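(* There are absolute constants (hidden in the $\Omega(\cdot)$ and $O(\cdot)$ below) such that the following holds. Let $\mathbf{A}\in\mathbb{R}^{n\times n}$ be real symmetric, $\mathbf{x}\in\mathbb{R}^n$ nonzero, $k\ge 1$ an integer, $0<\eta\le\|\mathbf{A}\|$, $0<\epsilon\le 1$, and let $f$ be a function with $|f(x)|<C$ for all $x\in[\lambda_{\min}(\mathbf{A})-\eta,\lambda_{\max}(\mathbf{A})+\eta]$. Let $B=\log\left(\frac{nk\|\mathbf{A}\|}{\epsilon\eta}\right)$. Suppose the Lanczos algorithm (described in the context) is run on $\mathbf{A},\mathbf{x},f$ for $k$ iterations on a computer satisfying Requirements 1 and 2 (see context) with relative precision $\epsilon_{mach}=2^{-\Omega(B)}$ (e.g. a floating-point computer using $\Omega(B)$ bits of precision), and that its final step, the computation of $\|\mathbf{x}\|\cdot\mathbf{Q}f(\mathbf{T})\mathbf{e}_1$, is carried out using the Gu–Eisenstat symmetric tridiagonal eigendecomposition algorithm (see context). Then the returned vector $\mathbf{y}$ satisfies $$\|f(\mathbf{A})\mathbf{x}-\mathbf{y}\|\le(7k\cdot\delta_k+\epsilon C)\|\mathbf{x}\|,$$ where $$\delta_k=\min_{\substack{\text{polynomial }p\\ \text{with degree}<k}}\left(\max_{x\in[\lambda_{\min}(\mathbf{A})-\eta,\lambda_{\max}(\mathbf{A})+\eta]}|p(x)-f(x)|\right).$$ The algorithm's runtime is $O(\mathrm{mv}(\mathbf{A})k+k^2B+kB^2)$, where $\mathrm{mv}(\mathbf{A})$ is the time required to multiply $\mathbf{A}$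 by a vector to the precision required by Requirement 2.
   Context: $\|\cdot\|$ is the Euclidean norm for vectors and the spectral norm for matrices. For symmetric $\mathbf{M}=\mathbf{V}\mathbf{\Lambda}\mathbf{V}^T$, $f(\mathbf{M})=\mathbf{V}f(\mathbf{\Lambda})\mathbf{V}^T$ with $f$ applied to each diagonal entry. $\mathbf{e}_1$ is the first standard basis vector. Floating-point model. $\mathrm{fl}(\cdot)$ denotes the computed result. Requirement 1: for $\circ\in\{+,-,\times,\div\}$, $\mathrm{fl}(x\circ y)=(1+\delta)(x\circ y)$ and $\mathrm{fl}(\sqrt{x})=(1+\delta)\sqrt{x}$ with $|\delta|\le\epsilon_{mach}$. Requirement 2: for every $\mathbf{w}\in\mathbb{R}^n$, $\|\mathrm{fl}(\mathbf{A}\mathbf{w})-\mathbf{A}\mathbf{w}\|\le 2n^{3/2}\|\mathbf{A}\|\|\mathbf{w}\|\epsilon_{mach}$. Overflow and underflow are ignored. Runtimes are in the unit-cost RAM model (each floating-point operation or square root costs $O(1)$), and $f$ can be evaluated to relative error $\epsilon_{mach}$ in $O(1)$ time. It is assumed that $\mathrm{mv}(\mathbf{A})=\Omega(n)$. Lanczos algorithm (input symmetric $\mathbf{A}$, number of iterations $k$, vector $\mathbf{x}$, function $f$): set $\mathbf{q}_0=\mathbf{0}$, $\mathbf{q}_1=\mathbf{x}/\|\mathbf{x}\|$, $\beta_1=0$. For $i=1,\dots,k$: $\mathbf{q}_{i+1}\leftarrow\mathbf{A}\mathbf{q}_i-\beta_i\mathbf{q}_{i-1}$; $\alpha_i\leftarrow\langle\mathbf{q}_{i+1},\mathbf{q}_i\rangle$;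 $\mathbf{q}_{i+1}\leftarrow\mathbf{q}_{i+1}-\alpha_i\mathbf{q}_i$; $\beta_{i+1}\leftarrow\|\mathbf{q}_{i+1}\|$; if $\beta_{i+1}=0$ exit the loop; $\mathbf{q}_{i+1}\leftarrow\mathbf{q}_{i+1}/\beta_{i+1}$. Let $\mathbf{T}$ be the symmetric tridiagonal $k\times k$ matrix with diagonal $\alpha_1,\dots,\alpha_k$ and off-diagonal $\beta_2,\dots,\beta_k$, and $\mathbf{Q}=[\mathbf{q}_1,\dots,\mathbf{q}_k]$ (if the loop exits early at iteration $i$, use the first $i$ coefficients and vectors). Return $\mathbf{y}=\|\mathbf{x}\|\cdot\mathbf{Q}f(\mathbf{T})\mathbf{e}_1$. Gu–Eisenstat algorithm. For a symmetric tridiagonal $\mathbf{T}\in\mathbb{R}^{k\times k}$ and a parameter $\epsilon_1$ with $ck^3\log k\cdot\epsilon_{mach}\le\epsilon_1\le 1/2$ ($c$ a fixed constant), it runs in $O(k^2\log\frac{k}{\epsilon_1}+k\log^2\frac{k}{\epsilon_1})$ time on a computer satisfying Requirements 1 and 2 with relative precision $\epsilon_{mach}$ (Requirement 2 being understood for the matrix-vector products the algorithm performs) and outputs $\tilde{\mathbf{V}}\in\mathbb{R}^{k\times k}$ and diagonal $\tilde{\mathbf{\Lambda}}$ with $\|\tilde{\mathbf{V}}\tilde{\mathbf{\Lambda}}\tilde{\mathbf{V}}^T-\mathbf{T}\|\le\epsilon_1\|\mathbf{T}\|$ and $\|\tilde{\mathbf{V}}^T\tilde{\mathbf{V}}-\mathbf{I}\|\le\epsilon_1$.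 In the final step it is called with $\epsilon_1=\left(\frac{\epsilon\eta}{3nk\|\mathbf{A}\|}\right)^{c'}$ for a sufficiently large absolute constant $c'$, and $\mathbf{y}$ is the result of computing, in floating point, $\|\mathbf{x}\|\cdot\mathbf{Q}(\tilde{\mathbf{V}}f(\tilde{\mathbf{\Lambda}})\tilde{\mathbf{V}}^T\mathbf{e}_1)$. Asymptotic notation: $\epsilon_{mach}=2^{-\Omega(B)}$ means $\epsilon_{mach}\le 2^{-c_0\max(B,1)}$ for a sufficiently large absolute constant $c_0$; in $O(\cdot)$ bounds $B$ is likewise read as $\max(B,1)$. *)

(* Defs.v *)
From mathcomp Require Import all_boot all_order all_algebra.
From mathcomp Require Import all_classical all_reals all_analysis.

Set Implicit Arguments.
Unset Strict Implicit.
Unset Printing Implicit Defensive.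

Import Order.TTheory GRing.Theory Num.Theory.

Local Open Scope classical_set_scope.
Local Open Scope ring_scope.

Definition log2 (R : realType) (x : R) : R := ln x / ln 2.

Section LinearAlgebra.
Variable R : realType.

(* The norm `|_| that the library puts on matrices is the max norm. *)
Definition vnorm n (v : 'cV[R]_n) : R := Num.sqrt (\sum_i v i 0 ^+ 2).

Definition opnorm m n (M : 'M[R]_(m, n)) : R :=
  sup [set vnorm (M *m v) | v in [set v : 'cV[R]_n | vnorm v <= 1]].

(* For a symmetric matrix of positive size the set of eigenvalues is finite and
   nonempty, so inf and sup are attained. *)
Definition lambda_min n (A : 'M[R]_n) : R := inf [set a | eigenvalue A a].
Definition lambda_max n (A : 'M[R]_n) : R := sup [set a | eigenvalue A a].

(* The set below is a singleton when M is symmetric: V f(L) V^T does not depend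
   on the orthogonal diagonalization V L V^T of M. *)
Definition mxfun n (f : R -> R) (M : 'M[R]_n) : 'M[R]_n :=
  xget 0 [set F | exists (V : 'M[R]_n) (d : 'rV[R]_n),
    [/\ V^T *m V = 1%:M,
        M = V *m diag_mx d *m V^T &
        F = V *m diag_mx (map_mx f d) *m V^T]].

Definition is_tridiagonal n (T : 'M[R]_n) : Prop :=
  forall i j : 'I_n, (i.+1 < j)%N || (j.+1 < i)%N -> T i j = 0.

Definition spec_interval n (A : 'M[R]_n) (eta : R) : set R :=
  `[lambda_min A - eta, lambda_max A + eta].

(* Error of the best uniform approximation of f on D by polynomials of degree
   less than k.  The inner sup is a max when f is continuous; the outer inf is
   attained when D is a compact interval and f is bounded on it. *)
Definition best_approx (f : R -> R) (k : nat) (D : set R) : R :=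
  inf [set sup [set `|p.[x] - f x| | x in D]
      | p in [set p : {poly R} | (size p <= k)%N]].

End LinearAlgebra.

(* A computation is the set of its possible outcomes, a result paired with a
   running time.  Nondeterminism leaves open every rounding error permitted by
   the floating-point model, as well as the order in which sums are evaluated:
   the run of any particular computer is one of the outcomes. *)
Definition comp (T : Type) := T -> nat -> Prop.

Definition ret (T : Type) (x : T) : comp T := fun y t => y = x /\ t = 0%N.

Definition bind (T U : Type) (m : comp T) (g : T -> comp U) : comp U :=
  fun y t => exists x t1 t2, [/\ m x t1, g x y t2 & t = (t1 + t2)%N].

Notation "x <~ m ;; p" := (bind m (fun x => p))
  (at level 61, m at next level, right associativity).

(* Some outcome exists and every outcome satisfies P. *)
Definition always (T : Type) (m : comp T) (P : T -> nat -> Prop) : Prop :=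
  (exists y t, m y t) /\ (forall y t, m y t -> P y t).

Section FloatingPoint.
Variable R : realType.
(* Unit roundoff, and a bound on the time of one elementary operation. *)
Variables (u : R) (kappa : nat).

(* fl z is the rounded evaluation of an elementary operation with exact result
   z: one of + - * / and square root, or one evaluation of the function f. *)
Definition fl (z : R) : comp R := fun r t =>
  (exists2 d : R, `|d| <= u & r = (1 + d) * z) /\ (t <= kappa)%N.

Definition fl_iszero (z : R) : comp bool := fun b t =>
  b = (z == 0) /\ (t <= kappa)%N.

Definition fl_col n (F : 'I_n -> comp R) : comp 'cV[R]_n := fun y t =>
  exists2 tau : 'I_n -> nat,
    (forall i, F i (y i 0) (tau i)) & t = (\sum_i tau i)%N.

(* Summation in an arbitrary order and with arbitrary bracketing. *)
Inductive fl_sum : seq R -> comp R :=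
| fl_sum_nil : fl_sum [::] 0 0%N
| fl_sum_one x : fl_sum [:: x] x 0%N
| fl_sum_add s s1 s2 a b r t1 t2 t3 :
    perm_eq s (s1 ++ s2) -> s1 <> [::] -> s2 <> [::] ->
    fl_sum s1 a t1 -> fl_sum s2 b t2 -> fl (a + b) r t3 ->
    fl_sum s r (t1 + t2 + t3)%N.

Definition fl_dot n (v w : 'cV[R]_n) : comp R :=
  p <~ fl_col (fun i => fl (v i 0 * w i 0)) ;;
  fl_sum [seq p i 0 | i <- enum 'I_n].

Definition fl_norm n (v : 'cV[R]_n) : comp R :=
  s <~ fl_dot v v ;; fl (Num.sqrt s).

Definition fl_sub n (v w : 'cV[R]_n) : comp 'cV[R]_n :=
  fl_col (fun i => fl (v i 0 - w i 0)).

Definition fl_scale n (a : R) (v : 'cV[R]_n) : comp 'cV[R]_n :=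
  fl_col (fun i => fl (a * v i 0)).

Definition fl_vdiv n (v : 'cV[R]_n) (a : R) : comp 'cV[R]_n :=
  fl_col (fun i => fl (v i 0 / a)).

Definition fl_mulmv m n (M : 'M[R]_(m, n)) (v : 'cV[R]_n) : comp 'cV[R]_m :=
  fl_col (fun i => fl_dot (row i M)^T v).

(* Multiplication by the input matrix A takes time mv and is only assumed to
   satisfy the normwise error bound below. *)
Definition mul_input n (A : 'M[R]_n) (mv : nat) (w : 'cV[R]_n) : comp 'cV[R]_n :=
  fun z t =>
    vnorm (z - A *m w) <= 2 * n%:R `^ (3 / 2) * opnorm A * vnorm w * u /\ t = mv.

(* Specification of the Gu-Eisenstat eigensolver: c is the constant in its
   precision requirement and K the constant in its running time.  Positivity of
   e does not follow from the precision requirement when m = 1 or u = 0, and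
   without it the error bounds would be unsatisfiable for e < 0. *)
Definition eigensolver := forall m : nat, 'M[R]_m -> R -> comp ('M[R]_m * 'rV[R]_m).

Definition gu_eisenstat (c K : R) (ge : eigensolver) : Prop :=
  forall (m : nat) (T : 'M[R]_m) (e : R),
    (0 < m)%N -> T^T = T -> is_tridiagonal T ->
    0 < e -> c * m%:R ^+ 3 * log2 m%:R * u <= e -> e <= 1 / 2 ->
    always (ge m T e) (fun VL t =>
      [/\ opnorm (VL.1 *m diag_mx VL.2 *m VL.1^T - T) <= e * opnorm T,
          opnorm (VL.1^T *m VL.1 - 1%:M) <= e &
          t%:R <= K * (m%:R ^+ 2 * log2 (m%:R / e)
                       + m%:R * log2 (m%:R / e) ^+ 2)]).

Section Lanczos.
Variables (n : nat) (A : 'M[R]_n) (mv : nat).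

(* r iterations remain; qp, q and b are q_(i-1), q_i and beta_i.  The
   accumulators end up as q_1 .. q_m, alpha_1 .. alpha_m and beta_1 .. beta_m,
   where m is the number of iterations performed. *)
Fixpoint lanczos_loop (r : nat) (qs : seq 'cV[R]_n) (als bes : seq R)
    (qp q : 'cV[R]_n) (b : R) : comp (seq 'cV[R]_n * seq R * seq R) :=
  if r is r'.+1 then
    v <~ mul_input A mv q ;;
    bq <~ fl_scale b qp ;;
    w <~ fl_sub v bq ;;
    a <~ fl_dot w q ;;
    aq <~ fl_scale a q ;;
    w' <~ fl_sub w aq ;;
    b' <~ fl_norm w' ;;
    stop <~ fl_iszero b' ;;
    (if stop then ret (rcons qs q, rcons als a, rcons bes b)
     else
       q' <~ fl_vdiv w' b' ;;
       lanczos_loop r' (rcons qs q) (rcons als a) (rcons bes b) q q' b')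
  else ret (qs, als, bes).

Definition tridiag (m : nat) (als bes : seq R) : 'M[R]_m :=
  \matrix_(i < m, j < m)
    if i == j :> nat then als`_i
    else if j == i.+1 :> nat then bes`_j
    else if i == j.+1 :> nat then bes`_i
    else 0.

Definition lanczos (ge : eigensolver) (e1 : R) (k : nat) (x : 'cV[R]_n)
    (f : R -> R) : comp 'cV[R]_n :=
  nx <~ fl_norm x ;;
  q1 <~ fl_vdiv x nx ;;
  out <~ lanczos_loop k [::] [::] [::] 0 q1 0 ;;
  let: (qs, als, bes) := out in
  let m := size als in
  let Q : 'M[R]_(n, m) := \matrix_(i, j) (qs`_j) i 0 in
  VL <~ ge m (tridiag m als bes) e1 ;;
  g <~ fl_col (fun i => fl (f (VL.2 0 i))) ;;
  w1 <~ fl_mulmv VL.1^T (\col_(i < m) ((i : nat) == 0%N)%:R) ;;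
  w2 <~ fl_col (fun i => fl (g i 0 * w1 i 0)) ;;
  w3 <~ fl_mulmv VL.1 w2 ;;
  w4 <~ fl_mulmv Q w3 ;;
  fl_scale nx w4.

End Lanczos.
End FloatingPoint.

(* Main.v *)
(* Write Q for the computed Lanczos vectors and T for the computed tridiagonal
   matrix.  Rounding only perturbs the recurrence, A Q = Q T + b q e_m^T + E
   with E tiny, and b q disappears after a breakdown.

   Paige's theorem locates the spectrum of T, although Q may be far from
   orthogonal.  Let T_j be the leading blocks of T and suppose that T_j has an
   eigenvalue mu above lambda_max(A) + j Delta while the smaller blocks do not.
   For the eigenvector y of mu, the numbers c_t = <sum_(s<t) y_s q_s, q_t>
   nearly satisfy the recurrence that defines y, so their Casoratian with y is
   tiny; the gap between mu and the smaller blocks bounds beta_t y_(t-1) y_t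
   below, whence c_t / y_t is tiny.  So |Q y|^2 is close to |y|^2, and the
   Rayleigh quotient of A at Q y is close to mu, a contradiction.

   On an interval containing both spectra, Chebyshev polynomials T_i obey
   T_i(A) q_1 ~ Q T_i(T) e_1: the defect solves the Chebyshev recurrence with a
   small source, and U_j(A) grows only linearly in j.  A polynomial bounded by M
   has Chebyshev coefficients at most 2 M, by discrete orthogonality at the
   Chebyshev nodes, so p(A) q_1 ~ Q p(T) e_1 for every p of degree less than k;
   here e_m^T T_i(T) e_1 = 0 removes the term b q e_m^T.  The same transfer, with
   T, V and L in place of A, Q and T, handles the approximate
   eigendecomposition V L V^T of T.  Applied to a near-best approximation p of f
   this gives the error bound; powers of 2^B dominate n, k and |A| / (eps eta). *)

Require Import Defs.
From mathcomp Require Import all_boot all_order all_algebra.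
From mathcomp Require Import all_classical all_reals all_analysis.
From mathcomp Require Import spectral complex ring lra zify.

Set Implicit Arguments.
Unset Strict Implicit.
Unset Printing Implicit Defensive.

Import Order.TTheory GRing.Theory Num.Theory.

Local Open Scope classical_set_scope.
Local Open Scope ring_scope.

(** * Euclidean norm and spectral theorem *)

Section Euclidean.
Variable R : realType.

(** Every loss must stay polynomial in n, k and |A| / (eps eta), since a precision of O(B) bits pays
    for nothing larger. Hence polynomials are expanded in the Chebyshev basis, while monomial
    coefficients could be exponentially large in k, and Paige's induction adds only [Delta] per
    block. With [Delta] = eta / (2 k) the Ritz values use half of the margin eta; the other half is
    left to the perturbation caused by the eigensolver. The lower end of the spectrum follows from
    the upper one by negating A.

    A single [gam] controls the rounding of all compound operations. The a priori growth of beta_t,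
    at most 2 |A| per step, turns relative roundings into absolute errors of order gam k |A|.

    The polynomial p is within delta_k + eps C / (12 k) of f, hence bounded by 3 C, since p = 0
    already shows delta_k <= C. The factor 7 k has room: f(A) against p(A) costs one delta_k, and
    f(L) against p(L) costs 4 k delta_k up to roundings, with a factor 2 from each of V and V^T and
    k from the norm of Q. *)

Definition dotv n (v w : 'cV[R]_n) : R := \sum_i v i 0 * w i 0.

Lemma dotvC n (v w : 'cV[R]_n) : dotv v w = dotv w v.
Proof. by apply: eq_bigr => i _; rewrite mulrC. Qed.

Lemma dotvDl n (u v w : 'cV[R]_n) : dotv (u + v) w = dotv u w + dotv v w.
Proof. by rewrite -big_split; apply: eq_bigr => i _; rewrite mxE mulrDl. Qed.

Lemma dotvDr n (u v w : 'cV[R]_n) : dotv w (u + v) = dotv w u + dotv w v.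
Proof. by rewrite dotvC dotvDl !(dotvC w). Qed.

Lemma dotvZl n a (v w : 'cV[R]_n) : dotv (a *: v) w = a * dotv v w.
Proof. by rewrite mulr_sumr; apply: eq_bigr => i _; rewrite mxE mulrA. Qed.

Lemma dotvZr n a (v w : 'cV[R]_n) : dotv w (a *: v) = a * dotv w v.
Proof. by rewrite dotvC dotvZl dotvC. Qed.

Lemma dotvNl n (v w : 'cV[R]_n) : dotv (- v) w = - dotv v w.
Proof. by rewrite -scaleN1r dotvZl mulN1r. Qed.

Lemma dotvNr n (v w : 'cV[R]_n) : dotv w (- v) = - dotv w v.
Proof. by rewrite dotvC dotvNl dotvC. Qed.

Lemma dot0v n (w : 'cV[R]_n) : dotv 0 w = 0.
Proof. by rewrite -(scale0r w) dotvZl mul0r. Qed.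

Lemma dotv0 n (w : 'cV[R]_n) : dotv w 0 = 0.
Proof. by rewrite dotvC dot0v. Qed.

Definition dotvE := (dotvDl, dotvDr, dotvZl, dotvZr, dotvNl, dotvNr, dot0v, dotv0).

Lemma dotv_suml n I (r : seq I) (P : pred I) (F : I -> 'cV[R]_n) w :
  dotv (\sum_(i <- r | P i) F i) w = \sum_(i <- r | P i) dotv (F i) w.
Proof.
by elim/big_rec2: _ => [|i x y _ <-]; rewrite ?dot0v ?dotvDl.
Qed.

Lemma dotvv_ge0 n (v : 'cV[R]_n) : 0 <= dotv v v.
Proof. by apply: sumr_ge0 => i _; rewrite -expr2 sqr_ge0. Qed.

Lemma dotvv_eq0 n (v : 'cV[R]_n) : (dotv v v == 0) = (v == 0).
Proof.
apply/eqP/eqP => [|->]; last by rewrite dot0v.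
move/eqP; rewrite psumr_eq0; last by move=> i _; rewrite -expr2 sqr_ge0.
move/allP => v0; apply/colP => i; rewrite mxE.
by have := v0 i (mem_index_enum i); rewrite mulf_eq0 orbb => /eqP.
Qed.

Lemma vnormE n (v : 'cV[R]_n) : vnorm v = Num.sqrt (dotv v v).
Proof. by congr Num.sqrt; apply: eq_bigr => i _; rewrite expr2. Qed.

Lemma vnorm_ge0 n (v : 'cV[R]_n) : 0 <= vnorm v.
Proof. exact: sqrtr_ge0. Qed.

Lemma sqr_vnorm n (v : 'cV[R]_n) : vnorm v ^+ 2 = dotv v v.
Proof. by rewrite vnormE sqr_sqrtr // dotvv_ge0. Qed.

Lemma vnorm_eq0 n (v : 'cV[R]_n) : (vnorm v == 0) = (v == 0).
Proof. by rewrite -sqrf_eq0 sqr_vnorm dotvv_eq0. Qed.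

Lemma vnorm_gt0 n (v : 'cV[R]_n) : (0 < vnorm v) = (v != 0).
Proof. by rewrite lt_neqAle vnorm_ge0 andbT eq_sym vnorm_eq0. Qed.

Lemma vnorm0 n : vnorm (0 : 'cV[R]_n) = 0.
Proof. by apply/eqP; rewrite vnorm_eq0. Qed.

Lemma vnormZ n a (v : 'cV[R]_n) : vnorm (a *: v) = `|a| * vnorm v.
Proof.
rewrite vnormE dotvZl dotvZr mulrA -expr2 sqrtrM ?sqr_ge0 //.
by rewrite sqrtr_sqr vnormE.
Qed.

Lemma vnormN n (v : 'cV[R]_n) : vnorm (- v) = vnorm v.
Proof. by rewrite -scaleN1r vnormZ normrN1 mul1r. Qed.

Lemma vnorm_subC n (v w : 'cV[R]_n) : vnorm (v - w) = vnorm (w - v).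
Proof. by rewrite -vnormN opprB. Qed.

Lemma le_vnorm n (v : 'cV[R]_n) (b : R) :
  0 <= b -> dotv v v <= b ^+ 2 -> vnorm v <= b.
Proof.
move=> b0 h; rewrite -(@ler_pXn2r _ 2) // ?nnegrE ?vnorm_ge0 //.
by rewrite sqr_vnorm.
Qed.

(** Cauchy-Schwarz, from the square of [dotv w w *: v - dotv v w *: w]; the case w = 0 is separate
    because the inequality is divided by [dotv w w]. *)
Lemma dotv_le n (v w : 'cV[R]_n) : `|dotv v w| <= vnorm v * vnorm w.
Proof.
rewrite -(@ler_pXn2r _ 2) // ?nnegrE ?mulr_ge0 ?vnorm_ge0 //.
rewrite exprMn !sqr_vnorm real_normK ?num_real //.
have [->|w0] := eqVneq w 0; first by rewrite !dotv0 expr0n mulr0.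
have ww : 0 < dotv w w by rewrite lt_neqAle dotvv_ge0 eq_sym dotvv_eq0 w0.
have := dotvv_ge0 (dotv w w *: v - dotv v w *: w).
rewrite !dotvE (dotvC w v) => h.
have : 0 <= dotv w w * (dotv v v * dotv w w - dotv v w ^+ 2) by lra.
by rewrite pmulr_rge0 // subr_ge0.
Qed.

Lemma dotv_bound n (v w : 'cV[R]_n) (a b : R) :
  vnorm v <= a -> vnorm w <= b -> `|dotv v w| <= a * b.
Proof.
by move=> va wb; apply: le_trans (dotv_le v w) _; apply: ler_pM; rewrite ?vnorm_ge0.
Qed.

Lemma vnormD n (v w : 'cV[R]_n) : vnorm (v + w) <= vnorm v + vnorm w.
Proof.
apply: le_vnorm; first by rewrite addr_ge0 ?vnorm_ge0.
have h := le_trans (ler_norm _) (dotv_le v w).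
by rewrite !dotvE (dotvC w v) sqrrD !sqr_vnorm; lra.
Qed.

Lemma vnormB n (v w : 'cV[R]_n) : vnorm (v - w) <= vnorm v + vnorm w.
Proof. by rewrite -(vnormN w) vnormD. Qed.

Lemma vnorm_le_sub n (v w : 'cV[R]_n) : vnorm v <= vnorm w + vnorm (v - w).
Proof. by rewrite -{1}(subrKC w v) vnormD. Qed.

Lemma vnorm_sum n I (r : seq I) (P : pred I) (F : I -> 'cV[R]_n) :
  vnorm (\sum_(i <- r | P i) F i) <= \sum_(i <- r | P i) vnorm (F i).
Proof.
elim/big_ind2: _ => [|x1 x2 y1 y2 h1 h2|//]; first by rewrite vnorm0.
by apply: le_trans (vnormD _ _) _; apply: lerD.
Qed.

Lemma entry_le_vnorm n (v : 'cV[R]_n) i : `|v i 0| <= vnorm v.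
Proof.
rewrite -(@ler_pXn2r _ 2) // ?nnegrE ?vnorm_ge0 // sqr_vnorm.
rewrite real_normK ?num_real // /dotv (bigD1 i) //= expr2 lerDl.
by apply: sumr_ge0 => j _; rewrite -expr2 sqr_ge0.
Qed.

Lemma vnorm_le_entries n (v : 'cV[R]_n) (b : R) :
  (forall i, `|v i 0| <= b) -> vnorm v <= n%:R * b.
Proof.
case: n v => [|n] v h.
  by rewrite flatmx0 vnorm0 mul0r.
have b0 : 0 <= b := le_trans (normr_ge0 _) (h ord0).
apply: le_vnorm; first by rewrite mulr_ge0.
apply: (@le_trans _ _ (\sum_(i < n.+1) b ^+ 2)).
  apply: ler_sum => i _; rewrite -expr2 -real_normK ?num_real //.
  by rewrite ler_pXn2r // nnegrE.
rewrite sumr_const card_ord exprMn -[leLHS]mulr_natl.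
apply: ler_wpM2r; first exact: sqr_ge0.
by rewrite -natrX ler_nat -{1}(expn1 n.+1) leq_pexp2l.
Qed.

Lemma le_vnorm_entries n (v w : 'cV[R]_n) (b : R) : 0 <= b ->
  (forall i, `|v i 0| <= b * `|w i 0|) -> vnorm v <= b * vnorm w.
Proof.
move=> b0 h; apply: le_vnorm; first by rewrite mulr_ge0 ?vnorm_ge0.
rewrite exprMn sqr_vnorm mulr_sumr; apply: ler_sum => i _.
rewrite -!expr2 -[in leLHS]real_normK ?num_real //.
rewrite -[in leRHS](@real_normK _ (w i 0)) ?num_real // -exprMn.
by rewrite ler_pXn2r // nnegrE ?mulr_ge0.
Qed.

Lemma dotvM m n (M : 'M[R]_(m, n)) v w : dotv (M *m v) w = dotv v (M^T *m w).
Proof.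
rewrite /dotv; under eq_bigr do rewrite mxE mulr_suml.
rewrite exchange_big /=; apply: eq_bigr => j _; rewrite mxE mulr_sumr.
by apply: eq_bigr => i _; rewrite mxE; ring.
Qed.

Lemma dotv_trM m n (M : 'M[R]_(m, n)) v w : dotv v (M *m w) = dotv (M^T *m v) w.
Proof. by rewrite dotvM trmxK. Qed.

Lemma vnorm_orthogonal m n (V : 'M[R]_(m, n)) v :
  V^T *m V = 1%:M -> vnorm (V *m v) = vnorm v.
Proof. by move=> VV; rewrite !vnormE dotvM mulmxA VV mul1mx. Qed.

(** Finiteness of the supremum in [opnorm], without which [sup] would carry no information; the sum
    of the column norms is crude but enough. *)
Lemma opnorm_bounded m n (M : 'M[R]_(m, n)) :
  exists2 b, 0 <= b & forall v, vnorm (M *m v) <= b * vnorm v.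
Proof.
exists (\sum_j vnorm (col j M)); first by apply: sumr_ge0 => j _; exact: vnorm_ge0.
move=> v; have -> : M *m v = \sum_j v j 0 *: col j M.
  apply/colP => i; rewrite mxE summxE; apply: eq_bigr => j _.
  by rewrite !mxE mulrC.
apply: le_trans (vnorm_sum _ _ _) _; rewrite mulr_suml; apply: ler_sum => j _.
by rewrite vnormZ mulrC ler_wpM2l ?vnorm_ge0 // entry_le_vnorm.
Qed.

Lemma opnorm_set_ub m n (M : 'M[R]_(m, n)) :
  has_ubound [set vnorm (M *m v) | v in [set v : 'cV[R]_n | vnorm v <= 1]].
Proof.
have [b b0 hb] := opnorm_bounded M; exists b => _ [v /= v1 <-].
by apply: le_trans (hb v) _; rewrite -[leRHS]mulr1 ler_wpM2l.
Qed.

Lemma opnorm_ge0 m n (M : 'M[R]_(m, n)) : 0 <= opnorm M.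
Proof.
apply: (ub_le_sup (opnorm_set_ub M)); exists 0 => /=; first by rewrite vnorm0.
by rewrite mulmx0 vnorm0.
Qed.

Lemma opnormP m n (M : 'M[R]_(m, n)) v : vnorm (M *m v) <= opnorm M * vnorm v.
Proof.
have [->|v0] := eqVneq v 0; first by rewrite mulmx0 !vnorm0 mulr0.
have nv : 0 < vnorm v by rewrite vnorm_gt0.
rewrite -ler_pdivrMr //; apply: (ub_le_sup (opnorm_set_ub M)).
exists ((vnorm v)^-1 *: v) => /=.
  by rewrite vnormZ ger0_norm ?invr_ge0 ?vnorm_ge0 // mulVf // gt_eqF.
by rewrite -scalemxAr vnormZ ger0_norm ?invr_ge0 ?vnorm_ge0 // mulrC.
Qed.

Lemma opnorm_le m n (M : 'M[R]_(m, n)) b :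
  0 <= b -> (forall v, vnorm (M *m v) <= b * vnorm v) -> opnorm M <= b.
Proof.
move=> b0 hb; apply: ge_sup; first by exists (vnorm (M *m 0)), 0; rewrite //= vnorm0.
move=> _ [v /= v1 <-]; apply: le_trans (hb v) _.
by rewrite -[leRHS]mulr1 ler_wpM2l.
Qed.

End Euclidean.

(** * Orthogonal diagonalization of real symmetric matrices *)

Section Spectral.
Variable R : realType.

(** Over the complex numbers the matrix is Hermitian, so its spectral diagonal is real; an
    eigenvalue of the complexified matrix that comes from R is an eigenvalue of the real one. *)
Lemma symmetric_eigenvalue n (A : 'M[R]_n.+1) :
  A^T = A -> exists a, eigenvalue A a.
Proof.
move=> As; pose AC := map_mx (real_complex R) A.
have AC_herm : AC \is hermsymmx.
  apply: realsym_hermsym; first by apply/is_hermitianmxP;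
    rewrite expr0 scale1r map_mx_id // map_trmx As.
  by apply/mxOverP => i j; rewrite mxE; apply/complex_realP; exists (A i j).
have /orthomx_spectralP ACE := hermitian_normalmx AC_herm.
have /mxOverP /(_ 0 0) /complex_realP [a da] := hermitian_spectral_diag_real AC_herm.
have PA : row 0 (spectralmx AC) *m AC =
    (real_complex R a) *: row 0 (spectralmx AC).
  rewrite -row_mul [X in _ *m X]ACE !mulmxA mulmxV ?spectral_unit // mul1mx.
  by rewrite row_mul row_diag_mx da -scalemxAl -rowE.
exists a; rewrite -(eigenvalue_map (real_complex R)); apply/eigenvalueP.
exists (row 0 (spectralmx AC)); [exact: PA|].
apply/eqP => r0; have := spectral_unit AC.
rewrite -row_free_unit -kermx_eq0 => /eqP k0.
have /sub_kermxP : delta_mx 0 0 *m spectralmx AC = 0 :> 'rV_n.+1 by rewrite -rowE.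
rewrite k0 submx0 => /eqP /matrixP /(_ 0 0); rewrite !mxE !eqxx /= => /eqP.
by rewrite oner_eq0.
Qed.

(** Reflection in the hyperplane orthogonal to w = q - e_0, which exchanges the two unit vectors;
    for w = 0 the identity serves. *)
Lemma householder n (q : 'cV[R]_n.+1) : dotv q q = 1 ->
  exists H : 'M[R]_n.+1, [/\ H^T = H, H *m H = 1%:M & H *m delta_mx 0 0 = q].
Proof.
move=> q1; pose e : 'cV[R]_n.+1 := delta_mx 0 0; pose w := q - e.
have [w0|w0] := eqVneq w 0.
  exists 1%:M; split; rewrite ?trmx1 ?mulmx1 ?mul1mx //.
  by apply/esym/eqP; rewrite -subr_eq0 -/e -/w w0.
have ee : dotv e e = 1.
  rewrite /dotv (bigD1 0) //= big1 ?addr0 ?mxE ?mulr1 // => i i0.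
  by rewrite mxE (negPf i0) mul0r.
have ww0 : dotv w w != 0 by rewrite dotvv_eq0.
have dotvmx (a b : 'cV[R]_n.+1) : a^T *m b = (dotv a b)%:M.
  apply/matrixP => i j; rewrite !mxE !ord1 eqxx mulr1n.
  by apply: eq_bigr => l _; rewrite mxE.
pose c := 2 / dotv w w.
(* For unit vectors |q - e|^2 = 2 - 2 q.e while w.e = q.e - 1; this makes c (w.e) = -1 below. *)
have wwE : dotv w w = - 2 * dotv w e.
  by rewrite /w !dotvE q1 ee (dotvC e q); ring.
exists (1%:M - c *: (w *m w^T)); split.
- by rewrite linearB linearZ /= trmx_mul trmxK trmx1.
- rewrite mulmxBl mul1mx mulmxBr mulmx1 -scalemxAl -scalemxAr mulmxA.
  rewrite -(mulmxA w) dotvmx mul_mx_scalar -scalemxAl !scalerA.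
  have -> : c * (c * dotv w w) = c + c by rewrite /c; field.
  by rewrite scalerDl opprB addrK subrK.
- rewrite mulmxBl mul1mx -/e -scalemxAl -mulmxA dotvmx mul_mx_scalar scalerA.
  have -> : c * dotv w e = - 1.
    rewrite /c wwE; have we0 : dotv w e != 0.
      by move: ww0; rewrite wwE mulf_eq0 negb_or => /andP[].
    by field.
  by rewrite scaleN1r opprK /w addrC subrK.
Qed.

Definition diagonalizes n (V : 'M[R]_n) (d : 'rV[R]_n) (A : 'M[R]_n) :=
  V^T *m V = 1%:M /\ A = V *m diag_mx d *m V^T.

(* Deflation by the Householder reflection that sends e_0 to a unit eigenvector. *)
Lemma symmetric_diagonalizable n (A : 'M[R]_n) :
  A^T = A -> exists V d, diagonalizes V d A.
Proof.
elim: n A => [|n IH] A As.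
  by exists 1%:M, 0; split; apply/matrixP => -[].
have [a /eigenvalueP [v vA v0]] := symmetric_eigenvalue As.
pose nv := vnorm v^T; have nv0 : nv != 0 by rewrite vnorm_eq0 trmx_eq0.
pose q := nv^-1 *: v^T.
have Aq : A *m q = a *: q.
  by rewrite -scalemxAr -{1}As -trmx_mul vA linearZ /= !scalerA mulrC.
have q1 : dotv q q = 1 by rewrite /q !dotvE -sqr_vnorm -/nv; field.
have [H [Hs HH He]] := householder q1.
have [B BH] : {B : 'M[R]_(1 + n) | B = H *m A *m H} by exists (H *m A *m H).
have Bs : B^T = B by rewrite BH !trmx_mul Hs As mulmxA.
have Be : B *m delta_mx 0 0 = a *: delta_mx 0 0 :> 'cV_(1 + n).
  rewrite BH -(mulmxA _ H) He -mulmxA Aq -scalemxAr -He mulmxA HH.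
  by rewrite mul1mx.
have Bi0 i : B i 0 = a * (i == 0)%:R.
  by move/colP/(_ i): Be; rewrite -colE !mxE eqxx andbT.
have BE : B = block_mx a%:M 0 0 (drsubmx B).
  rewrite -{1}(submxK B); congr block_mx; apply/matrixP => i j.
  - by rewrite !mxE !ord1 eqxx mulr1n -[RHS]mulr1 lshift0 Bi0.
  - by rewrite -Bs !mxE !ord1 lshift0 Bi0 /= mulr0.
  - by rewrite !mxE !ord1 lshift0 Bi0 /= mulr0.
have [V' [d' [V'1 B'E]]] : exists V' d', diagonalizes V' d' (drsubmx B).
  by apply: IH; rewrite trmx_drsub Bs.
pose W : 'M[R]_(1 + n) := block_mx 1%:M 0 0 V'.
have WW : W^T *m W = 1%:M.
  rewrite tr_block_mx (@mulmx_block _ 1 n 1 n 1 n).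
  rewrite !trmx0 !mul0mx !mulmx0 !addr0 add0r trmx1 mulmx1 V'1.
  by rewrite -scalar_mx_block.
have WB : W *m diag_mx (row_mx a%:M d') *m W^T = B.
  rewrite BE diag_mx_row tr_block_mx.
  rewrite (@mulmx_block _ 1 n 1 n 1 n) (@mulmx_block _ 1 n 1 n 1 n).
  rewrite !trmx0 !mul0mx !mulmx0 !addr0 !add0r trmx1 mulmx1 mul1mx -B'E.
  congr block_mx; rewrite ?mul0mx ?mulmx1 //.
  by apply/matrixP => i j; rewrite !ord1 !mxE eqxx !mulr1n.

exists (H *m W : 'M[R]_(1+n)), (row_mx a%:M d'); split.
  by rewrite trmx_mul Hs mulmxA -(mulmxA W^T) HH mulmx1.
rewrite trmx_mul Hs mulmxA -(mulmxA H) -(mulmxA H) WB.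
by rewrite BH !mulmxA HH mul1mx -mulmxA HH mulmx1.
Qed.

End Spectral.

(** * Norms, quadratic forms and eigenvalues read off a diagonalization *)

Section SpectralBounds.
Variable R : realType.
Implicit Types (n : nat).

Lemma diagonalizes_tr n (V : 'M[R]_n) d A : diagonalizes V d A -> V *m V^T = 1%:M.
Proof. by case=> VV _; apply: mulmx1C. Qed.

Lemma diag_mx_mulE n (d : 'rV[R]_n) (v : 'cV[R]_n) i :
  (diag_mx d *m v) i 0 = d 0 i * v i 0.
Proof. by rewrite mul_diag_mx mxE. Qed.

Lemma vnorm_diag n (d : 'rV[R]_n) (v : 'cV[R]_n) b : 0 <= b ->
  (forall i, `|d 0 i| <= b) -> vnorm (diag_mx d *m v) <= b * vnorm v.
Proof.
move=> b0 db; apply: le_vnorm_entries => // i.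
by rewrite diag_mx_mulE normrM ler_wpM2r.
Qed.

Lemma vnorm_conj_diag n (V : 'M[R]_n) (d : 'rV[R]_n) (v : 'cV[R]_n) b :
  V^T *m V = 1%:M -> 0 <= b -> (forall i, `|d 0 i| <= b) ->
  vnorm (V *m diag_mx d *m V^T *m v) <= b * vnorm v.
Proof.
move=> VV b0 db; rewrite -!mulmxA vnorm_orthogonal //.
apply: le_trans (vnorm_diag _ b0 db) _; rewrite vnorm_orthogonal //.
by rewrite trmxK; apply: mulmx1C.
Qed.

Lemma eigenvector_diag n (V : 'M[R]_n) d A i : diagonalizes V d A ->
  A *m col i V = d 0 i *: col i V.
Proof.
move=> [VV ->]; rewrite !colE -!mulmxA (mulmxA V^T) VV mul1mx.
rewrite scalemxAr; congr (_ *m _).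
apply/colP => j; rewrite diag_mx_mulE !mxE eqxx andbT.
by case: eqP => [->|_]; rewrite ?mulr0.
Qed.

Lemma dotv_col_orthogonal n (V : 'M[R]_n) i :
  V^T *m V = 1%:M -> dotv (col i V) (col i V) = 1.
Proof.
move/matrixP/(_ i i); rewrite !mxE eqxx mulr1n => <-.
by apply: eq_bigr => j _; rewrite !mxE.
Qed.

Lemma vnorm_col_orthogonal n (V : 'M[R]_n) i :
  V^T *m V = 1%:M -> vnorm (col i V) = 1.
Proof. by move=> VV; rewrite vnormE dotv_col_orthogonal // sqrtr1. Qed.

Lemma quadratic_diag n (V : 'M[R]_n) d A z : diagonalizes V d A ->
  dotv z (A *m z) = \sum_i d 0 i * (V^T *m z) i 0 ^+ 2.
Proof.
move=> [VV ->]; rewrite -!mulmxA dotv_trM; apply: eq_bigr => i _.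
by rewrite diag_mx_mulE; ring.
Qed.

Lemma sum_sqr_orthogonal n (V : 'M[R]_n) (z : 'cV[R]_n) : V^T *m V = 1%:M ->
  \sum_i (V^T *m z) i 0 ^+ 2 = dotv z z.
Proof.
move=> VV; under eq_bigr do rewrite expr2.
by rewrite -/(dotv _ _) dotvM trmxK mulmxA (mulmx1C VV) mul1mx.
Qed.

Lemma quadratic_le n (V : 'M[R]_n) d A b z : diagonalizes V d A ->
  (forall i, d 0 i <= b) -> dotv z (A *m z) <= b * dotv z z.
Proof.
move=> VdA db; rewrite (quadratic_diag z VdA) -(sum_sqr_orthogonal z VdA.1).
by rewrite mulr_sumr; apply: ler_sum => i _; rewrite ler_wpM2r ?sqr_ge0.
Qed.

Lemma quadratic_ge n (V : 'M[R]_n) d A b z : diagonalizes V d A ->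
  (forall i, b <= d 0 i) -> b * dotv z z <= dotv z (A *m z).
Proof.
move=> VdA db; rewrite (quadratic_diag z VdA) -(sum_sqr_orthogonal z VdA.1).
by rewrite mulr_sumr; apply: ler_sum => i _; rewrite ler_wpM2r ?sqr_ge0.
Qed.

Lemma eigenvalue_diag n (V : 'M[R]_n) d A a : A^T = A -> diagonalizes V d A ->
  eigenvalue A a <-> exists i, a = d 0 i.
Proof.
move=> As VdA; have [VV AE] := VdA; split.
  move=> /eigenvalueP [v vA v0].
  have vV0 : v *m V != 0.
    apply: contraNneq v0 => vV.
    by rewrite -(mulmx1 v) -(diagonalizes_tr VdA) mulmxA vV mul0mx.
  have E : a *: (v *m V) = v *m V *m diag_mx d.
    by rewrite scalemxAl -vA AE -!mulmxA VV mulmx1.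
  have [i vi] : exists i, (v *m V) 0 i != 0.
    apply/existsP; apply: contraNT vV0 => /existsPn h.
    by apply/eqP/rowP => i; have := h i; rewrite negbK => /eqP ->; rewrite mxE.
  exists i; apply: (mulIf vi); move: (v *m V) E => w /rowP/(_ i).
  by rewrite mul_mx_diag !mxE => ->; rewrite mulrC.
move=> [i ->]; apply/eigenvalueP; exists (col i V)^T.
  by rewrite -{1}As -trmx_mul (eigenvector_diag i VdA) linearZ.
rewrite trmx_eq0; apply: contraTneq (oner_neq0 R) => c0.
by rewrite -(dotv_col_orthogonal i VV) c0 dot0v eqxx.
Qed.

Lemma lambda_bounds n (V : 'M[R]_n) d A i : A^T = A -> diagonalizes V d A ->
  lambda_min A <= d 0 i <= lambda_max A.
Proof.
move=> As VdA.
have ev j : [set a | eigenvalue A a] (d 0 j).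
  by apply/(eigenvalue_diag _ As VdA); exists j.
(* [inf] and [sup] bound a set only when it is bounded; any common bound on the eigenvalues will
   do. *)
have bnd a : [set a | eigenvalue A a] a -> `|a| <= \sum_j `|d 0 j|.
  move=> /(eigenvalue_diag _ As VdA) [j ->].
  by rewrite (bigD1 j) //= lerDl sumr_ge0.
apply/andP; split.
  apply: ge_inf (ev i); exists (- \sum_j `|d 0 j|) => a /bnd.
  by rewrite ler_norml => /andP[].
by apply: ub_le_sup (ev i); exists (\sum_j `|d 0 j|) => a /bnd /ler_normlW.
Qed.

Lemma eigenvalue_le_opnorm n (V : 'M[R]_n) d A i : diagonalizes V d A ->
  `|d 0 i| <= opnorm A.
Proof.
move=> VdA; have := opnormP A (col i V).
by rewrite (eigenvector_diag i VdA) vnormZ (vnorm_col_orthogonal i VdA.1) !mulr1.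
Qed.

End SpectralBounds.

(** * Chebyshev polynomials *)

Section Chebyshev.
Variable R : realType.

Fixpoint chebT (n : nat) : {poly R} :=
  if n is m.+1 then
    if m is l.+1 then 2%:P * 'X * chebT m - chebT l else 'X
  else 1.

Fixpoint chebU (n : nat) : {poly R} :=
  if n is m.+1 then
    if m is l.+1 then 2%:P * 'X * chebU m - chebU l else 2%:P * 'X
  else 1.

Lemma chebT_rec n : chebT n.+2 = 2%:P * 'X * chebT n.+1 - chebT n.
Proof. by []. Qed.

Lemma chebU_rec n : chebU n.+2 = 2%:P * 'X * chebU n.+1 - chebU n.
Proof. by []. Qed.

Lemma chebT_cos n t : (chebT n).[cos t] = cos (n%:R * t).
Proof.
suff: (chebT n).[cos t] = cos (n%:R * t) /\
      (chebT n.+1).[cos t] = cos (n.+1%:R * t) by case.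
elim: n => [|n [IH1 IH2]].
  by rewrite /= hornerC hornerX mul0r cos0 mul1r.
split=> //; rewrite chebT_rec !hornerE IH1 IH2.
have -> : n.+2%:R * t = n.+1%:R * t + t by rewrite (_ : n.+2 = n.+1 + 1)%N ?natrD; [ring|rewrite addn1].
have -> : n%:R * t = n.+1%:R * t - t by rewrite -addn1 natrD; ring.
by rewrite !cosD cosN sinN; ring.
Qed.

Lemma chebT_norm n x : -1 <= x <= 1 -> `|(chebT n).[x]| <= 1.
Proof.
move=> x1; rewrite -(@acosK R x) ?in_itv //= chebT_cos.
by rewrite ler_norml cos_geN1 cos_le1.
Qed.

(** The addition formula for sin((n + 2) t) divided by sin t. In this form it yields |U_n| <= n + 1
    on [-1, 1] by induction, with no division by a sine. *)
Lemma chebU_chebT n : chebU n.+1 = 'X * chebU n + chebT n.+1.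
Proof.
suff: chebU n.+1 = 'X * chebU n + chebT n.+1 /\
      chebU n.+2 = 'X * chebU n.+1 + chebT n.+2 by case.
have E0 : chebU 1 = 'X * chebU 0 + chebT 1.
  by rewrite /= mulr1 polyCD; ring.
elim: n => [|n [IH1 IH2]].
  split=> //; rewrite chebU_rec chebT_rec /=; ring.
split=> //; rewrite chebT_rec [LHS]chebU_rec.
transitivity (2%:P * 'X * ('X * chebU n.+1 + chebT n.+2)
              - ('X * chebU n + chebT n.+1) : {poly R}).
  by rewrite -IH2 -IH1.
by rewrite (chebU_rec n); ring.
Qed.

Lemma chebU_norm n x : -1 <= x <= 1 -> `|(chebU n).[x]| <= n.+1%:R.
Proof.
move=> x1; elim: n => [|n IH]; first by rewrite /= hornerC normr1.
rewrite chebU_chebT hornerD hornerM hornerX -(addn1 n.+1) natrD.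
apply: le_trans (ler_normD _ _) _; apply: lerD; last exact: chebT_norm.
rewrite normrM; apply: le_trans IH; apply: ler_piMl => //.
by rewrite ler_norml.
Qed.

End Chebyshev.

(** * Chebyshev expansion and discrete orthogonality *)

Section ChebyshevExpansion.
Variable R : realType.

Lemma size_chebT n : size (chebT R n) = n.+1.
Proof.
suff: size (chebT R n) = n.+1 /\ size (chebT R n.+1) = n.+2 by case.
elim: n => [|n [IH1 IH2]]; first by rewrite /= size_poly1 size_polyX.
split=> //; rewrite chebT_rec.
have T0 : chebT R n.+1 != 0 by rewrite -size_poly_eq0 IH2.
have S : size (2%:P * 'X * chebT R n.+1) = n.+3.
  by rewrite -mulrA mul_polyC size_scale ?pnatr_eq0 // mulrC size_mulX // IH2.
by rewrite size_polyDl S // size_polyN IH1.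
Qed.

Lemma chebT_expansion k (p : {poly R}) : (size p <= k)%N ->
  exists c : nat -> R, p = \sum_(i < k) c i *: chebT R i.
Proof.
elim: k p => [|k IH] p sp.
  by exists (fun=> 0); rewrite big_ord0; apply/eqP; rewrite -size_poly_leq0.
pose a := p`_k / lead_coef (chebT R k).
have lT : lead_coef (chebT R k) != 0 by rewrite lead_coef_eq0 -size_poly_eq0 size_chebT.
have lk : (chebT R k)`_k = lead_coef (chebT R k) by rewrite lead_coefE size_chebT.
have [c hc] : exists c : nat -> R, p - a *: chebT R k = \sum_(i < k) c i *: chebT R i.
  apply: IH; apply/leq_sizeP => j kj; rewrite coefB coefZ.
  move: kj; rewrite leq_eqVlt => /predU1P[<-|kj].
    by rewrite lk /a mulfVK // subrr.
  have -> : p`_j = 0 by apply: nth_default; apply: leq_trans sp _.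
  by rewrite [_`_j]nth_default ?size_chebT // mulr0 subr0.
exists (fun i => if i == k then a else c i).
rewrite big_ord_recr /= eqxx -[LHS](subrK (a *: chebT R k)) hc; congr (_ + _).
by apply: eq_bigr => i _; rewrite ltn_eqF.
Qed.

Lemma sin_natpi n : sin (n%:R * pi) = 0 :> R.
Proof.
elim: n => [|n IH]; first by rewrite mul0r sin0.
by rewrite -addn1 natrD mulrDl mul1r sinD IH sinpi mul0r mulr0 addr0.
Qed.

(** The angles whose cosines are the zeros of T_k. *)
Definition cheb_node k j : R := (j%:R + 2^-1) * (pi / k%:R).

(** Multiplied by 2 sin [phi], where [phi] = l pi / (2 k) is half the step of the angles, the sum
    telescopes to sin(l pi) = 0. The condition l < 2 k puts [phi] in (0, pi), so its sine can be
    cancelled. *)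
Lemma cos_node_sum k l : (0 < l < k + k)%N ->
  \sum_(j < k) cos (l%:R * cheb_node k j) = 0.
Proof.
move=> /andP[l0 lk]; have k0 : (0 < k)%N by case: (k) lk => //; rewrite ltn0.
have kr : k%:R != 0 :> R by rewrite pnatr_eq0 -lt0n.
pose phi : R := l%:R * (pi / (k%:R * 2)).
have sphi : 0 < sin phi.
  apply: sin_gt0_pi; apply/andP; split.
    by rewrite !mulr_gt0 ?invr_gt0 ?mulr_gt0 ?ltr0n ?pi_gt0.
  rewrite /phi mulrCA -[ltRHS]mulr1 ltr_pM2l ?pi_gt0 //.
  rewrite ltr_pdivrMr ?mulr_gt0 ?ltr0n // mul1r -natrM ltr_nat; lia.
apply: (mulfI (lt0r_neq0 sphi)); rewrite mulr0 mulr_sumr.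
apply: (mulfI (_ : 2 != 0 :> R)); first by rewrite pnatr_eq0.
rewrite mulr0 mulr_sumr -[RHS](sin_natpi l).
have T := telescope_sumr (fun j => sin (j%:R * 2 * phi)) (leq0n k).
rewrite !mul0r sin0 subr0 big_mkord in T.
have -> : l%:R * pi = k%:R * 2 * phi :> R by rewrite /phi; field.
rewrite -T; apply: eq_bigr => j _.
have -> : l%:R * cheb_node k j = (j%:R * 2 * phi) + phi.
  by rewrite /cheb_node /phi; field.
have -> : j.+1%:R * 2 * phi = (j%:R * 2 * phi + phi) + phi.
  by rewrite -addn1 natrD; ring.
set a := j%:R * 2 * phi; have -> : sin a = sin ((a + phi) - phi) by rewrite addrK.
by rewrite (sinD _ phi) (sinD _ (- phi)) cosN sinN; ring.
Qed.

Lemma cos_node_orth k l i : (l < k)%N -> (i < k)%N ->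
  \sum_(j < k) cos (l%:R * cheb_node k j) * cos (i%:R * cheb_node k j) =
  if l == i then (if i == 0%N then k%:R else k%:R / 2) else 0.
Proof.
move=> lk ik.
(* With i <= l the truncated difference l - i is the true one. *)
wlog li : l i lk ik / (i <= l)%N.
  move=> H; have [il|/ltnW li] := leqP i l; first exact: H.
  under eq_bigr do rewrite mulrC.
  by rewrite H // eq_sym; case: eqP => // ->.
have E j : cos (l%:R * cheb_node k j) * cos (i%:R * cheb_node k j) =
   2^-1 * cos ((l + i)%:R * cheb_node k j) + 2^-1 * cos ((l - i)%:R * cheb_node k j).
  rewrite natrD natrB // mulrDl mulrBl !cosD cosN sinN.
  by field.
under eq_bigr do rewrite E.
rewrite big_split /= -!mulr_sumr.
have c1 : \sum_(i0 < k) cos (0%:R * cheb_node k i0) = k%:R :> R.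
  under eq_bigr do rewrite mul0r cos0.
  by rewrite sumr_const card_ord.
case: eqP => [->|lni].
  rewrite subnn c1; case: (eqVneq i 0%N) => [->|i0].
    by rewrite addn0 c1; field.
  have ii : (0 < i + i < k + k)%N by move: i0 ik; clear; lia.
  by rewrite (cos_node_sum ii) mulr0 add0r mulrC.
have il : (0 < l + i < k + k)%N /\ (0 < l - i < k + k)%N.
  by move: lni lk ik li; clear; lia.
by rewrite (cos_node_sum il.1) (cos_node_sum il.2) mulr0 addr0.
Qed.

(** The sum of p T_i over the k nodes is at most k M, and orthogonality evaluates it to c_i times k
    or k / 2; the weight k / 2 is the origin of the factor 2. *)
Lemma chebT_coef_le k (c : nat -> R) M :
  (forall x, -1 <= x <= 1 -> `|(\sum_(i < k) c i *: chebT R i).[x]| <= M) ->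
  forall i, (i < k)%N -> `|c i| <= 2 * M.
Proof.
move=> hM i ik; set p := \sum_(i < k) _ in hM.
have k0 : 0 < k%:R :> R by rewrite ltr0n; apply: leq_ltn_trans ik.
have S : \sum_(j < k) p.[cos (cheb_node k j)] * cos (i%:R * cheb_node k j) =
    c i * (if i == 0%N then k%:R else k%:R / 2).
  under eq_bigr do rewrite horner_sum mulr_suml.
  rewrite exchange_big /=.
  transitivity (\sum_(l < k) c l * (if l == i :> nat then (if i == 0%N then k%:R else k%:R / 2) else 0)).
    apply: eq_bigr => l _; rewrite -cos_node_orth // mulr_sumr.
    by apply: eq_bigr => j _; rewrite hornerZ chebT_cos mulrA.
  rewrite (bigD1 (Ordinal ik)) //= eqxx big1 ?addr0 // => l li.
  by rewrite (_ : (l == i :> nat) = false) ?mulr0 //; apply: negbTE li.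
have : `|c i * (if i == 0%N then k%:R else k%:R / 2)| <= k%:R * M.
  rewrite -S; apply: le_trans (ler_norm_sum _ _ _) _.
  rewrite -[k in k%:R * M]card_ord mulr_natl -sumr_const; apply: ler_sum => j _.
  rewrite normrM -[leRHS]mulr1; apply: ler_pM => //.
    by apply: hM; rewrite cos_geN1 cos_le1.
  by rewrite ler_norml cos_geN1 cos_le1.
rewrite normrM => h.
have h2 : `|c i| * (k%:R / 2) <= k%:R * M.
  apply: le_trans h; apply: ler_wpM2l => //.
  by case: ifP => _; rewrite ger0_norm; lra.
by rewrite -(ler_pM2l k0); lra.
Qed.

End ChebyshevExpansion.

(** * Transfer of polynomials between intertwined matrices *)

Section PolynomialTransfer.
Variable R : realType.

(** Evaluation through the diagonalization rather than by matrix powers, so that the norm depends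
    only on the values of p at the entries of d. *)
Definition polymx n (p : {poly R}) (V : 'M[R]_n) (d : 'rV[R]_n) : 'M[R]_n :=
  V *m diag_mx (map_mx (horner p) d) *m V^T.

Lemma polymxD n p q (V : 'M[R]_n) d :
  polymx (p + q) V d = polymx p V d + polymx q V d.
Proof.
rewrite /polymx -mulmxDl -mulmxDr -raddfD; congr (_ *m diag_mx _ *m _).
by apply/rowP => i; rewrite !mxE hornerD.
Qed.

Lemma polymxZ n a p (V : 'M[R]_n) d : polymx (a *: p) V d = a *: polymx p V d.
Proof.
rewrite /polymx scalemxAl scalemxAr -linearZ; congr (_ *m diag_mx _ *m _).
by apply/rowP => i; rewrite !mxE hornerZ.
Qed.

Lemma polymx0 n (V : 'M[R]_n) d : polymx 0 V d = 0.
Proof. by rewrite -(scale0r 0) polymxZ scale0r. Qed.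

Lemma polymxB n p q (V : 'M[R]_n) d :
  polymx (p - q) V d = polymx p V d - polymx q V d.
Proof. by rewrite -(scaleN1r q) polymxD polymxZ scaleN1r. Qed.

Lemma polymx_sum n I (r : seq I) (F : I -> {poly R}) (V : 'M[R]_n) d :
  polymx (\sum_(i <- r) F i) V d = \sum_(i <- r) polymx (F i) V d.
Proof.
elim/big_rec2: _ => [|i x y _ <-]; last by rewrite polymxD.
exact: polymx0.
Qed.

Lemma polymxM n p q (V : 'M[R]_n) d : V^T *m V = 1%:M ->
  polymx (p * q) V d = polymx p V d *m polymx q V d.
Proof.
move=> VV; rewrite /polymx !mulmxA -(mulmxA _ V^T V) VV mulmx1.
rewrite -[in RHS](mulmxA V) mulmx_diag; congr (_ *m diag_mx _ *m _).
by apply/rowP => i; rewrite !mxE hornerM.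
Qed.

Lemma polymxC n c (V : 'M[R]_n) d : V^T *m V = 1%:M -> polymx c%:P V d = c%:M.
Proof.
move=> VV; rewrite /polymx; have -> : map_mx (horner c%:P) d = const_mx c.
  by apply/rowP => i; rewrite !mxE hornerC.
by rewrite diag_const_mx mul_mx_scalar -scalemxAl (mulmx1C VV) scalemx1.
Qed.

Lemma polymx1 n (V : 'M[R]_n) d : V^T *m V = 1%:M -> polymx 1 V d = 1%:M.
Proof. exact: polymxC. Qed.

Lemma polymxX n (V : 'M[R]_n) d A : diagonalizes V d A -> polymx 'X V d = A.
Proof.
move=> [VV ->]; congr (_ *m diag_mx _ *m _).
by apply/rowP => i; rewrite !mxE hornerX.
Qed.

Lemma vnorm_polymx n (p : {poly R}) (V : 'M[R]_n) (d : 'rV[R]_n) (v : 'cV[R]_n) (b : R) :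
  V^T *m V = 1%:M -> 0 <= b -> (forall i, `|p.[d 0 i]| <= b) ->
  vnorm (polymx p V d *m v) <= b * vnorm v.
Proof.
by move=> VV b0 pb; apply: vnorm_conj_diag => // i; rewrite mxE.
Qed.

(* Discrete variation of constants: U j is the fundamental solution of the
   recurrence, shifted by one index. *)
Lemma second_order_duhamel n (M : 'M[R]_n) (U : nat -> 'cV[R]_n -> 'cV[R]_n)
    (D g : nat -> 'cV[R]_n) :
  (forall w, U 0%N w = w) -> (forall w, U 1%N w = 2 *: (M *m w)) ->
  (forall j w, U j.+2 w = 2 *: (M *m U j.+1 w) - U j w) ->
  D 0%N = 0 -> D 1%N = g 0%N ->
  (forall i, D i.+2 = 2 *: (M *m D i.+1) - D i + g i.+1) ->
  forall i, D i = \sum_(j < i) U (i.-1 - j)%N (g j).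
Proof.
move=> U0 U1 US D0 D1 DS i.
suff: D i = \sum_(j < i) U (i.-1 - j)%N (g j) /\
      D i.+1 = \sum_(j < i.+1) U (i - j)%N (g j) by case.
elim: i => [|i [IH1 IH2]]; first by rewrite big_ord0 big_ord1 U0.
split=> //; rewrite DS IH1 IH2 !big_ord_recr /= !subSnn !subnn !U0 U1.
congr (_ + _); rewrite mulmxDr scalerDr addrAC; congr (_ + _).
rewrite mulmx_sumr scaler_sumr -sumrB; apply: eq_bigr => j _.
have ji := ltn_ord j.
have -> : (i.+1 - j = (i.-1 - j).+2)%N by lia.
have -> : (i - j = (i.-1 - j).+1)%N by lia.
by rewrite US.
Qed.

Section Transfer.
Variables (n m k : nat) (V M : 'M[R]_n) (d : 'rV[R]_n).
Variables (W N : 'M[R]_m) (e : 'rV[R]_m) (X : 'M[R]_(n, m)) (v : 'cV[R]_m).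
Hypotheses (VdM : diagonalizes V d M) (WeN : diagonalizes W e N).

(** [r j] measures how far X is from intertwining M and N on the vector T_j(N) v, and [D i] how far
    it is from intertwining T_i(M) and T_i(N) on v. The source [g] has weight 1 at index 0 because
    T_1 = X T_0, while all later steps of the recurrence carry 2 X. *)
Let r (j : nat) : 'cV[R]_n :=
  M *m (X *m (polymx (chebT R j) W e *m v)) - X *m (N *m (polymx (chebT R j) W e *m v)).
Let D (i : nat) : 'cV[R]_n :=
  polymx (chebT R i) V d *m (X *m v) - X *m (polymx (chebT R i) W e *m v).
Let g (j : nat) : 'cV[R]_n := (if j == 0%N then 1 else 2) *: r j.
Let U (j : nat) (w : 'cV[R]_n) : 'cV[R]_n := polymx (chebU R j) V d *m w.

Lemma polymx_rec l (Z P : 'M[R]_l) c (p q : {poly R}) (w : 'cV[R]_l) :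
  diagonalizes Z c P -> polymx (2%:P * 'X * p - q) Z c *m w =
  2 *: (P *m (polymx p Z c *m w)) - polymx q Z c *m w.
Proof.
move=> ZcP; have ZZ := ZcP.1.
rewrite polymxB mulmxBl !polymxM // polymxC // (polymxX ZcP).
by rewrite mul_scalar_mx -!scalemxAl -mulmxA.
Qed.

Lemma chebT_defect i : D i = \sum_(j < i) U (i.-1 - j)%N (g j).
Proof.
have VV := VdM.1; have WW := WeN.1.
apply: (@second_order_duhamel _ M U D g) => [w|w|j w|||l].
- by rewrite /U /= polymx1 // mul1mx.
- rewrite /U /= polymxM // polymxC // (polymxX VdM).
  by rewrite mul_scalar_mx -scalemxAl.
- by rewrite /U chebU_rec (polymx_rec _ _ _ VdM).
- by rewrite /D /= !polymx1 // !mul1mx subrr.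
- rewrite /D /g /r scale1r /= polymx1 // mul1mx.
  by rewrite (polymxX VdM) (polymxX WeN).
- have gen (a1 a2 a3 a4 a5 : 'cV[R]_n) : (2 *: a1 - a4) - (2 *: a3 - a5) =
      2 *: (a1 - a2) - (a4 - a5) + 2 *: (a2 - a3).
    by apply/colP => j; rewrite !mxE; ring.
  rewrite /D /g /r chebT_rec (polymx_rec _ _ _ VdM) (polymx_rec _ _ _ WeN).
  by rewrite !mulmxBr -!scalemxAr; apply: gen.
Qed.

Hypothesis d1 : forall i, -1 <= d 0 i <= 1.

(** There are i terms, each at most i from the Chebyshev polynomial of the second kind times 2 xi
    from the source. *)
Lemma chebT_defect_le xi i :
  (forall j, (j < i)%N -> vnorm (r j) <= xi) -> vnorm (D i) <= 2 * i%:R ^+ 2 * xi.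
Proof.
move=> rxi; rewrite chebT_defect.
apply: le_trans (vnorm_sum _ _ _) _.
apply: (@le_trans _ _ (\sum_(j < i) 2 * i%:R * xi)); last first.
  by rewrite sumr_const card_ord -mulr_natl; lra.
apply: ler_sum => j _; have xi0 := le_trans (vnorm_ge0 _) (rxi j (ltn_ord j)).
apply: (@le_trans _ _ (i%:R * vnorm (g j))).
  apply: vnorm_polymx => // [|l]; first exact: VdM.1.
  apply: le_trans (chebU_norm _ (d1 l)) _; rewrite ler_nat.
  by have := ltn_ord j; lia.
rewrite (mulrC 2) -mulrA; apply: ler_wpM2l => //; rewrite vnormZ.
apply: ler_pM => //; first exact: vnorm_ge0; last exact: rxi.
by case: ifP => _; rewrite ger0_norm //; lra.
Qed.

(** The sum has k terms, each with a coefficient of at most 2 B and a defect of at most 2 k^2 xi.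
    The intertwining is tested only on T_j with j + 1 < k; the hypothesis speaks of all bounded q of
    size below k because that class survives an affine change of variable. *)
Lemma polymx_transfer1 (p : {poly R}) (B xi : R) :
  (forall q : {poly R}, (size q < k)%N ->
     (forall x, -1 <= x <= 1 -> `|q.[x]| <= 1) ->
     vnorm (M *m (X *m (polymx q W e *m v)) - X *m (N *m (polymx q W e *m v))) <= xi) ->
  0 <= xi -> (size p <= k)%N -> (forall x, -1 <= x <= 1 -> `|p.[x]| <= B) ->
  vnorm (polymx p V d *m (X *m v) - X *m (polymx p W e *m v)) <=
    4 * B * k%:R ^+ 3 * xi.
Proof.
move=> hq xi0 sp pB; have [c pE] := chebT_expansion sp.
have cB : forall i, (i < k)%N -> `|c i| <= 2 * B.
  by apply: chebT_coef_le => x x1; rewrite -pE; apply: pB.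
have -> : polymx p V d *m (X *m v) - X *m (polymx p W e *m v) = \sum_(i < k) c i *: D i.
  rewrite {1 2}pE !polymx_sum !mulmx_suml mulmx_sumr -sumrB; apply: eq_bigr => i _.
  by rewrite !polymxZ -!scalemxAl -scalemxAr scalerBr.
apply: le_trans (vnorm_sum _ _ _) _.
apply: (@le_trans _ _ (\sum_(i < k) 2 * B * (2 * k%:R ^+ 2 * xi))); last first.
  by rewrite sumr_const card_ord -mulr_natl; lra.
apply: ler_sum => i _; rewrite vnormZ; apply: ler_pM => //; first exact: vnorm_ge0.
  exact: cB.
apply: le_trans (chebT_defect_le (xi := xi) _) _.
  move=> j ji; apply: hq => [|x x1]; last exact: chebT_norm.
  by rewrite size_chebT; apply: leq_ltn_trans ji _.
rewrite ler_wpM2r // ler_wpM2l // -!natrX ler_nat leq_exp2r //.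
exact/ltnW/ltn_ord.
Qed.

End Transfer.

Definition affine_map n (lo hi : R) (d : 'rV[R]_n) : 'rV[R]_n :=
  map_mx (fun x => (2 * x - lo - hi) / (hi - lo)) d.

Lemma diagonalizes_affine n (V : 'M[R]_n) d A lo hi : diagonalizes V d A ->
  diagonalizes V (affine_map lo hi d)
    ((hi - lo)^-1 *: (2 *: A - (lo + hi)%:M)).
Proof.
move=> VdA; have [VV AE] := VdA; split=> //.
have -> : diag_mx (affine_map lo hi d) =
    (hi - lo)^-1 *: (2 *: diag_mx d - (lo + hi)%:M).
  apply/matrixP => i j; rewrite !mxE; case: eqP => _; rewrite ?mulr1n ?mulr0n; ring.
rewrite -scalemxAr -scalemxAl mulmxBr mulmxBl -scalemxAr -scalemxAl -AE.
by rewrite mul_mx_scalar -scalemxAl (mulmx1C VV) scalemx1.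
Qed.

Lemma polymx_comp_affine n (p q : {poly R}) (V : 'M[R]_n) d lo hi :
  (forall x, p.[(2 * x - lo - hi) / (hi - lo)] = q.[x]) ->
  polymx p V (affine_map lo hi d) = polymx q V d.
Proof.
move=> pq; congr (_ *m diag_mx _ *m _).
by apply/rowP => i; rewrite !mxE pq.
Qed.

(** The affine map of [[lo, hi]] onto [[-1, 1]] reduces to the previous case. Its shift commutes
    with X and cancels, and its slope 2 / (hi - lo) multiplies the intertwining defect. *)
Lemma polymx_transfer n m k (V A : 'M[R]_n) (d : 'rV[R]_n) (W N : 'M[R]_m)
    (e : 'rV[R]_m) (X : 'M[R]_(n, m)) (v : 'cV[R]_m) (p : {poly R}) (lo hi B xi : R) :
  diagonalizes V d A -> diagonalizes W e N ->
  lo < hi -> (forall i, lo <= d 0 i <= hi) ->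
  (forall q : {poly R}, (size q < k)%N ->
     (forall x, lo <= x <= hi -> `|q.[x]| <= 1) ->
     vnorm (A *m (X *m (polymx q W e *m v)) - X *m (N *m (polymx q W e *m v))) <= xi) ->
  0 <= xi -> (size p <= k)%N -> (forall x, lo <= x <= hi -> `|p.[x]| <= B) ->
  vnorm (polymx p V d *m (X *m v) - X *m (polymx p W e *m v)) <=
    8 * B * k%:R ^+ 3 * xi / (hi - lo).
Proof.
move=> VdA WeN lohi dI hq xi0 sp pB.
have h0 : 0 < hi - lo by rewrite subr_gt0.
have h1 := lt0r_neq0 h0.
(* [s1] maps [[-1, 1]] onto [[lo, hi]] and [s2] is its inverse; composing with either does not
   increase the size. *)
pose s1 : {poly R} := ((hi - lo) / 2) *: 'X + ((lo + hi) / 2)%:P.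
pose s2 : {poly R} := (2 / (hi - lo)) *: 'X - ((lo + hi) / (hi - lo))%:P.
have s1E x : s1.[x] = ((hi - lo) * x + lo + hi) / 2 by rewrite !hornerE; field.
have s2E x : s2.[x] = (2 * x - lo - hi) / (hi - lo).
  by rewrite !hornerE; field.
have lo_hi x : -1 <= x <= 1 -> lo <= ((hi - lo) * x + lo + hi) / 2 <= hi.
  by move=> /andP[x1 x2]; apply/andP; split; nra.
have hi_lo x : lo <= x <= hi -> -1 <= (2 * x - lo - hi) / (hi - lo) <= 1.
  by move=> /andP[x1 x2]; rewrite ler_pdivlMr // ler_pdivrMr //; apply/andP; split; lra.
pose af a b : {poly R} := a *: 'X + b%:P.
have size_comp_affine (q : {poly R}) a b : (size (q \Po af a b) <= size q)%N.
  have [->|q0] := eqVneq q 0; first by rewrite comp_poly0.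
  apply: leq_trans (size_comp_poly_leq _ _) _.
  have : (0 < size q)%N by rewrite size_poly_gt0.
  have : (size (af a b) <= 2)%N.
    apply: leq_trans (size_polyD _ _) _; rewrite geq_max.
    rewrite (leq_trans (size_scale_leq _ _)) ?size_polyX //.
    by rewrite (leq_trans (size_polyC_leq1 _)).
  by case: (size (af a b)) => [|[|[|l]]] //= _; rewrite ?muln1 ?muln0; case: (size q).
have P1 : forall x, (p \Po s1).[(2 * x - lo - hi) / (hi - lo)] = p.[x].
  by move=> x; rewrite horner_comp s1E; congr (_.[_]); field.
have Q2 (q : {poly R}) : forall x, q.[(2 * x - lo - hi) / (hi - lo)] = (q \Po s2).[x].
  by move=> x; rewrite horner_comp s2E.
have := @polymx_transfer1 n m k V _ _ W _ _ X v
  (diagonalizes_affine lo hi VdA) (diagonalizes_affine lo hi WeN) _ (p \Po s1) B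
  (2 * xi / (hi - lo)).
rewrite !(polymx_comp_affine _ _ P1) => H.
apply: le_trans (H _ _ _ _ _) _.
- by move=> i; rewrite mxE; apply: hi_lo.
- move=> q sq q1; rewrite (polymx_comp_affine _ _ (Q2 q)).
  set w := polymx _ W e *m v.
  have -> : (hi - lo)^-1 *: (2 *: A - (lo + hi)%:M) *m (X *m w) -
      X *m ((hi - lo)^-1 *: (2 *: N - (lo + hi)%:M) *m w) =
      (2 / (hi - lo)) *: (A *m (X *m w) - X *m (N *m w)).
    rewrite -!scalemxAl !mulmxBl -!scalemxAl !mul_scalar_mx -!scalemxAr.
    rewrite mulmxBr -!scalemxAr.
    have gen c s (a1 a2 a3 : 'cV[R]_n) : c *: (2 *: a1 - s *: a2) -
        c *: (2 *: a3 - s *: a2) = (2 * c) *: (a1 - a3).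
      by apply/colP => l; rewrite !mxE; ring.
    exact: gen.
  rewrite vnormZ ger0_norm; last by rewrite divr_ge0 // ltW.
  rewrite mulrAC; apply: ler_wpM2r; first by rewrite invr_ge0 ltW.
  apply: ler_wpM2l => //; apply: hq.
    apply: leq_ltn_trans sq; rewrite /s2 -polyCN; exact: size_comp_affine.
  by move=> x xI; rewrite -Q2; apply/q1/hi_lo.
- by rewrite divr_ge0 ?mulr_ge0 // ltW.
- exact: leq_trans (size_comp_affine _ _ _) sp.
- by move=> x x1; rewrite horner_comp s1E; apply/pB/lo_hi.
by rewrite (_ : _ * (2 * xi / _) = 8 * B * k%:R ^+ 3 * xi / (hi - lo)) //; field.
Qed.

End PolynomialTransfer.

(** * Paige's theorem *)

Section Tridiagonal.
Variable R : realType.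
Implicit Types (als bes : seq R) (y : nat -> R).

(** Extension by zero to all natural indices, so that three-term recurrences have no special last
    row. *)
Definition ext j (v : 'cV[R]_j) (t : nat) : R :=
  if insub t is Some i then v i 0 else 0.

Lemma ext_ord j (v : 'cV[R]_j) (i : 'I_j) : ext v i = v i 0.
Proof. by rewrite /ext valK. Qed.

Lemma ext_ge j (v : 'cV[R]_j) t : (j <= t)%N -> ext v t = 0.
Proof. by move=> jt; rewrite /ext insubN // -leqNgt. Qed.

Lemma sum_pick j c (G : nat -> R) :
  \sum_(l < j) (if l == c :> nat then G l else 0) = if (c < j)%N then G c else 0.
Proof.
case: ltnP => cj.
  rewrite (bigD1 (Ordinal cj)) //= eqxx big1 ?addr0 // => l lc.
  by rewrite ifF //; apply: negbTE lc.
by rewrite big1 // => l _; rewrite ifF //; apply/negbTE; have := ltn_ord l; lia.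
Qed.

(** In row 0 the predecessor index is again 0, and the hypothesis on [bes] removes the spurious
    term; in the last row [ext] vanishes. *)
Lemma tridiag_mulE j (als bes : seq R) (v : 'cV[R]_j) (i : 'I_j) : bes`_0 = 0 ->
  (tridiag j als bes *m v) i 0 =
  bes`_i * ext v i.-1 + als`_i * ext v i + bes`_i.+1 * ext v i.+1.
Proof.
move=> b0; rewrite mxE.
transitivity (\sum_(l < j) ((if l == i :> nat then als`_i * ext v l else 0)
    + (if l == i.+1 :> nat then bes`_i.+1 * ext v l else 0)
    + (if l == i.-1 :> nat then bes`_i * ext v l else 0))).
  apply: eq_bigr => l _; rewrite mxE ext_ord.
  have [<-|il] := eqVneq (i : nat) l.
    rewrite [_ == i.+1](_ : _ = false) ?addr0; last by apply/eqP; lia.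
    case: eqP => // ii; first by rewrite (_ : (i : nat) = 0)%N ?b0; [ring|lia].
    by rewrite addr0.
  rewrite add0r.
  case: eqP => [->|l1]; first by rewrite ifF ?addr0 //; apply/eqP; lia.
  rewrite add0r; case: eqP => [il1|il1].
    by rewrite ifT //; apply/eqP; lia.
  case: eqP => [li|]; last by rewrite mul0r.
  by rewrite (_ : (i : nat) = 0)%N ?b0; [ring|lia].
rewrite !big_split /= (sum_pick _ _ (fun l => als`_i * ext v l)).
rewrite (sum_pick _ _ (fun l => bes`_i.+1 * ext v l)).
rewrite (sum_pick _ _ (fun l => bes`_i * ext v l)) ltn_ord.
rewrite (_ : (i.-1 < j)%N); last by have := ltn_ord i; lia.
case: ltnP => [_|ji]; first by ring.
by rewrite (ext_ge _ ji); ring.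
Qed.

Lemma tridiag_sym j (als bes : seq R) : (tridiag j als bes)^T = tridiag j als bes.
Proof.
apply/matrixP => i l; rewrite !mxE eq_sym; case: eqP => [->//|il].
case: (eqVneq (i : nat) l.+1) => [->|il1].
  by rewrite ifF //; apply/eqP; lia.
by [].
Qed.

Lemma tridiag_tridiagonal j (als bes : seq R) : is_tridiagonal (tridiag j als bes).
Proof.
move=> i l h; rewrite mxE; do 3 (rewrite ifF; last by apply/eqP; move: h; lia).
by [].
Qed.

(** The quadratic form of the leading block of order t, on sequences so that one y serves the blocks
    of all orders. *)
Definition jacobi_form (als bes : seq R) t (y : nat -> R) : R :=
  \sum_(s < t) (als`_s * y s ^+ 2 + 2 * bes`_s * (y s.-1 * y s)).

Definition head_sqr t (y : nat -> R) : R := \sum_(s < t) y s ^+ 2.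

(** Cutting the recurrence at t leaves, besides the form of the block, its coupling to the next
    index. For an eigenvector it is this coupling that a spectral gap bounds from below. *)
Lemma jacobi_form_mul als bes t y : bes`_0 = 0 ->
  \sum_(s < t) y s * (bes`_s * y s.-1 + als`_s * y s + bes`_s.+1 * y s.+1) =
  jacobi_form als bes t y + bes`_t * y t.-1 * y t.
Proof.
move=> b0; rewrite /jacobi_form; elim: t => [|t IH].
  by rewrite !big_ord0 b0 !mul0r addr0.
by rewrite !big_ord_recr /= IH; ring.
Qed.

Lemma head_sqr_ge0 t y : 0 <= head_sqr t y.
Proof. by apply: sumr_ge0 => s _; apply: sqr_ge0. Qed.

Lemma head_sqr_le s t y : (s <= t)%N -> head_sqr s y <= head_sqr t y.
Proof.
move=> st; rewrite -(subnK st) addnC /head_sqr; elim: (t - s)%N => [|k IH].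
  by rewrite addn0.
by rewrite addnS big_ord_recr /= (le_trans IH) // lerDl sqr_ge0.
Qed.

Lemma sqr_le_head s t (y : nat -> R) : (s < t)%N -> y s ^+ 2 <= head_sqr t y.
Proof.
move=> st; apply: le_trans (head_sqr_le _ st).
by rewrite /head_sqr big_ord_recr /= lerDr head_sqr_ge0.
Qed.

Lemma prod_le_head r s t (y : nat -> R) : (r < t)%N -> (s < t)%N ->
  `|y r * y s| <= head_sqr t y.
Proof.
move=> /(sqr_le_head y) rt /(sqr_le_head y) st; rewrite normrM.
move: rt st; rewrite -(real_normK (num_real (y r))) -(real_normK (num_real (y s))).
set a := `|y r|; set b := `|y s| => rt st.
have := sqr_ge0 (a - b); rewrite sqrrB; lra.
Qed.

Lemma dotv_tridiag j als bes (v : 'cV[R]_j) : bes`_0 = 0 ->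
  dotv v (tridiag j als bes *m v) = jacobi_form als bes j (ext v).
Proof.
move=> b0; have := jacobi_form_mul als j (ext v) b0.
rewrite (ext_ge v (leqnn j)) mulr0 addr0 => <-.
by apply: eq_bigr => i _; rewrite tridiag_mulE // ext_ord.
Qed.

Lemma dotv_ext j (v : 'cV[R]_j) : dotv v v = head_sqr j (ext v).
Proof. by apply: eq_bigr => i _; rewrite ext_ord expr2. Qed.

Lemma jacobi_form_col als bes j (y : nat -> R) :
  jacobi_form als bes j (ext (\col_(i < j) y i)) = jacobi_form als bes j y.
Proof.
have E t : (t < j)%N -> ext (\col_(i < j) y i) t = y t.
  by move=> tj; rewrite -[t]/(val (Ordinal tj)) ext_ord mxE.
apply: eq_bigr => s _; rewrite !E //; have := ltn_ord s; lia.
Qed.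

Lemma head_sqr_col j (y : nat -> R) :
  head_sqr j (ext (\col_(i < j) y i)) = head_sqr j y.
Proof. by apply: eq_bigr => s _; rewrite ext_ord mxE. Qed.

End Tridiagonal.

(** * A Ritz value separated from the smaller blocks *)

Section Paige.
Variable R : realType.

(* At t = 0 the term with q t.-1 = q 0 is harmless, because bes`_0 = 0. *)
Definition lanczos_residual n (A : 'M[R]_n) (q : nat -> 'cV[R]_n) (als bes : seq R) t :=
  A *m q t - bes`_t *: q t.-1 - als`_t *: q t - bes`_t.+1 *: q t.+1.

(** What Paige's argument takes from the computation. Only neighbouring vectors are compared, and
    always with weight beta, so a nearly vanishing beta, after which the directions are dominated by
    rounding, does no harm. *)
Record lanczos_rel n (A : 'M[R]_n) (m : nat) (q : nat -> 'cV[R]_n)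
    (als bes : seq R) (tau : R) : Prop := LanczosRel {
  lanczos_beta0 : bes`_0 = 0;
  lanczos_res : forall t, (t < m)%N -> vnorm (lanczos_residual A q als bes t) <= tau;
  lanczos_orth : forall t, (t < m)%N -> `|bes`_t.+1 * dotv (q t) (q t.+1)| <= tau;
  lanczos_norm : forall t, (t < m)%N -> 3 / 4 <= dotv (q t) (q t) <= 2;
  lanczos_diff : forall t, (t < m)%N ->
    `|bes`_t * (dotv (q t) (q t) - dotv (q t.-1) (q t.-1))| <= tau }.

Section Step.
Variables (n m j : nat) (A : 'M[R]_n) (q : nat -> 'cV[R]_n) (als bes : seq R).
Variables (tau Delta mu : R) (Y : nat -> R).
Hypotheses (As : A^T = A) (rel : lanczos_rel A m q als bes tau) (jm : (j <= m)%N).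
Hypotheses (Delta_gt0 : 0 < Delta) (tau_ge0 : 0 <= tau).
Hypothesis eigY : forall t, (t < j)%N ->
  mu * Y t = bes`_t * Y t.-1 + als`_t * Y t + bes`_t.+1 * Y t.+1.
Hypothesis gap : forall t y, (t < j)%N ->
  jacobi_form als bes t y <= (mu - Delta) * head_sqr t y.

Let b0 := lanczos_beta0 rel.
Let res := lanczos_residual A q als bes.
(** [p t] is the Ritz vector cut after t terms, [g t] the residual it accumulates, [c t] the
    spurious overlap with the next Lanczos vector, which exact orthogonality would make zero. *)
Let p t : 'cV[R]_n := \sum_(s < t) Y s *: q s.
Let g t : 'cV[R]_n := \sum_(s < t) Y s *: res s.
Let c t := dotv (p t) (q t).
Let D t := dotv (q t) (q t).
Let o t := bes`_t * dotv (q t.-1) (q t).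
(* The Casoratian of c and Y; rho is the defect of c in the recurrence of Y. *)
Let w t := bes`_t * (c t * Y t.-1 - c t.-1 * Y t).
Let rho t := - (Y t * o t) + bes`_t * (D t - D t.-1) * Y t.-1
  + dotv (g t) (q t) - dotv (p t) (res t) + Y t * o t.+1.
Let S t := head_sqr t Y.

(** On the head of the eigenvector the form of the block equals mu S_t minus the coupling term, and
    the gap keeps it below (mu - Delta) S_t. *)
Let offdiag t : (t < j)%N -> Delta * S t <= bes`_t * Y t.-1 * Y t.
Proof.
move=> tj; have := jacobi_form_mul als t Y b0.
have -> : \sum_(s < t) Y s * (bes`_s * Y s.-1 + als`_s * Y s + bes`_s.+1 * Y s.+1) =
    mu * S t.
  rewrite mulr_sumr; apply: eq_bigr => s _; rewrite -eigY; first by ring.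
  by apply: ltn_trans tj.
by have := gap Y tj; rewrite -/(S t); lra.
Qed.

Let Aq t : A *m q t = res t + bes`_t *: q t.-1 + als`_t *: q t + bes`_t.+1 *: q t.+1.
Proof.
rewrite /res /lanczos_residual; move: (A *m q t) => x.
by apply/colP => i; rewrite !mxE; ring.
Qed.

Let Ap t : (t <= j)%N ->
  A *m p t = mu *: p t - (bes`_t * Y t) *: q t.-1 + (bes`_t * Y t.-1) *: q t + g t.
Proof.
rewrite /p /g; elim: t => [|t IH] tj.
  by rewrite !big_ord0 mulmx0 b0 !mul0r !scale0r scaler0 subr0 !addr0.
rewrite !big_ord_recr /= mulmxDr IH 1?ltnW // -scalemxAr Aq.
set P := \sum_(s < t) _; set G := \sum_(s < t) _.
have e := eigY tj; apply/colP => i; rewrite !mxE.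
have -> : bes`_t.+1 * Y t.+1 = mu * Y t - bes`_t * Y t.-1 - als`_t * Y t by lra.
by ring.
Qed.

(** Both sides of <A p_t, q_t> = <p_t, A q_t> expanded; the symmetry of A is used here. *)
Let c_rec t : (t < j)%N ->
  bes`_t.+1 * c t.+1 + als`_t * c t + bes`_t * c t.-1 - mu * c t = rho t.
Proof.
move=> tj; have := dotvM A (p t) (q t).
have [r rE] : {r | r = res t} by exists (res t).
rewrite As (Ap (ltnW tj)) Aq -rE !dotvE.
have -> : dotv (p t) (q t.+1) = c t.+1 - Y t * dotv (q t) (q t.+1).
  by rewrite /c /p big_ord_recr /= dotvDl dotvZl; ring.
(* At t = 0 both sides vanish with beta_0; otherwise the last term of p_t is peeled off. *)
have -> : bes`_t * dotv (p t) (q t.-1) = bes`_t * (c t.-1 + Y t.-1 * D t.-1).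
  clear r rE; case: t tj => [|t] _; first by rewrite b0 !mul0r.
  by rewrite /c /p big_ord_recr /= dotvDl dotvZl.
rewrite -/(c t) -/(D t) /rho /o -rE /=; lra.
Qed.

(** Since c and Y obey the same recurrence up to [rho], the Casoratian changes only by the defect
    times Y_t. *)
Let w_rec t : (t < j)%N -> w t.+1 = w t + rho t * Y t.
Proof.
move=> tj; rewrite -(c_rec tj) /w /=.
have e := eigY tj.
have -> : (bes`_t.+1 * c t.+1 + als`_t * c t + bes`_t * c t.-1 - mu * c t) * Y t =
  (bes`_t.+1 * c t.+1 + als`_t * c t + bes`_t * c t.-1) * Y t - c t * (mu * Y t) by ring.
by rewrite e; ring.
Qed.

Let q_le2 t : (t < j)%N -> vnorm (q t) <= 2.
Proof.
move=> tj; apply: le_vnorm => //.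
by have /andP[_] := lanczos_norm rel (leq_trans tj jm); lra.
Qed.

Let res_le t : (t < j)%N -> vnorm (res t) <= tau.
Proof. by move=> tj; apply: (lanczos_res rel); apply: leq_trans jm. Qed.

Let o_le t : (t <= j)%N -> `|o t| <= tau.
Proof.
case: t => [|t] tj; first by rewrite /o b0 mul0r normr0.
by apply: (lanczos_orth rel); apply: leq_trans jm.
Qed.

(** Three local terms cost tau each and the two sums over s < t cost 2 t tau each; 3 + 4 t <= 4 m
    because t < m. The extra factor Y_t makes all products comparable to S_(t+1). *)
Let rho_le t : (t < j)%N -> `|rho t * Y t| <= 4 * m%:R * tau * S t.+1.
Proof.
move=> tj.
have Stt : `|Y t * Y t| <= S t.+1 by apply: prod_le_head.
have Stp : `|Y t.-1 * Y t| <= S t.+1 by apply: prod_le_head => //; lia.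
have h1 : `|Y t * o t * Y t| <= tau * S t.+1.
  by rewrite mulrAC normrM mulrC; apply: ler_pM => //; apply/o_le/ltnW.
have h2 : `|bes`_t * (D t - D t.-1) * Y t.-1 * Y t| <= tau * S t.+1.
  rewrite -mulrA normrM; apply: ler_pM => //.
  by apply: (lanczos_diff rel); apply: leq_trans jm.
have h5 : `|Y t * o t.+1 * Y t| <= tau * S t.+1.
  by rewrite mulrAC normrM mulrC; apply: ler_pM => //; apply/o_le.
have sum_le (F : nat -> R) : (forall s, (s < t)%N -> `|F s| <= 2 * tau) ->
    `|\sum_(s < t) Y s * F s * Y t| <= t%:R * (2 * tau * S t.+1).
  move=> Fle; apply: le_trans (ler_norm_sum _ _ _) _.
  rewrite -[X in X%:R]card_ord mulr_natl -sumr_const; apply: ler_sum => s _.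
  rewrite mulrAC normrM mulrC; apply: ler_pM => //; first exact: Fle.
  by apply: prod_le_head => //; apply: ltnW; rewrite ltnS.
have h3 : `|dotv (g t) (q t) * Y t| <= t%:R * (2 * tau * S t.+1).
  rewrite /g dotv_suml mulr_suml.
  under eq_bigr do rewrite dotvZl.
  apply: (sum_le (fun s => dotv (res s) (q t))) => s st.
  by rewrite mulrC; apply: dotv_bound; [apply/res_le/(ltn_trans st)|apply: q_le2].
have h4 : `|dotv (p t) (res t) * Y t| <= t%:R * (2 * tau * S t.+1).
  rewrite /p dotv_suml mulr_suml.
  under eq_bigr do rewrite dotvZl.
  apply: (sum_le (fun s => dotv (q s) (res t))) => s st.
  by apply: dotv_bound; [apply/q_le2/(ltn_trans st)|apply: res_le].
have tm : t%:R + 1 <= m%:R :> R by rewrite natr1 ler_nat; apply: leq_trans jm.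
have S0 : 0 <= tau * S t.+1 by rewrite mulr_ge0 // head_sqr_ge0.
have : (3 + 4 * t%:R) * (tau * S t.+1) <= 4 * m%:R * (tau * S t.+1).
  by apply: ler_wpM2r => //; lra.
rewrite /rho; move: h1 h2 h3 h4 h5; rewrite !ler_norml => /andP[? ?] /andP[? ?] /andP[? ?] /andP[? ?] /andP[? ?] ?.
by apply/andP; split; lra.
Qed.

Let w_le t : (t <= j)%N -> `|w t| <= 4 * m%:R ^+ 2 * tau * S t.
Proof.
move=> tj; suff: `|w t| <= t%:R * (4 * m%:R * tau * S t).
  move/le_trans; apply.
  have -> : 4 * m%:R ^+ 2 * tau * S t = m%:R * (4 * m%:R * tau * S t) by ring.
  apply: ler_wpM2r; first by rewrite !mulr_ge0 ?head_sqr_ge0.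
  by rewrite ler_nat (leq_trans tj).
elim: t tj => [|t IH] tj; first by rewrite /w b0 !mul0r normr0.
rewrite w_rec // -[t.+1%:R]natr1 [leRHS]mulrDl [1 * _]mul1r; apply: le_trans (ler_normD _ _) _.
apply: lerD; last exact: rho_le.
apply: le_trans (IH (ltnW tj)) _; apply: ler_wpM2l => //.
by apply: ler_wpM2l; rewrite ?mulr_ge0 // head_sqr_le.
Qed.

Let K := 4 * m%:R ^+ 2 * tau / Delta.

Let K_ge0 : 0 <= K.
Proof. by rewrite /K divr_ge0 ?mulr_ge0 // ltW. Qed.

(** By the definition of w, beta_(t+1) Y_t c_(t+1) = w_(t+1) + beta_(t+1) Y_(t+1) c_t, and [offdiag]
    bounds |w_(t+1)| by K beta_(t+1) Y_t Y_(t+1). So each step adds at most K to the ratio |c_t| /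
    |Y_t|. *)
Let c_le t : (t < j)%N -> `|c t| <= t%:R * K * `|Y t|.
Proof.
elim: t => [|t IH] tj.
  by rewrite /c /p big_ord0 dot0v normr0 !mul0r.
have := offdiag tj; rewrite /= => h.
(* If the head of Y vanishes there is nothing to divide by, but then p_(t+1) = 0. *)
have [S0|S0] := eqVneq (S t.+1) 0.
  have -> : c t.+1 = 0.
    rewrite /c /p big1 ?dot0v // => s _.
    have := sqr_le_head Y (ltn_ord s); rewrite -/(S _) S0 => ys.
    have /eqP : Y s ^+ 2 == 0 by rewrite eq_le ys sqr_ge0.
    by move/eqP; rewrite sqrf_eq0 => /eqP ->; rewrite scale0r.
  by rewrite normr0; apply: mulr_ge0 => //; apply: mulr_ge0.
have Sp : 0 < S t.+1 by rewrite lt_neqAle eq_sym S0 head_sqr_ge0.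
have bYY : 0 < bes`_t.+1 * Y t * Y t.+1 by apply: lt_le_trans h; rewrite mulr_gt0.
have bY : 0 < `|bes`_t.+1 * Y t|.
  by rewrite normr_gt0; apply: contraTneq bYY => ->; rewrite mul0r ltxx.
rewrite -(ler_pM2l bY) -normrM.
have -> : bes`_t.+1 * Y t * c t.+1 = w t.+1 + bes`_t.+1 * Y t.+1 * c t by rewrite /w /=; ring.
apply: le_trans (ler_normD _ _) _.
have wt : `|w t.+1| <= K * (bes`_t.+1 * Y t * Y t.+1).
  apply: le_trans (w_le (ltnW tj)) _.
  apply: le_trans (ler_wpM2l K_ge0 h).
  rewrite /K le_eqVlt; apply/orP; left; apply/eqP; rewrite -/(S _); field.
  exact: lt0r_neq0.
have ct : `|bes`_t.+1 * Y t.+1 * c t| <= t%:R * K * (bes`_t.+1 * Y t * Y t.+1).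
  rewrite normrM; apply: le_trans (ler_wpM2l (normr_ge0 _) (IH (ltnW tj))) _.
  rewrite -(gtr0_norm bYY) !normrM le_eqVlt; apply/orP; left; apply/eqP; ring.
apply: le_trans (lerD wt ct) _.
rewrite -(gtr0_norm bYY) (normrM _ (Y t.+1)) -[t.+1%:R]natr1 le_eqVlt.
by apply/orP; left; apply/eqP; ring.
Qed.

(** |p_(t+1)|^2 = |p_t|^2 + 2 Y_t c_t + Y_t^2 |q_t|^2, and the cross term is at most 2 m K Y_t^2. *)
Let p_norm t : (t <= j)%N -> (3 / 4 - 2 * m%:R * K) * S t <= dotv (p t) (p t).
Proof.
elim: t => [|t IH] tj; first by rewrite /S /head_sqr big_ord0 mulr0 dotvv_ge0.
rewrite /S /head_sqr /p !big_ord_recr /= -/(p t) -/(head_sqr t Y) -/(S t).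
rewrite !dotvE (dotvC (q t)) -/(c t) -/(D t).
have IHt := IH (ltnW tj).
have Dt : 3 / 4 <= D t by have /andP[] := lanczos_norm rel (leq_trans tj jm).
have YD : 3 / 4 * Y t ^+ 2 <= Y t ^+ 2 * D t.
  by rewrite mulrC; apply: ler_wpM2l; rewrite ?sqr_ge0.
have Yc : `|Y t * c t| <= m%:R * K * Y t ^+ 2.
  rewrite normrM mulrC; apply: le_trans (ler_wpM2r (normr_ge0 _) (c_le tj)) _.
  rewrite -(real_normK (num_real (Y t))) expr2 [leRHS]mulrA.
  do 3 apply: ler_wpM2r => //.
  by rewrite ler_nat; apply: leq_trans jm; apply: ltnW.
move: Yc; rewrite ler_norml => /andP[Yc _]; lra.
Qed.

Let dot_pg t : (t <= j)%N -> `|dotv (p t) (g t)| <= 2 * m%:R ^+ 2 * tau * S t.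
Proof.
move=> tj; apply: (@le_trans _ _ (t%:R * (t%:R * (2 * tau * S t)))); last first.
  have -> : 2 * m%:R ^+ 2 * tau * S t = m%:R * (m%:R * (2 * tau * S t)) by ring.
  have tm : t%:R <= m%:R :> R by rewrite ler_nat (leq_trans tj).
  have S0 : 0 <= 2 * tau * S t by rewrite !mulr_ge0 ?head_sqr_ge0.
  apply: ler_pM => //; first by rewrite mulr_ge0.
  exact: ler_wpM2r.
rewrite /p dotv_suml; apply: le_trans (ler_norm_sum _ _ _) _.
rewrite -[X in X%:R * _]card_ord [leRHS]mulr_natl -sumr_const; apply: ler_sum => s _.
rewrite /g dotvC dotv_suml; apply: le_trans (ler_norm_sum _ _ _) _.
rewrite -[X in X%:R * _]card_ord [leRHS]mulr_natl -sumr_const; apply: ler_sum => r _.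
have sj : (s < j)%N by apply: leq_trans tj.
have rj : (r < j)%N by apply: leq_trans tj.
rewrite dotvZl dotvZr mulrA normrM mulrC; apply: ler_pM => //.
  by rewrite mulrC; apply: dotv_bound; [apply: res_le|apply: q_le2].
exact: prod_le_head.
Qed.

(** The smallness of tau gives 2 m K <= 1 / 4, hence |p_j|^2 >= 1 / 2. The Rayleigh quotient then
    misses mu |p_j|^2 by at most 6 m^2 tau, which is less than Delta / 2. *)
Lemma ritz_value_le lambda : (forall z, dotv z (A *m z) <= lambda * dotv z z) ->
  (0 < j)%N -> Y j = 0 -> S j = 1 -> 32 * m%:R ^+ 3 * tau <= Delta ->
  mu <= lambda + Delta.
Proof.
move=> Al j0 Yj Sj small.
have m1 : 1 <= m%:R :> R by rewrite ler1n (leq_trans j0).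
have mK : 2 * m%:R * K <= 1 / 4.
  have -> : 2 * m%:R * K = 8 * m%:R ^+ 3 * tau / Delta by rewrite /K; ring.
  by rewrite ler_pdivrMr //; lra.
have pn : 1 / 2 <= dotv (p j) (p j) by have := p_norm (leqnn j); rewrite Sj; lra.
have wj := w_le (leqnn j); have pg := dot_pg (leqnn j).
rewrite Sj mulr1 in wj pg.
(* As Y_j = 0, the boundary term of the Rayleigh quotient is the Casoratian itself, which is already
   bounded; [c_le] stops short of the index j. *)
have wE : w j = bes`_j * Y j.-1 * c j by rewrite /w Yj; ring.
have := Al (p j); rewrite (Ap (leqnn j)) !dotvE Yj -/(c j).
rewrite mulr0 mul0r oppr0 addr0 -wE.
move: wj pg; rewrite !ler_norml => /andP[w1 w2] /andP[g1 g2].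
set P := dotv (p j) (p j) in pn *; move=> h.
have m2 : m%:R ^+ 2 * tau <= m%:R ^+ 3 * tau.
  apply: ler_wpM2r => //; rewrite [m%:R ^+ 3]exprSr; apply: ler_peMr => //.
have hP : (mu - lambda) * P <= 6 * (m%:R ^+ 2 * tau) by lra.
rewrite leNgt; apply/negP => big.
have : Delta * (1 / 2) < (mu - lambda) * P by nra.
by lra.
Qed.

End Step.
End Paige.

(** * Induction over the leading blocks and the range of the Ritz values *)

Section PaigeBound.
Variable R : realType.
Variables (n : nat) (tau Delta : R) (m : nat) (q : nat -> 'cV[R]_n).
Hypotheses (tau_ge0 : 0 <= tau) (Delta_gt0 : 0 < Delta).
Hypothesis small : 32 * m%:R ^+ 3 * tau <= Delta.

Lemma jacobi_form_le (A : 'M[R]_n) als bes lambda : A^T = A ->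
  lanczos_rel A m q als bes tau ->
  (forall z, dotv z (A *m z) <= lambda * dotv z z) ->
  forall j y, (j <= m)%N ->
  jacobi_form als bes j y <= (lambda + j%:R * Delta) * head_sqr j y.
Proof.
move=> As rel Al j; have b0 := lanczos_beta0 rel.
elim/ltn_ind: j => -[|j] IH y jm.
  by rewrite /jacobi_form /head_sqr !big_ord0 mulr0.
have [V [d VdT]] := symmetric_diagonalizable (tridiag_sym j.+1 als bes).
have [i0 i0max] : exists i0, forall i, d 0 i <= d 0 i0.
  by case: (@arg_maxP _ _ _ (ord0 : 'I_j.+1) xpredT (d 0)) => // i0 _ h; exists i0 => i; apply: h.
set v := \col_(i < j.+1) y i.
rewrite -(jacobi_form_col als bes) -(head_sqr_col j.+1 y) -/v -dotv_tridiag // -dotv_ext.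
apply: le_trans (quadratic_le v VdT i0max) _; apply: ler_wpM2r; first exact: dotvv_ge0.
rewrite leNgt; apply/negP => big.
have jD : Delta <= j.+1%:R * Delta by apply: ler_peMl; rewrite ?ler1n // ltW.
(* The order of the block is at least 1, so this contradicts [big]. *)
suff : d 0 i0 <= lambda + Delta by lra.
apply: (@ritz_value_le _ n m j.+1 A q als bes tau Delta (d 0 i0) (ext (col i0 V))) => //.
- move=> t tj; have := congr1 (fun w : 'cV_j.+1 => w (Ordinal tj) 0) (eigenvector_diag i0 VdT).
  rewrite tridiag_mulE // -[t in LHS]/(val (Ordinal tj)) ext_ord /= => ->.
  by rewrite !mxE.
(* The gap: a block of order t <= j stays below lambda + t Delta, while the assumed eigenvalue
   exceeds lambda + (j + 1) Delta. *)
- move=> t z tj; apply: le_trans (IH t tj z _) _; first by lia.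
  apply: ler_wpM2r; first exact: head_sqr_ge0.
  have : t%:R * Delta + Delta <= j.+1%:R * Delta.
    have -> : t%:R * Delta + Delta = t.+1%:R * Delta by rewrite -[t.+1%:R]natr1; ring.
    by apply: ler_wpM2r; rewrite ?ler_nat // ltW.
  by lra.
- exact: ext_ge.
- by rewrite -dotv_ext dotv_col_orthogonal //; case: VdT.
Qed.

Lemma nth_opp (s : seq R) t : (map -%R s)`_t = - s`_t.
Proof.
have [ts|ts] := ltnP t (size s); first by rewrite (nth_map 0).
by rewrite !nth_default ?size_map ?oppr0.
Qed.

(** Negating A and the coefficients keeps the same vectors, so a lower bound on the Ritz values is
    an upper bound for the negated data. *)
Lemma lanczos_rel_opp (A : 'M[R]_n) als bes : lanczos_rel A m q als bes tau ->
  lanczos_rel (- A) m q (map -%R als) (map -%R bes) tau.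
Proof.
case=> b0 res orth nrm diff; split=> [|t tm|t tm|//|t tm].
- by rewrite nth_opp b0 oppr0.
- have -> : lanczos_residual (- A) q (map -%R als) (map -%R bes) t =
      - lanczos_residual A q als bes t.
    rewrite /lanczos_residual !nth_opp mulNmx !scaleNr; move: (A *m q t) => x.
    by apply/colP => i; rewrite !mxE; ring.
  by rewrite vnormN; apply: res.
- by rewrite nth_opp mulNr normrN; apply: orth.
- by rewrite nth_opp mulNr normrN; apply: diff.
Qed.

Lemma jacobi_form_opp als bes j (y : nat -> R) :
  jacobi_form (map -%R als) (map -%R bes) j y = - jacobi_form als bes j y.
Proof. by rewrite -sumrN; apply: eq_bigr => s _; rewrite !nth_opp; ring. Qed.

Lemma ritz_values_range (A : 'M[R]_n) als bes W e i : A^T = A ->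
  lanczos_rel A m q als bes tau -> diagonalizes W e (tridiag m als bes) ->
  lambda_min A - m%:R * Delta <= e 0 i <= lambda_max A + m%:R * Delta.
Proof.
move=> As rel WeT; have [V [d VdA]] := symmetric_diagonalizable As.
have b0 := lanczos_beta0 rel.
have FE : jacobi_form als bes m (ext (col i W)) = e 0 i.
  rewrite -dotv_tridiag // (eigenvector_diag i WeT) dotvZr dotv_col_orthogonal ?mulr1 //.
  by case: WeT.
have S1 : head_sqr m (ext (col i W)) = 1.
  by rewrite -dotv_ext dotv_col_orthogonal //; case: WeT.
apply/andP; split.
  have := jacobi_form_le (lambda := - lambda_min A) _ (lanczos_rel_opp rel) _
    (ext (col i W)) (leqnn m).
  rewrite jacobi_form_opp FE S1 mulr1 => h.
  rewrite -lerN2 opprB addrC; apply: h; first by rewrite linearN /= As.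
  move=> z; rewrite mulNmx dotvNr mulNr lerN2; apply: (quadratic_ge _ VdA) => l.
  by have /andP[] := lambda_bounds l As VdA.
have := jacobi_form_le (lambda := lambda_max A) As rel _ (ext (col i W)) (leqnn m).
rewrite FE S1 mulr1; apply=> z; apply: (quadratic_le _ VdA) => l.
by have /andP[] := lambda_bounds l As VdA.
Qed.

End PaigeBound.

(** * Support of a polynomial in a tridiagonal matrix *)

Section KrylovSupport.
Variable R : realType.

(** Horner's scheme: each multiplication by the tridiagonal matrix extends the support of the first
    basis vector by at most one row. *)
Lemma polymx_tridiag_support m als bes (W : 'M[R]_m) e (p : {poly R}) (i : 'I_m) :
  bes`_0 = 0 -> diagonalizes W e (tridiag m als bes) -> (size p <= i)%N ->
  (polymx p W e *m (\col_(l < m) ((l : nat) == 0%N)%:R)) i 0 = 0.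
Proof.
move=> b0 WeT; have WW := WeT.1; set x := \col_(l < m) _.
elim/poly_ind: p i => [|p c IH] i.
  by rewrite polymx0 mul0mx mxE.
rewrite size_MXaddC; case: ifP => [/andP[/eqP -> /eqP ->] _|_ pi].
  by rewrite mul0r add0r polymx0 mul0mx mxE.
rewrite polymxD mulmxDl mulrC polymxM // (polymxX WeT) -mulmxA polymxC //.
rewrite mul_scalar_mx mxE [X in _ + X]mxE [x i 0]mxE gtn_eqF ?(leq_ltn_trans _ pi) //.
rewrite mulr0 addr0 tridiag_mulE //; set w := polymx p W e *m x.
have w0 t : (size p <= t)%N -> ext w t = 0.
  move=> pt; have [tm|mt] := ltnP t m; last exact: ext_ge.
  by rewrite -[t]/(val (Ordinal tm)) ext_ord; apply: IH.
by rewrite !w0 ?mulr0 ?addr0 //; lia.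
Qed.

End KrylovSupport.

(** * Rounding errors of the elementary operations *)

Section Computations.
Variables T U : Type.

Lemma always_bind (c : Defs.comp T) (g : T -> Defs.comp U) P Q :
  always c P -> (forall x t1, P x t1 -> always (g x) (fun y t2 => Q y (t1 + t2)%N)) ->
  always (bind c g) Q.
Proof.
move=> [[x [t1 cx]] cP] gQ; split.
  have [[y [t2 gy]] _] := gQ _ _ (cP _ _ cx).
  by exists y, (t1 + t2)%N, x, t1, t2.
move=> y t [z [t1' [t2' [cz gy ->]]]].
by have [_] := gQ _ _ (cP _ _ cz); apply.
Qed.

Lemma always_impl (c : Defs.comp T) (P Q : T -> nat -> Prop) :
  always c P -> (forall x t, P x t -> Q x t) -> always c Q.
Proof. by move=> [ex cP] PQ; split=> // y t /cP /PQ. Qed.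

Lemma always_ret (x : T) (P : T -> nat -> Prop) : P x 0%N -> always (ret x) P.
Proof. by move=> Px; split; [exists x, 0%N | move=> y t [-> ->]]. Qed.

End Computations.

Section FloatingPointErrors.
Variables (R : realType) (u : R) (kappa : nat).
Hypothesis u_ge0 : 0 <= u.

Lemma always_fl z :
  always (fl u kappa z) (fun r t => `|r - z| <= u * `|z| /\ (t <= kappa)%N).
Proof.
split; first by exists z, 0%N; split=> //; exists 0; rewrite ?normr0 // addr0 mul1r.
move=> r t [[d du ->] tk]; split=> //.
by rewrite mulrDl mul1r addrAC subrr add0r normrM ler_wpM2r.
Qed.

Lemma always_fl_iszero (z : R) :
  always (fl_iszero kappa z) (fun b t => b = (z == 0) /\ (t <= kappa)%N).
Proof. by split=> //; exists (z == 0), 0%N. Qed.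

Lemma always_fl_col n (F : 'I_n -> Defs.comp R) (P : 'I_n -> R -> Prop) b :
  (forall i, always (F i) (fun r t => P i r /\ (t <= b)%N)) ->
  always (fl_col F) (fun y t => (forall i, P i (y i 0)) /\ (t <= n * b)%N).
Proof.
move=> FP; split.
  have /choice [ft Fft] : forall i, exists rt : R * nat, F i rt.1 rt.2.
    by move=> i; have [[r [t Frt]] _] := FP i; exists (r, t).
  exists (\col_i (ft i).1), (\sum_i (ft i).2)%N, (fun i => (ft i).2) => // i.
  by rewrite mxE; apply: Fft.
move=> y t [tau Ftau ->]; split=> [i|].
  by have [_ /(_ _ _ (Ftau i)) []] := FP i.
rewrite -[n in (n * b)%N]card_ord -sum_nat_const; apply: leq_sum => i _.
by have [_ /(_ _ _ (Ftau i)) []] := FP i.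
Qed.

Lemma always_fl_entries n (z : 'cV[R]_n) :
  always (fl_col (fun i => fl u kappa (z i 0)))
    (fun y t => vnorm (y - z) <= u * vnorm z /\ (t <= n * kappa)%N).
Proof.
apply: always_impl (always_fl_col (fun i => always_fl (z i 0))) _ => y t [yz tn].
by split=> //; apply: le_vnorm_entries => // i; rewrite !mxE; apply: yz.
Qed.

Lemma always_fl_scale n a (v : 'cV[R]_n) :
  always (fl_scale u kappa a v)
    (fun y t => vnorm (y - a *: v) <= u * (`|a| * vnorm v) /\ (t <= n * kappa)%N).
Proof.
rewrite -vnormZ; have := always_fl_entries (a *: v).
by rewrite (_ : (fun i => _) = fun i => fl u kappa (a * v i 0)) //; apply/funext => i; rewrite mxE.
Qed.

Lemma always_fl_sub n (v w : 'cV[R]_n) :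
  always (fl_sub u kappa v w)
    (fun y t => vnorm (y - (v - w)) <= u * vnorm (v - w) /\ (t <= n * kappa)%N).
Proof.
have := always_fl_entries (v - w).
by rewrite (_ : (fun i => _) = fun i => fl u kappa (v i 0 - w i 0)) //; apply/funext => i; rewrite !mxE.
Qed.

Lemma always_fl_vdiv n (v : 'cV[R]_n) a :
  always (fl_vdiv u kappa v a)
    (fun y t => vnorm (y - a^-1 *: v) <= u * vnorm (a^-1 *: v) /\ (t <= n * kappa)%N).
Proof.
have := always_fl_entries (a^-1 *: v).
by rewrite (_ : (fun i => _) = fun i => fl u kappa (v i 0 / a)) //; apply/funext => i; rewrite mxE mulrC.
Qed.

(** Whatever the bracketing, each term passes through at most as many roundings as there are
    additions: joining parts of k1 and k2 terms gives (k1 - 1) + (k2 - 1) + 1. *)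
Lemma fl_sum_error s r t : fl_sum u kappa s r t ->
  `|r - \sum_(x <- s) x| <= ((1 + u) ^+ (size s).-1 - 1) * \sum_(x <- s) `|x|
  /\ (t <= (size s).-1 * kappa)%N.
Proof.
elim=> {s r t} [|x|s s1 s2 a b r t1 t2 t3 ss n1 n2 _ [IH1 T1] _ [IH2 T2] [[d du ->] T3]].
- by rewrite !big_nil subr0 normr0 mulr0.
- by rewrite !big_seq1 subrr normr0 expr0 subrr mul0r.
have {n1} : (0 < size s1)%N by case: (s1) n1.
have {n2} : (0 < size s2)%N by case: (s2) n2.
rewrite (perm_size ss) !(perm_big _ ss) /= !big_cat size_cat /=.
set k1 := size s1 in IH1 T1 *; set k2 := size s2 in IH2 T2 * => k20 k10.
have -> : (k1 + k2).-1 = (k1.-1 + k2.-1).+1 by lia.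
split; last first.
  have -> : ((k1.-1 + k2.-1).+1 * kappa = k1.-1 * kappa + k2.-1 * kappa + kappa)%N by lia.
  by apply: leq_add T3; apply: leq_add.
move: IH1 IH2; set A := \sum_(i <- s1) i; set B := \sum_(i <- s2) i.
set A' := \sum_(i <- s1) `|i|; set B' := \sum_(i <- s2) `|i| => IH1 IH2.
have A0 : 0 <= A' by apply: sumr_ge0.
have B0 : 0 <= B' by apply: sumr_ge0.
set G := (1 + u) ^+ (k1.-1 + k2.-1).
have u1 : 1 <= 1 + u by rewrite lerDl.
have g1 : (1 + u) ^+ k1.-1 <= G by apply: ler_weXn2l; rewrite ?leq_addr.
have g2 : (1 + u) ^+ k2.-1 <= G by apply: ler_weXn2l; rewrite ?leq_addl.
have {}IH1 : `|a - A| <= (G - 1) * A'.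
  by apply: le_trans IH1 _; rewrite ler_wpM2r // lerB.
have {}IH2 : `|b - B| <= (G - 1) * B'.
  by apply: le_trans IH2 _; rewrite ler_wpM2r // lerB.
have AA : `|A| <= A' by apply: ler_norm_sum.
have BB : `|B| <= B' by apply: ler_norm_sum.
rewrite exprS -/G.
have -> : (1 + d) * (a + b) - (A + B) =
  d * (A + B) + (1 + d) * ((a - A) + (b - B)) by ring.
apply: (@le_trans _ _ (u * (A' + B') + (1 + u) * ((G - 1) * A' + (G - 1) * B'))); last by lra.
apply: le_trans (ler_normD _ _) _; rewrite !normrM; apply: lerD.
  by apply: ler_pM => //; apply: le_trans (ler_normD _ _) _; apply: lerD.
apply: ler_pM => //.
  by apply: le_trans (ler_normD _ _) _; rewrite normr1; apply: lerD.
by apply: le_trans (ler_normD _ _) _; apply: lerD.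
Qed.

Lemma fl_sum_exists s : exists r t, fl_sum u kappa s r t.
Proof.
elim: s => [|x s [r [t h]]]; first by exists 0, 0%N; constructor.
case: s h => [|y s] h; first by exists x, 0%N; constructor.
exists (x + r), (0 + t + 0)%N.
apply: (@fl_sum_add _ _ _ _ [:: x] (y :: s) x r) => //; first by constructor.
by split=> //; exists 0; rewrite ?normr0 // addr0 mul1r.
Qed.

(** One rounding per product and n - 1 per sum; the exponent n + 1 leaves room and covers n = 0.
    Cauchy-Schwarz for the absolute values makes the bound normwise. *)
Lemma always_fl_dot n (v w : 'cV[R]_n) gam : (1 + u) ^+ n.+1 <= 1 + gam ->
  always (fl_dot u kappa v w) (fun r t =>
    `|r - dotv v w| <= gam * (vnorm v * vnorm w) /\ (t <= 2 * (n * kappa))%N).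
Proof.
move=> ugam; have u0 : 0 <= u := u_ge0.
apply: always_bind (always_fl_col (fun i => always_fl (v i 0 * w i 0))) _ => p t1 [pE t1n].
have sumE (F : R -> R) : \sum_(x <- [seq p i 0 | i <- enum 'I_n]) F x = \sum_i F (p i 0).
  by rewrite big_map big_enum.
have [r [t rt]] := fl_sum_exists [seq p i 0 | i <- enum 'I_n].
split; first by exists r, t.
move=> {r t rt} r t2 /fl_sum_error; rewrite size_map size_enum_ord.
rewrite (sumE id) (sumE Num.norm) => -[rE t2n]; split; last first.
  by rewrite mul2n -addnn; apply: leq_add t1n _; apply: leq_trans t2n _; rewrite leq_mul2r leq_pred orbT.
set S := \sum_i `|v i 0 * w i 0|.
have S0 : 0 <= S by apply: sumr_ge0.
have SE : S <= vnorm v * vnorm w.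
  have absE (x : 'cV[R]_n) : vnorm (map_mx Num.norm x) = vnorm x.
    by rewrite !vnormE; congr Num.sqrt; apply: eq_bigr => i _;
      rewrite mxE -!expr2 real_normK ?num_real.
  rewrite -(absE v) -(absE w); apply: le_trans (dotv_le _ _).
  apply: le_trans (ler_norm _); apply: ler_sum => i _.
  by rewrite !mxE normrM.
have pS : \sum_i `|p i 0| <= (1 + u) * S.
  rewrite mulr_sumr; apply: ler_sum => i _; rewrite mulrDl mul1r addrC -lerBlDr.
  apply: le_trans (pE i); apply: le_trans (lerB_dist _ _); exact: lexx.
have pv : `|\sum_i p i 0 - dotv v w| <= u * S.
  rewrite /dotv -sumrB mulr_sumr; apply: le_trans (ler_norm_sum _ _ _) _.
  by apply: ler_sum => i _; apply: pE.
apply: (@le_trans _ _ (((1 + u) ^+ n.+1 - 1) * S)); last first.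
  apply: (@le_trans _ _ (gam * S)); first by rewrite ler_wpM2r //; lra.
  apply: ler_wpM2l => //.
  have : 1 <= (1 + u) ^+ n.+1 by apply: exprn_ege1; lra.
  lra.
have -> : r - dotv v w = (r - \sum_i p i 0) + (\sum_i p i 0 - dotv v w) by ring.
apply: le_trans (ler_normD _ _) _.
apply: le_trans (lerD rE pv) _.
have G1 : 1 <= (1 + u) ^+ n.-1 by apply: exprn_ege1; lra.
have Gn : (1 + u) ^+ n.-1 <= (1 + u) ^+ n by apply: ler_weXn2l; [lra|lia].
apply: (@le_trans _ _ (((1 + u) ^+ n.-1 - 1) * ((1 + u) * S) + u * S)).
  by rewrite lerD2r; apply: ler_wpM2l => //; lra.
rewrite exprS.
have : (1 + u) * (1 + u) ^+ n.-1 * S <= (1 + u) * (1 + u) ^+ n * S.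
  by apply: ler_wpM2r => //; apply: ler_wpM2l => //; lra.
lra.
Qed.

(** A relative error gam in the square moves the root by at most gam, and the last rounding adds gam
    (1 + gam); for gam <= 1 / 10 the total is below 3 gam. *)
Lemma always_fl_norm n (v : 'cV[R]_n) gam : (1 + u) ^+ n.+1 <= 1 + gam ->
  gam <= 1 / 10 ->
  always (fl_norm u kappa v) (fun r t =>
    `|r - vnorm v| <= 3 * gam * vnorm v /\ (t <= 2 * (n * kappa) + kappa)%N).
Proof.
move=> ugam gam1; have u0 : 0 <= u := u_ge0; have ug : u <= gam.
  have : (1 + u) ^+ 1 <= (1 + u) ^+ n.+1 by apply: ler_weXn2l => //; lra.
  by rewrite expr1; lra.
apply: always_bind (always_fl_dot v v ugam) _ => s t1 [sE t1n].
apply: always_impl (always_fl _) _ => r t2 [rE t2n]; split; last exact: leq_add.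
set N := vnorm v in sE *; have N0 : 0 <= N := vnorm_ge0 v.
rewrite -sqr_vnorm -/N in sE.
have /andP[s1 s2] : (1 - gam) * N <= Num.sqrt s <= (1 + gam) * N.
  have N2 : 0 <= N ^+ 2 := sqr_ge0 N.
  move: sE; rewrite ler_norml -expr2 => /andP[s1 s2].
  apply/andP; split.
    rewrite -(@ger0_norm _ ((1 - gam) * N)) ?mulr_ge0 //; last by lra.
    rewrite -sqrtr_sqr ler_wsqrtr // exprMn.
    have : (1 - gam) ^+ 2 * N ^+ 2 <= (1 - gam) * N ^+ 2.
      apply: ler_wpM2r => //; rewrite expr2; apply: ler_piMl; lra.
    lra.
  rewrite -(@ger0_norm _ ((1 + gam) * N)) ?mulr_ge0 //; last by lra.
  rewrite -sqrtr_sqr ler_wsqrtr // exprMn.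
  have : (1 + gam) * N ^+ 2 <= (1 + gam) ^+ 2 * N ^+ 2.
    apply: ler_wpM2r => //; rewrite expr2; apply: ler_peMl; lra.
  lra.
rewrite (ger0_norm (sqrtr_ge0 s)) in rE.
have rE' : `|r - Num.sqrt s| <= gam * ((1 + gam) * N).
  by apply: le_trans rE _; apply: ler_pM => //; rewrite sqrtr_ge0.
have gN : gam * (gam * N) <= 1 / 10 * (gam * N).
  by apply: ler_wpM2r => //; rewrite mulr_ge0 //; lra.
have gN0 : 0 <= gam * N by rewrite mulr_ge0 //; lra.
by move: rE'; rewrite !ler_norml => /andP[r1 r2]; apply/andP; split; lra.
Qed.

Lemma always_mul_input n (A : 'M[R]_n) mv w gam :
  2 * n%:R `^ (3 / 2) * u <= gam ->
  always (mul_input u A mv w) (fun z t =>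
    vnorm (z - A *m w) <= gam * (opnorm A * vnorm w) /\ t = mv).
Proof.
move=> ug; split.
  exists (A *m w), mv; split=> //; rewrite subrr vnorm0.
  by rewrite !mulr_ge0 ?powR_ge0 ?opnorm_ge0 ?vnorm_ge0.
move=> z t [zE ->]; split=> //; apply: le_trans zE _.
have -> : 2 * n%:R `^ (3 / 2) * opnorm A * vnorm w * u =
  (2 * n%:R `^ (3 / 2) * u) * (opnorm A * vnorm w) by ring.
by apply: ler_wpM2r => //; rewrite mulr_ge0 ?opnorm_ge0 ?vnorm_ge0.
Qed.

Lemma always_fl_mulmv m n (M : 'M[R]_(m, n)) (v : 'cV[R]_n) gam b :
  (1 + u) ^+ n.+1 <= 1 + gam -> 0 <= gam -> (forall i, vnorm (row i M)^T <= b) ->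
  always (fl_mulmv u kappa M v) (fun y t =>
    vnorm (y - M *m v) <= m%:R * (gam * (b * vnorm v)) /\ (t <= m * (2 * (n * kappa)))%N).
Proof.
move=> ugam gam0 Mb.
apply: always_impl (always_fl_col (fun i => always_fl_dot (row i M)^T v ugam)) _.
move=> y t [yE tn]; split=> //; apply: vnorm_le_entries => i.
have -> : (y - M *m v) i 0 = y i 0 - dotv (row i M)^T v.
  by rewrite !mxE; congr (_ - _); apply: eq_bigr => j _; rewrite !mxE.
apply: le_trans (yE i) _; apply: ler_wpM2l => //.
by apply: ler_wpM2r; rewrite ?vnorm_ge0.
Qed.

End FloatingPointErrors.

(** * The Lanczos recurrence in floating point *)

Section LanczosStep.
Variable R : realType.

Lemma vnorm_approx n (x y : 'cV[R]_n) (a e : R) :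
  vnorm y <= a -> vnorm (x - y) <= e -> vnorm x <= a + e.
Proof. by move=> ya xe; apply: le_trans (vnorm_le_sub x y) _; apply: lerD. Qed.

Lemma vnorm_tri n (x y z : 'cV[R]_n) (a b : R) :
  vnorm (x - y) <= a -> vnorm (y - z) <= b -> vnorm (x - z) <= a + b.
Proof.
move=> xy yz; have -> : x - z = (x - y) + (y - z) by rewrite addrA subrK.
by apply: le_trans (vnormD _ _) _; apply: lerD.
Qed.

Lemma vnorm_unit_approx n (q : 'cV[R]_n) (gam : R) :
  0 <= gam -> `|dotv q q - 1| <= 10 * gam -> vnorm q <= 1 + 5 * gam.
Proof.
move=> g0; rewrite ler_norml => /andP[_ h]; apply: le_vnorm; first by lra.
have : 0 <= gam ^+ 2 := sqr_ge0 gam.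
by rewrite (_ : (1 + 5 * gam) ^+ 2 = 1 + 10 * gam + 25 * gam ^+ 2); [lra|ring].
Qed.

(** The square of the left side is |w|^2 - (w.q)^2 (2 - |q|^2), so q need not be exactly a unit
    vector. The absence of a multiplicative loss is what makes beta grow only additively. *)
Lemma vnorm_project_le n (w q : 'cV[R]_n) : dotv q q <= 2 ->
  vnorm (w - dotv w q *: q) <= vnorm w.
Proof.
move=> q2; apply: le_vnorm; first exact: vnorm_ge0.
rewrite sqr_vnorm !dotvE (dotvC q w).
have : 0 <= dotv w q ^+ 2 * (2 - dotv q q) by rewrite mulr_ge0 ?sqr_ge0 // subr_ge0.
rewrite expr2; lra.
Qed.

(** S bounds the scale |A| + b, and each rounding is an absolute error of order gam S. The third
    bound keeps the coefficient 1 in front of |A| + b, so that errors do not compound over the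
    iterations. *)
Lemma orthogonalize_error n (A : 'M[R]_n) (q qp v bq w aq w' : 'cV[R]_n)
    (b a u gam S : R) :
  0 <= u -> u <= gam -> gam <= 1 / 1000 -> 0 <= b -> opnorm A + b <= S ->
  `|dotv q q - 1| <= 10 * gam -> vnorm qp <= 1 + 5 * gam ->
  vnorm (v - A *m q) <= gam * (opnorm A * vnorm q) ->
  vnorm (bq - b *: qp) <= u * (`|b| * vnorm qp) ->
  vnorm (w - (v - bq)) <= u * vnorm (v - bq) ->
  `|a - dotv w q| <= gam * (vnorm w * vnorm q) ->
  vnorm (aq - a *: q) <= u * (`|a| * vnorm q) ->
  vnorm (w' - (w - aq)) <= u * vnorm (w - aq) ->
  [/\ vnorm (w' - (A *m q - b *: qp - a *: q)) <= 9 * (gam * S),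
      `|dotv q w'| <= 40 * (gam * S) &
      vnorm w' <= opnorm A + b + 20 * (gam * S)].
Proof.
move=> u0 ug g1 b0 NbS qq nqp vE bqE wE aE aqE w'E.
have g0 : 0 <= gam := le_trans u0 ug.
set N := opnorm A in vE NbS *; have N0 : 0 <= N := opnorm_ge0 A.
have S0 : 0 <= S by apply: le_trans NbS; apply: addr_ge0.
have nq := vnorm_unit_approx g0 qq.
have nq1 : vnorm q <= 101 / 100 by move: nq g1; clear; lra.
have nqp1 : vnorm qp <= 101 / 100 by move: nqp g1; clear; lra.
have gS0 : 0 <= gam * S by rewrite mulr_ge0.
have gS : gam * S <= 1 / 1000 * S by apply: ler_wpM2r.
have gN0 : 0 <= gam * N by rewrite mulr_ge0.
have gb0 : 0 <= gam * b by rewrite mulr_ge0.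
have gNbS : gam * N + gam * b <= gam * S by rewrite -mulrDr ler_wpM2l.
have mq c : 0 <= c -> c * vnorm q <= c * (101 / 100) by move=> c0; apply: ler_wpM2l.
have ug_le c d : 0 <= c -> c <= d -> u * c <= gam * d by move=> c0 cd; apply: ler_pM.
have {}vE : vnorm (v - A *m q) <= 101 / 100 * (gam * N).
  by apply: le_trans vE _; rewrite mulrA mulrC ler_wpM2r.
have {}bqE : vnorm (bq - b *: qp) <= 101 / 100 * (gam * b).
  apply: le_trans bqE _; rewrite ger0_norm //.
  apply: le_trans (ug_le _ (b * (101 / 100)) _ _) _; rewrite ?mulr_ge0 ?vnorm_ge0 //.
    by rewrite ler_wpM2l.
  by clear; lra.
pose z := A *m q - b *: qp.
have z1 : vnorm (v - bq - z) <= 101 / 100 * (gam * S).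
  have -> : v - bq - z = (v - A *m q) - (bq - b *: qp).
    by rewrite /z; apply/colP => i; rewrite !mxE; ring.
  apply: le_trans (vnormB _ _) _; apply: le_trans (lerD vE bqE) _.
  by move: gNbS; clear; lra.
have zn : vnorm z <= (N + b) * (1 + 5 * gam).
  rewrite mulrDl; apply: le_trans (vnormB _ _) _; apply: lerD.
    by apply: le_trans (opnormP _ _) _; apply: ler_wpM2l.
  by rewrite vnormZ ger0_norm // ler_wpM2l.
have zn' : vnorm z <= N + b + 5 * (gam * S) by move: zn gNbS; clear; lra.
have vbn := vnorm_approx zn' z1.
have {}wE : vnorm (w - (v - bq)) <= 101 / 100 * (gam * S).
  apply: le_trans wE _; rewrite [leRHS]mulrCA; apply: ug_le; rewrite ?vnorm_ge0 //.
  by move: vbn NbS gS gS0; clear; lra.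
have wz := vnorm_tri wE z1.
have wn := vnorm_approx zn' wz.
have wn1 : vnorm w <= 101 / 100 * S by move: wn NbS gS gS0; clear; lra.
have {}aE : `|a - dotv w q| <= 2 * (gam * S).
  apply: le_trans aE _; rewrite [leRHS]mulrCA; apply: ler_wpM2l => //.
  apply: (@le_trans _ _ ((101 / 100 * S) * (101 / 100))); last by move: S0; clear; lra.
  by apply: ler_pM; rewrite ?vnorm_ge0.
have wq : `|dotv w q| <= 103 / 100 * S.
  by apply: le_trans (dotv_bound wn1 nq1) _; move: S0; clear; lra.
have an : `|a| <= 2 * S.
  have -> : a = (a - dotv w q) + dotv w q by rewrite subrK.
  apply: le_trans (ler_normD _ _) _; apply: le_trans (lerD aE wq) _.
  by move: gS S0; clear; lra.
have anq : `|a| * vnorm q <= 203 / 100 * S.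
  by apply: le_trans (mq _ (normr_ge0 a)) _; move: an S0; clear; lra.
have {}aqE : vnorm (aq - a *: q) <= 203 / 100 * (gam * S).
  apply: le_trans aqE _; rewrite [leRHS]mulrCA; apply: ug_le => //.
  by rewrite mulr_ge0 ?vnorm_ge0.
have aqn : vnorm aq <= 203 / 100 * S + 203 / 100 * (gam * S).
  by apply: vnorm_approx aqE; rewrite vnormZ.
have waq : vnorm (w - aq) <= 4 * S.
  apply: le_trans (vnormB _ _) _; apply: le_trans (lerD wn1 aqn) _.
  by move: gS S0; clear; lra.
have {}w'E : vnorm (w' - (w - aq)) <= 4 * (gam * S).
  apply: le_trans w'E _; rewrite [leRHS]mulrCA; by apply: ug_le; first exact: vnorm_ge0.
pose e := w' - (w - a *: q).
have en : vnorm e <= 61 / 10 * (gam * S).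
  have -> : e = (w' - (w - aq)) - (aq - a *: q).
    by rewrite /e; apply/colP => i; rewrite !mxE; ring.
  apply: le_trans (vnormB _ _) _; apply: le_trans (lerD w'E aqE) _.
  by move: gS0; clear; lra.
split.
- have -> : w' - (A *m q - b *: qp - a *: q) = e + (w - z).
    by rewrite /e /z; move: (A *m q) => x; apply/colP => i; rewrite !mxE; ring.
  apply: le_trans (vnormD _ _) _; apply: le_trans (lerD en wz) _.
  by move: gS0; clear; lra.
- have -> : dotv q w' = (dotv w q - a) + a * (1 - dotv q q) + dotv q e.
    by rewrite /e !dotvE (dotvC q w); ring.
  have h1 : `|a * (1 - dotv q q)| <= (2 * S) * (10 * gam).
    by rewrite normrM; apply: ler_pM => //; rewrite distrC.
  have h2 : `|dotv q e| <= (101 / 100) * (61 / 10 * (gam * S)) by apply: dotv_bound.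
  rewrite distrC in aE.
  apply: le_trans (ler_normD _ _) _; apply: le_trans (lerD (ler_normD _ _) (lexx _)) _.
  by move: aE h1 h2 gS0; clear; lra.
- have -> : w' = (w - dotv w q *: q) + (dotv w q - a) *: q + e.
    by rewrite /e; apply/colP => i; rewrite !mxE; ring.
  have h1 : vnorm (w - dotv w q *: q) <= vnorm w.
    by apply: vnorm_project_le; move: qq g1; rewrite ler_norml => /andP[_]; clear; lra.
  have h2 : vnorm ((dotv w q - a) *: q) <= 2 * (gam * S) * (101 / 100).
    by rewrite vnormZ distrC; apply: ler_pM; rewrite ?vnorm_ge0.
  apply: le_trans (vnormD _ _) _; apply: le_trans (lerD (vnormD _ _) (lexx _)) _.
  by move: h1 h2 en wn gS0; clear; lra.
Qed.

(** The norm is off by 3 gam and the division by gam, so |q| is within 49/10 gam of 1; squaring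
    doubles this to less than 10 gam. It serves the starting vector as well. *)
Lemma normalize_error n (w q : 'cV[R]_n) (b u gam : R) :
  0 <= u -> u <= gam -> gam <= 1 / 1000 -> w != 0 ->
  `|b - vnorm w| <= 3 * gam * vnorm w ->
  vnorm (q - b^-1 *: w) <= u * vnorm (b^-1 *: w) ->
  [/\ 0 < b, vnorm (b *: q - w) <= gam * vnorm w & `|dotv q q - 1| <= 10 * gam].
Proof.
move=> u0 ug g1 w0 bE qE; have g0 : 0 <= gam := le_trans u0 ug.
have W0 : 0 < vnorm w by rewrite vnorm_gt0.
set W := vnorm w in W0 bE *.
have gW0 : 0 <= gam * W by rewrite mulr_ge0 // ltW.
have gW : gam * W <= 1 / 1000 * W by rewrite ler_pM2r.
move: bE; rewrite ler_norml => /andP[b1 b2].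
have b0 : 0 < b by lra.
have bq : vnorm (b *: q - w) <= gam * W.
  have -> : b *: q - w = b *: (q - b^-1 *: w).
    by rewrite scalerBr scalerA mulfV ?scale1r ?lt0r_neq0.
  rewrite vnormZ gtr0_norm //; apply: le_trans (ler_wpM2l (ltW b0) qE) _.
  rewrite vnormZ gtr0_norm ?invr_gt0 // mulrCA mulVKf ?lt0r_neq0 //.
  by rewrite ler_pM2r.
split=> //.
have h1 : b * vnorm q <= W + gam * W.
  by rewrite -[b]gtr0_norm // -vnormZ; apply: vnorm_approx bq.
have h2 : W <= b * vnorm q + gam * W.
  by rewrite -[b]gtr0_norm // -vnormZ; apply: (@vnorm_approx _ w (b *: q)) => //; rewrite vnorm_subC.
rewrite -sqr_vnorm; set Q := vnorm q in h1 h2 *.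
have Q0 : 0 <= Q := vnorm_ge0 q.
have Q1 : Q <= 1 + 49 / 10 * gam.
  rewrite -(ler_pM2l b0); apply: le_trans h1 _.
  have : (W - 3 * gam * W) * (1 + 49 / 10 * gam) <= b * (1 + 49 / 10 * gam).
    by apply: ler_wpM2r; lra.
  have : gam * (gam * W) <= 1 / 1000 * (gam * W) by apply: ler_wpM2r.
  lra.
have Q2 : 1 - 49 / 10 * gam <= Q.
  rewrite -(ler_pM2l b0); apply: (@le_trans _ _ (W - gam * W)); last by lra.
  have : b * (1 - 49 / 10 * gam) <= (W + 3 * gam * W) * (1 - 49 / 10 * gam).
    by apply: ler_wpM2r; lra.
  have : 0 <= gam * (gam * W) by rewrite mulr_ge0.
  lra.
have gg : gam * gam <= 1 / 1000 * gam by apply: ler_wpM2r.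
have gg0 : 0 <= gam * gam by rewrite mulr_ge0.
have S1 : Q ^+ 2 <= (1 + 49 / 10 * gam) ^+ 2.
  by rewrite ler_pXn2r ?nnegrE //; lra.
have S2 : (1 - 49 / 10 * gam) ^+ 2 <= Q ^+ 2.
  by rewrite ler_pXn2r ?nnegrE //; lra.
rewrite !expr2 in S1 S2 *; rewrite ler_norml; apply/andP; split; lra.
Qed.

End LanczosStep.

(** * The invariant of the loop and its running time *)

Section LanczosRun.
Variable R : realType.

(** The factor k reflects the a priori bound beta_t <= 2 k |A|; 200 covers the constants of one step
    at scale 3 k |A|. *)
Definition lanczos_tol n (A : 'M[R]_n) (k : nat) (gam : R) : R := 200 * (gam * (k%:R * opnorm A)).

Lemma lanczos_tol_ge0 n (A : 'M[R]_n) k (gam : R) : 0 <= gam -> 0 <= lanczos_tol A k gam.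
Proof. by move=> g0; rewrite /lanczos_tol; do 3 apply: mulr_ge0 => //; apply: opnorm_ge0. Qed.

(** The current q and b are appended because the relation at t involves q_(t+1) and beta_(t+1). The
    linear bound on b is the one that keeps rounding errors of order gam k |A|. *)
Record lanczos_inv n (A : 'M[R]_n) (k : nat) (gam : R) (q1 : 'cV[R]_n) (qs : seq 'cV[R]_n) (als bes : seq R)
    (qp q : 'cV[R]_n) (b : R) : Prop := LanczosInv {
  inv_als : size als = size qs;
  inv_bes : size bes = size qs;
  inv_rel : lanczos_rel A (size qs) (nth 0 (rcons qs q)) als (rcons bes b) (lanczos_tol A k gam);
  inv_unit : forall t, (t <= size qs)%N ->
    `|dotv (rcons qs q)`_t (rcons qs q)`_t - 1| <= 10 * gam;
  inv_first : (rcons qs q)`_0 = q1;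
  inv_b_ge0 : 0 <= b;
  inv_b_le : b <= 2 * (size qs)%:R * opnorm A;
  inv_prev : qp = if size qs is i.+1 then (rcons qs q)`_i else 0 }.

Lemma inv_start n (A : 'M[R]_n) k (gam : R) q1 : `|dotv q1 q1 - 1| <= 10 * gam ->
  lanczos_inv A k gam q1 [::] [::] [::] 0 q1 0.
Proof.
move=> q1u; split=> //=; last by rewrite mulr0 mul0r.
by case.
Qed.

Lemma inv_extend n (A : 'M[R]_n) k (gam : R) q1 qs als bes qp q b a (q' : 'cV[R]_n) (b' : R) :
  0 <= gam -> 1000 * (gam * k%:R) <= 1 ->
  lanczos_inv A k gam q1 qs als bes qp q b -> (size qs < k)%N ->
  vnorm (A *m q - b *: qp - a *: q - b' *: q') <= lanczos_tol A k gam ->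
  `|b' * dotv q q'| <= lanczos_tol A k gam ->
  lanczos_rel A (size qs).+1 (nth 0 (rcons (rcons qs q) q')) (rcons als a)
    (rcons (rcons bes b) b') (lanczos_tol A k gam).
Proof.
move=> g0 gsm; case=> sa sb rel qu _ b0 ble qpE ik resE orthE.
have k1 : 1 <= k%:R :> R by rewrite ler1n (leq_ltn_trans _ ik).
have predW t m : (t <= m)%N -> (t.-1 <= m)%N by apply/leq_trans/leq_pred.
have g1 : gam <= 1 / 1000.
  have : gam <= gam * k%:R by apply: ler_peMr.
  by move: gsm; clear; lra.
have qE t : (t <= size qs)%N -> (rcons (rcons qs q) q')`_t = (rcons qs q)`_t.
  by move=> ti; rewrite [LHS]nth_rcons size_rcons ltnS ti.
have qi : (rcons qs q)`_(size qs) = q by rewrite nth_rcons ltnn eqxx.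
have qi' : (rcons (rcons qs q) q')`_(size qs).+1 = q'.
  by rewrite nth_rcons size_rcons ltnn eqxx.
have bE t : (t <= size qs)%N -> (rcons (rcons bes b) b')`_t = (rcons bes b)`_t.
  by move=> ti; rewrite [LHS]nth_rcons size_rcons sb ltnS ti.
have bi : (rcons bes b)`_(size qs) = b by rewrite nth_rcons sb ltnn eqxx.
have bi' : (rcons (rcons bes b) b')`_(size qs).+1 = b'.
  by rewrite nth_rcons size_rcons sb ltnn eqxx.
have aE t : (t < size qs)%N -> (rcons als a)`_t = als`_t.
  by move=> ti; rewrite nth_rcons sa ti.
have ai : (rcons als a)`_(size qs) = a by rewrite nth_rcons sa ltnn eqxx.
split.
- by rewrite bE //; apply: lanczos_beta0 rel.
- move=> t; rewrite ltnS leq_eqVlt => /predU1P[->|ti]; last first.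
    have := lanczos_res rel ti; rewrite /lanczos_residual.
    by rewrite (qE _ (ltnW ti)) (qE _ ti) (qE _ (predW _ _ (ltnW ti))) (bE _ (ltnW ti)) (bE _ ti) aE.
  rewrite /lanczos_residual (qE _ (leqnn _)) qi (bE _ (leqnn _)) bi ai bi' qi'.
  rewrite (qE _ (predW _ _ (leqnn _))).
  (* With an empty history the truncated predecessor is q itself, while [qp] is zero; the two agree
     after multiplication by b = beta_0 = 0. *)
  suff -> : b *: (rcons qs q)`_(size qs).-1 = b *: qp by [].
  rewrite qpE; case E : (size qs) => [|i //].
  have := lanczos_beta0 rel; have := bi; rewrite E => -> ->.
  by rewrite !scale0r.
- move=> t; rewrite ltnS leq_eqVlt => /predU1P[->|ti].
    by rewrite qE // qi bi' qi'.
  by rewrite (qE _ (ltnW ti)) (qE _ ti) (bE _ ti); apply: lanczos_orth rel _ ti.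
- move=> t; rewrite ltnS => ti; rewrite qE //.
  have := qu t ti; rewrite ler_norml => /andP[h1 h2].
  by move: h1 h2 g1; clear=> *; apply/andP; split; lra.
- move=> t; rewrite ltnS leq_eqVlt => /predU1P[->|ti]; last first.
    rewrite (qE _ (ltnW ti)) (qE _ (predW _ _ (ltnW ti))) (bE _ (ltnW ti)).
    exact: lanczos_diff rel _ ti.
  rewrite bE // bi (qE _ (leqnn _)) (qE _ (predW _ _ (leqnn _))).
  have u1 := qu _ (leqnn _); have u2 : `|dotv (rcons qs q)`_(size qs).-1 (rcons qs q)`_(size qs).-1 - 1| <= 10 * gam.
    by apply: qu; apply: predW.
  set x := dotv _ _ in u1 *; set y := dotv _ _ in u2 *.
  have xy : `|x - y| <= 20 * gam.
    by move: u1 u2; rewrite !ler_norml; clear=> /andP[? ?] /andP[? ?]; apply/andP; split; lra.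
  rewrite normrM ger0_norm //; apply: le_trans (_ : 2 * k%:R * opnorm A * (20 * gam) <= _).
    apply: ler_pM => //; apply: le_trans ble _; apply: ler_wpM2r; first exact: opnorm_ge0.
    by apply: ler_wpM2l => //; rewrite ler_nat ltnW.
  have : 0 <= gam * (k%:R * opnorm A) by rewrite !mulr_ge0 ?opnorm_ge0.
  by rewrite /lanczos_tol; clear; lra.
Qed.

(* ql and bl are q_(m+1) and beta_(m+1), where m = size als; the loop has
   broken down when m < k. *)
Definition lanczos_post n (A : 'M[R]_n) k (gam : R) (q1 : 'cV[R]_n) (out : seq 'cV[R]_n * seq R * seq R) : Prop :=
  let: (qs, als, bes) := out in
  [/\ size qs = size als, size bes = size als, (0 < size als <= k)%N &
    exists ql bl, [/\ lanczos_rel A (size als) (nth 0 (rcons qs ql)) als (rcons bes bl) (lanczos_tol A k gam),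
      (forall t, (t < size als)%N -> `|dotv qs`_t qs`_t - 1| <= 10 * gam),
      qs`_0 = q1 & ((size als < k)%N -> bl = 0)]].

Lemma inv_post n (A : 'M[R]_n) k (gam : R) q1 qs als bes qp q b : lanczos_inv A k gam q1 qs als bes qp q b ->
  (0 < size qs)%N -> size qs = k -> lanczos_post A k gam q1 (qs, als, bes).
Proof.
case=> sa sb rel qu q1E _ _ _ i0 ik; split; rewrite ?sa ?sb //.
  by rewrite i0 ik leqnn.
exists q, b; split=> // [t ti||]; last by rewrite ik ltnn.
  by have := qu t (ltnW ti); rewrite nth_rcons ti.
by move: q1E; rewrite nth_rcons i0.
Qed.

Lemma inv_post_stop n (A : 'M[R]_n) k (gam : R) q1 qs als bes qp q b a :
  0 <= gam -> 1000 * (gam * k%:R) <= 1 -> lanczos_inv A k gam q1 qs als bes qp q b ->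
  (size qs < k)%N -> vnorm (A *m q - b *: qp - a *: q) <= lanczos_tol A k gam ->
  lanczos_post A k gam q1 (rcons qs q, rcons als a, rcons bes b).
Proof.
move=> g0 gsm inv ik res; have [sa sb _ qu q1E _ _ _] := inv.
split; rewrite ?size_rcons ?sa ?sb //.
(* A breakdown is recorded as a next vector 0 with beta = 0, which satisfies the relation trivially
   apart from the residual. *)
exists 0, 0; split=> //.
- apply: (inv_extend g0 gsm inv) => //; first by rewrite scale0r subr0.
  by rewrite mul0r normr0; apply: lanczos_tol_ge0.
Qed.

(** 9 n + 2: n for each of two scalings, two subtractions and one division, 2 n for the inner
    product, 2 n + 1 for the norm, 1 for the zero test. *)
Definition lanczos_iter_time (n kappa mv : nat) := (mv + (9 * n + 2) * kappa)%N.

Lemma always_lanczos_loop n (A : 'M[R]_n) k (gam u : R) kappa mv q1 r qs als bes qp q b :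
  0 <= gam -> 1000 * (gam * k%:R) <= 1 -> 0 <= u -> u <= gam ->
  (1 + u) ^+ n.+1 <= 1 + gam -> 2 * n%:R `^ (3 / 2) * u <= gam ->
  lanczos_inv A k gam q1 qs als bes qp q b -> (size qs + r = k)%N -> (0 < k)%N ->
  always (lanczos_loop u kappa A mv r qs als bes qp q b) (fun out t =>
    lanczos_post A k gam q1 out /\ (t <= r * lanczos_iter_time n kappa mv)%N).
Proof.
move=> g0 gsm u_ge0 u_le gam_sum gam_mul.
elim: r qs als bes qp q b => [|r IH] qs als bes qp q b inv szk k0 /=.
  rewrite addn0 in szk; apply: always_ret; split=> //.
  by apply: inv_post inv _ _; rewrite szk.
have ik : (size qs < k)%N by rewrite -szk -[X in (X < _)%N]addn0 ltn_add2l.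
have k1 : 1 <= k%:R :> R by rewrite ler1n.
have g1 : gam <= 1 / 1000.
  have : gam <= gam * k%:R by apply: ler_peMr.
  by move: gsm; clear; lra.
have g10 : gam <= 1 / 10 by move: g1; clear; lra.
set N := opnorm A; have N0 : 0 <= N := opnorm_ge0 A.
have [_ _ _ qu q1E b0 ble qpE] := inv.
have qi : (rcons qs q)`_(size qs) = q by rewrite nth_rcons ltnn eqxx.
have qq : `|dotv q q - 1| <= 10 * gam by rewrite -{1 2}qi; apply: qu.
have nqp : vnorm qp <= 1 + 5 * gam.
  rewrite qpE; case E : (size qs) => [|i].
    by rewrite vnorm0 addr_ge0 // mulr_ge0.
  by apply: vnorm_unit_approx => //; apply: qu; rewrite E.
have ikr : (size qs)%:R + 1 <= k%:R :> R by rewrite natr1 ler_nat.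
have bk : b <= 2 * k%:R * N - 2 * N.
  apply: le_trans ble _; have : ((size qs)%:R + 1) * N <= k%:R * N by apply: ler_wpM2r.
  by rewrite -/N; clear; lra.
(* b <= 2 k |A| - 2 |A| and |A| <= k |A| leave this scale ample. *)
pose S := 3 * (k%:R * N).
have NkN : N <= k%:R * N by apply: ler_peMl.
have NbS : N + b <= S by rewrite /S; move: bk NkN N0; clear; lra.
have tolE : lanczos_tol A k gam = 200 / 3 * (gam * S) by rewrite /lanczos_tol /S -/N; field.
have gS0 : 0 <= gam * S by rewrite /S !mulr_ge0.
have gkN : 1000 * (gam * (k%:R * N)) <= N.
  by rewrite (mulrA gam) mulrA -[leRHS]mul1r ler_wpM2r.
apply: always_bind (always_mul_input u_ge0 A mv q gam_mul) _ => v _ [vE ->].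
apply: always_bind (always_fl_scale kappa u_ge0 b qp) _ => bq t2 [bqE T2].
apply: always_bind (always_fl_sub kappa u_ge0 v bq) _ => w t3 [wE T3].
apply: always_bind (always_fl_dot kappa u_ge0 w q gam_sum) _ => a t4 [aE T4].
apply: always_bind (always_fl_scale kappa u_ge0 a q) _ => aq t5 [aqE T5].
apply: always_bind (always_fl_sub kappa u_ge0 w aq) _ => w' t6 [w'E T6].
apply: always_bind (always_fl_norm kappa u_ge0 w' gam_sum g10) _ => b' t7 [b'E T7].
apply: always_bind (always_fl_iszero kappa b') _ => stop t8 [-> T8].
have [w'1 w'2 w'3] := orthogonalize_error u_ge0 u_le g1 b0 NbS qq nqp vE bqE wE aE aqE w'E.
have w'S : vnorm w' <= 2 * S.
  apply: le_trans w'3 _; rewrite -/N.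
  have S0 : 0 <= S by rewrite /S !mulr_ge0.
  have gS1 : gam * S <= 1 / 1000 * S by apply: ler_wpM2r.
  by move: NbS S0 gS1; clear; lra.
case: eqP => [b'0|/eqP b'0].
  (* The computed norm has relative error below 1, so it vanishes only for the zero vector. *)
  have w'0 : w' = 0.
    apply/eqP; rewrite -vnorm_eq0; move: b'E; rewrite b'0 sub0r normrN (ger0_norm (vnorm_ge0 _)).
    have W0 := vnorm_ge0 w' => h; rewrite eq_le W0 andbT.
    have : gam * vnorm w' <= 1 / 1000 * vnorm w' by apply: ler_wpM2r.
    by move: h W0; clear; lra.
  apply: always_ret; split.
    apply: inv_post_stop g0 gsm inv ik _.
    rewrite w'0 sub0r vnormN in w'1; apply: le_trans w'1 _; rewrite tolE.
    by move: gS0; clear; lra.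
  rewrite mulSn /lanczos_iter_time; move: T2 T3 T4 T5 T6 T7 T8; clear.
  by move=> *; nia.
have w'n0 : w' != 0.
  apply: contraNneq b'0 => w'0; move: b'E; rewrite w'0 vnorm0 mulr0 subr0.
  by rewrite normr_le0.
apply: always_bind (always_fl_vdiv kappa u_ge0 w' b') _ => q' t9 [q'E T9].
have [b'p bq' q'u] := normalize_error u_ge0 u_le g1 w'n0 b'E q'E.
have nq2 : vnorm q <= 2 by have := vnorm_unit_approx g0 qq; move: g1; clear; lra.
have gw' : gam * vnorm w' <= 2 * (gam * S).
  by rewrite mulrCA; apply: ler_wpM2l.
have res : vnorm (A *m q - b *: qp - a *: q - b' *: q') <= lanczos_tol A k gam.
  have -> : A *m q - b *: qp - a *: q - b' *: q' =
     (A *m q - b *: qp - a *: q - w') + (w' - b' *: q') by rewrite addrA subrK.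
  apply: le_trans (vnormD _ _) _; rewrite vnorm_subC (vnorm_subC w' (b' *: q')).
  apply: le_trans (lerD w'1 (le_trans bq' gw')) _; rewrite tolE.
  by move: gS0; clear; lra.
have orth : `|b' * dotv q q'| <= lanczos_tol A k gam.
  have -> : b' * dotv q q' = dotv q w' + dotv q (b' *: q' - w') by rewrite !dotvE; ring.
  apply: le_trans (ler_normD _ _) _.
  apply: le_trans (lerD w'2 (dotv_bound nq2 (le_trans bq' gw'))) _; rewrite tolE.
  by move: gS0; clear; lra.
have inv' : lanczos_inv A k gam q1 (rcons qs q) (rcons als a) (rcons bes b) q q' b'.
  have rel' := inv_extend g0 gsm inv ik res orth.
  have [sa sb _ _ _ _ _ _] := inv.
  split; rewrite ?size_rcons ?sa ?sb //.
  - move=> t; rewrite leq_eqVlt => /predU1P[->|ti].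
      by rewrite nth_rcons size_rcons ltnn eqxx.
    by rewrite nth_rcons size_rcons ti; apply: qu.
  - by rewrite nth_rcons size_rcons.
  - exact: ltW.
  - move: b'E; rewrite ler_norml => /andP[_ b'E].
    (* The errors are multiples of gam k |A| that [gkN] keeps below |A|. *)
    have : b' <= b + 2 * N.
      rewrite -/N in w'3; move: b'E w'3 gw' gkN gS0; rewrite /S; clear; lra.
    move: ble; rewrite -/N -[(size qs).+1%:R]natr1; clear; lra.
  - by rewrite nth_rcons size_rcons ltnSn qi.
have szk' : (size (rcons qs q) + r = k)%N by rewrite size_rcons -szk addSnnS.
apply: always_impl (IH _ _ _ _ _ _ inv' szk' k0) _ => out t [post T]; split=> //.
rewrite mulSn /lanczos_iter_time in T *; move: T T2 T3 T4 T5 T6 T7 T8 T9; clear.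
set X := (r * _)%N; move: X => X *; nia.
Qed.

End LanczosRun.

(** * From the recurrence to the error bound *)

Section LanczosDecomposition.
Variable R : realType.

Definition col_seq n (q : nat -> 'cV[R]_n) m : 'M[R]_(n, m) := \matrix_(i, j) q j i 0.

Lemma col_seq_mul n (q : nat -> 'cV[R]_n) m (w : 'cV[R]_m) :
  col_seq q m *m w = \sum_(t < m) ext w t *: q t.
Proof.
apply/colP => i; rewrite mxE summxE; apply: eq_bigr => t _.
by rewrite !mxE ext_ord mulrC.
Qed.

Lemma ext_le_vnorm m (w : 'cV[R]_m) t : `|ext w t| <= vnorm w.
Proof.
have [tm|mt] := ltnP t m; last by rewrite ext_ge // normr0 vnorm_ge0.
by rewrite -[t]/(val (Ordinal tm)) ext_ord entry_le_vnorm.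
Qed.

Lemma vnorm_col_seq_mul n (q : nat -> 'cV[R]_n) m (w : 'cV[R]_m) b :
  (forall t, (t < m)%N -> vnorm (q t) <= b) ->
  vnorm (col_seq q m *m w) <= m%:R * b * vnorm w.
Proof.
move=> qb; rewrite col_seq_mul; apply: le_trans (vnorm_sum _ _ _) _.
rewrite -mulrA -[X in X%:R]card_ord mulr_natl -sumr_const; apply: ler_sum => t _.
rewrite vnormZ mulrC; apply: ler_pM; rewrite ?vnorm_ge0 ?ext_le_vnorm //.
exact: qb.
Qed.

Lemma lanczos_decomposition n (A : 'M[R]_n) m q als bes (w : 'cV[R]_m) :
  bes`_0 = 0 ->
  A *m (col_seq q m *m w) - col_seq q m *m (tridiag m als bes *m w) =
  \sum_(t < m) ext w t *: lanczos_residual A q als bes t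
    + (bes`_m * ext w m.-1) *: q m.
Proof.
move=> b0; rewrite !col_seq_mul mulmx_sumr.
have -> : \sum_(t < m) ext (tridiag m als bes *m w) t *: q t =
  \sum_(t < m) (bes`_t * ext w t.-1 + als`_t * ext w t + bes`_t.+1 * ext w t.+1) *: q t.
  by apply: eq_bigr => t _; rewrite ext_ord tridiag_mulE.
(* The boundary term of the summation at a cut t; at t = m its second half vanishes with [ext]. *)
pose f t := (bes`_t * ext w t.-1) *: q t - (bes`_t * ext w t) *: q t.-1.
have fm : f m = (bes`_m * ext w m.-1) *: q m.
  by rewrite /f (ext_ge w (leqnn m)) mulr0 scale0r subr0.
rewrite -fm; suff H s : \sum_(t < s) A *m (ext w t *: q t) -
    \sum_(t < s) (bes`_t * ext w t.-1 + als`_t * ext w t + bes`_t.+1 * ext w t.+1) *: q t =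
    \sum_(t < s) ext w t *: lanczos_residual A q als bes t + f s by exact: H.
elim: s => [|t IH].
  by rewrite !big_ord0 /f b0 !mul0r !scale0r !subr0 addr0.
rewrite !big_ord_recr /= opprD addrACA {}IH /f /lanczos_residual -scalemxAr /=.
move: (\sum_(i < t) _) (A *m q t) => Z Aq.
by apply/colP => i; rewrite !mxE; ring.
Qed.

Lemma lanczos_decomposition_error n (A : 'M[R]_n) m q als bes tau (w : 'cV[R]_m) :
  lanczos_rel A m q als bes tau -> bes`_m * ext w m.-1 = 0 ->
  vnorm (A *m (col_seq q m *m w) - col_seq q m *m (tridiag m als bes *m w)) <=
    m%:R * tau * vnorm w.
Proof.
move=> rel bw; rewrite lanczos_decomposition; last exact: lanczos_beta0 rel.
rewrite bw scale0r addr0; apply: le_trans (vnorm_sum _ _ _) _.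
rewrite -mulrA -[X in X%:R]card_ord mulr_natl -sumr_const; apply: ler_sum => t _.
rewrite vnormZ mulrC; apply: ler_pM; rewrite ?vnorm_ge0 ?ext_le_vnorm //.
exact: (lanczos_res rel).
Qed.

Definition first_col m : 'cV[R]_m := \col_(i < m) ((i : nat) == 0%N)%:R.

Lemma vnorm_first_col m : vnorm (first_col m) <= 1.
Proof.
apply: le_vnorm => //; rewrite expr1n /dotv; case: m => [|m].
  by rewrite big_ord0.
rewrite big_ord_recl big1 ?addr0 => [|i _]; rewrite !mxE /=; first by rewrite mulr1.
by rewrite mulr0.
Qed.

Lemma col_seq_first n (q : nat -> 'cV[R]_n) m : (0 < m)%N ->
  col_seq q m *m first_col m = q 0%N.
Proof.
case: m => // m _; rewrite col_seq_mul big_ord_recl big1 => [|i _].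
  by rewrite ext_ord mxE scale1r addr0.
by rewrite ext_ord mxE scale0r.
Qed.

Lemma krylov_transfer n (A V : 'M[R]_n) d k m q als bes (W : 'M[R]_m) e tau lo hi B
    (p : {poly R}) :
  lanczos_rel A m q als bes tau -> 0 <= tau ->
  diagonalizes V d A -> diagonalizes W e (tridiag m als bes) ->
  (0 < m <= k)%N -> ((m < k)%N -> bes`_m = 0) ->
  lo < hi -> (forall i, lo <= d 0 i <= hi) -> (forall i, lo <= e 0 i <= hi) ->
  (size p <= k)%N -> (forall x, lo <= x <= hi -> `|p.[x]| <= B) ->
  vnorm (polymx p V d *m q 0%N - col_seq q m *m (polymx p W e *m first_col m)) <=
    8 * B * k%:R ^+ 3 * (m%:R * tau) / (hi - lo).
Proof.
move=> rel tau0 VdA WeT /andP[m0 mk] bm lohi dI eI sp pB.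
rewrite -(col_seq_first q m0).
apply: (polymx_transfer VdA WeT lohi dI) sp pB; last by rewrite mulr_ge0.
move=> r sr r1; set w := polymx r W e *m _.
have wn : vnorm w <= 1.
  apply: le_trans (vnorm_first_col m); rewrite -[leRHS]mul1r.
  apply: vnorm_polymx => // [|i]; first by case: WeT.
  exact: r1.
apply: le_trans (lanczos_decomposition_error rel _) _; last first.
  by rewrite ler_piMr // mulr_ge0.
(* Either the loop broke down and beta_m = 0, or m = k and r has size at most m - 1, so that the
   last entry of r(T) e_1 is zero. *)
move: mk; rewrite leq_eqVlt => /predU1P[mk|/bm ->]; last by rewrite mul0r.
have mm : (m.-1 < m)%N by rewrite prednK.
rewrite -[m.-1]/(val (Ordinal mm)) ext_ord /w /first_col.
rewrite (polymx_tridiag_support (als := als) (bes := bes)) ?mulr0 //.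
  exact: lanczos_beta0 rel.
by rewrite -ltnS prednK // mk.
Qed.

End LanczosDecomposition.

(** * Consequences of an approximate eigendecomposition *)

Section ApproximateEigendecomposition.
Variable R : realType.

Lemma sqr_le_reg (a b : R) : 0 <= a -> 0 <= b -> a ^+ 2 <= b * a -> a <= b.
Proof.
move=> a0 b0; have [->//|an] := eqVneq a 0.
by rewrite expr2 ler_pM2r // lt_neqAle eq_sym an.
Qed.

(** V distorts lengths by at most a factor 2, so it is invertible; writing z = V a turns V V^T z - z
    into V (V^T V a - a), which the hypothesis controls. *)
Lemma almost_orthogonal m (V : 'M[R]_m) e :
  opnorm (V^T *m V - 1%:M) <= e -> e <= 1 / 100 ->
  [/\ forall w, `|dotv (V *m w) (V *m w) - dotv w w| <= e * dotv w w,
      forall w, vnorm (V *m w) <= 2 * vnorm w,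
      forall z, vnorm (V^T *m z) <= 2 * vnorm z &
      forall z, vnorm (V *m (V^T *m z) - z) <= 4 * e * vnorm z].
Proof.
move=> Ve e1; have e0 : 0 <= e := le_trans (opnorm_ge0 _) Ve.
have G w : vnorm (V^T *m (V *m w) - w) <= e * vnorm w.
  rewrite -[X in _ - X]mul1mx mulmxA -mulmxBl.
  by apply: le_trans (opnormP _ _) _; rewrite ler_wpM2r ?vnorm_ge0.
have H1 w : `|dotv (V *m w) (V *m w) - dotv w w| <= e * dotv w w.
  rewrite dotvM -dotvNr -dotvDr -(sqr_vnorm w).
  by rewrite (_ : e * _ = vnorm w * (e * vnorm w)); [apply: dotv_bound|ring].
have H2 w : vnorm (V *m w) <= 2 * vnorm w.
  apply: le_vnorm; first by rewrite mulr_ge0 ?vnorm_ge0.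
  have := H1 w; have := dotvv_ge0 w; rewrite exprMn sqr_vnorm ler_norml => w0 /andP[_ h].
  have : e * dotv w w <= 1 / 100 * dotv w w by apply: ler_wpM2r.
  move: h w0; clear; lra.
have H2' w : vnorm w <= 2 * vnorm (V *m w).
  apply: le_vnorm; first by rewrite mulr_ge0 ?vnorm_ge0.
  have := H1 w; have := dotvv_ge0 w; rewrite exprMn sqr_vnorm ler_norml => w0 /andP[h _].
  have : e * dotv w w <= 1 / 100 * dotv w w by apply: ler_wpM2r.
  move: h w0; clear; lra.
have H3 z : vnorm (V^T *m z) <= 2 * vnorm z.
  apply: sqr_le_reg; rewrite ?mulr_ge0 ?vnorm_ge0 // sqr_vnorm dotvM trmxK.
  apply: le_trans (le_trans (ler_norm _) (dotv_le _ _)) _.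
  by have := ler_wpM2l (vnorm_ge0 z) (H2 (V^T *m z)); clear; lra.
split=> // z.
have Vu : V \in unitmx.
  rewrite -unitmx_tr -row_free_unit -kermx_eq0; apply/eqP/row_matrixP => i.
  have : row i (kermx V^T) *m V^T = 0 by rewrite -row_mul mulmx_ker row0.
  move: (row i _) => r /(congr1 trmx); rewrite trmx_mul trmxK trmx0 row0 => Vr.
  have := H2' r^T; rewrite Vr vnorm0 mulr0 => r0.
  apply/eqP; rewrite -trmx_eq0 -vnorm_eq0 eq_le r0; exact: vnorm_ge0.
have -> : z = V *m (invmx V *m z) by rewrite mulmxA mulmxV // mul1mx.
move: (invmx V *m z) => a {z}.
rewrite -mulmxBr; apply: le_trans (H2 _) _.
have := ler_wpM2l e0 (H2' a); have := G a; clear; lra.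
Qed.

(** The column V e_i is an approximate eigenvector of T with value L_i, so L_i is close to a
    Rayleigh quotient of T. The defect itself depends on the size of L, which has to be bounded
    beforehand. *)
Lemma eigensolver_error m (T V W : 'M[R]_m) (L d : 'rV[R]_m) e lo hi :
  opnorm (V *m diag_mx L *m V^T - T) <= e * opnorm T ->
  opnorm (V^T *m V - 1%:M) <= e -> e <= 1 / 100 ->
  diagonalizes W d T -> (forall i, lo <= d 0 i <= hi) ->
  (forall w, vnorm (T *m (V *m w) - V *m (diag_mx L *m w)) <= 6 * (e * opnorm T) * vnorm w)
  /\ (forall i, lo - 24 * (e * opnorm T) <= L 0 i <= hi + 24 * (e * opnorm T)).
Proof.
move=> VLT Ve e1 WdT dI.
have [H1 H2 H3 _] := almost_orthogonal Ve e1.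
have e0 : 0 <= e := le_trans (opnorm_ge0 _) Ve.
set t := opnorm T in VLT *; have t0 : 0 <= t := opnorm_ge0 T.
have et0 : 0 <= e * t by rewrite mulr_ge0.
have G w : vnorm (V^T *m (V *m w) - w) <= e * vnorm w.
  rewrite -[X in _ - X]mul1mx mulmxA -mulmxBl.
  by apply: le_trans (opnormP _ _) _; rewrite ler_wpM2r ?vnorm_ge0.
have defect b w : 0 <= b -> (forall i, `|L 0 i| <= b) ->
    vnorm (T *m (V *m w) - V *m (diag_mx L *m w)) <= (2 * (e * t) + 2 * (e * b)) * vnorm w.
  move=> b0 Lb.
  have -> : T *m (V *m w) - V *m (diag_mx L *m w) =
    - ((V *m diag_mx L *m V^T - T) *m (V *m w)) + V *m (diag_mx L *m (V^T *m (V *m w) - w)).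
    rewrite !mulmxBr mulmxBl !mulmxA opprB.
    by move: (T *m V *m w) (V *m diag_mx L *m V^T *m V *m w) => x y; rewrite addrA subrK.
  apply: le_trans (vnormD _ _) _; rewrite vnormN mulrDl; apply: lerD.
    apply: le_trans (opnormP _ _) _.
    apply: le_trans (ler_pM (opnorm_ge0 _) (vnorm_ge0 _) VLT (H2 w)) _.
    by clear; lra.
  apply: le_trans (H2 _) _.
  have := vnorm_diag (V^T *m (V *m w) - w) b0 Lb.
  have := ler_wpM2l b0 (G w); clear; lra.
have tE : opnorm T <= t by [].
case: m T V W L d t VLT Ve WdT dI H1 H2 H3 t0 et0 G defect tE
  => [|m] T V W L d t VLT Ve WdT dI H1 H2 H3 t0 et0 G defect tE.
  split=> [w|[]//]; rewrite (flatmx0 (_ - _)) vnorm0 !mulr_ge0 ?vnorm_ge0 //.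
have [j0 jmax] : exists j0, forall i, `|L 0 i| <= `|L 0 j0|.
  by case: (@arg_maxP _ _ _ (ord0 : 'I_m.+1) xpredT (fun i => `|L 0 i|)) => // i0 _ h; exists i0 => i; apply: h.
pose x i := V *m (delta_mx i 0 : 'cV[R]_m.+1).
have ei i : dotv (delta_mx i 0 : 'cV[R]_m.+1) (delta_mx i 0) = 1.
  by rewrite /dotv (bigD1 i) //= big1 => [|l li]; rewrite !mxE ?eqxx ?addr0 ?mulr1 // (negPf li) mul0r.
have xx i : 99 / 100 <= dotv (x i) (x i) <= 101 / 100.
  have := H1 (delta_mx i 0); rewrite ei mulr1 -/(x i) ler_norml => /andP[].
  by move: e1; clear=> *; apply/andP; split; lra.
have xn i : vnorm (x i) <= 2.
  by have := H2 (delta_mx i 0); rewrite (vnormE (delta_mx i 0)) ei sqrtr1 mulr1.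
have Lx b i : 0 <= b -> (forall j, `|L 0 j| <= b) ->
    `|dotv (x i) (T *m x i) - L 0 i * dotv (x i) (x i)| <= 4 * (e * t) + 4 * (e * b).
  move=> b0 Lb; have := defect b (delta_mx i 0) b0 Lb; rewrite -/(x i).
  have -> : diag_mx L *m delta_mx i 0 = L 0 i *: (delta_mx i 0 : 'cV[R]_m.+1).
    apply/colP => j; rewrite diag_mx_mulE !mxE eqxx andbT.
    by case: eqP => [->|_]; rewrite ?mulr0.
  rewrite -scalemxAr -/(x i) (vnormE (delta_mx _ _)) ei sqrtr1 mulr1 => h.
  have := dotv_bound (xn i) h; rewrite dotvDr dotvNr dotvZr.
  by move/le_trans; apply; rewrite mulrDr; clear; lra.
have Tx i : lo * dotv (x i) (x i) <= dotv (x i) (T *m x i) <= hi * dotv (x i) (x i).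
  apply/andP; split; [apply: (quadratic_ge _ WdT)|apply: (quadratic_le _ WdT)] => l.
    by have /andP[] := dI l.
  by have /andP[] := dI l.
(* Bootstrap at the entry of largest modulus l: 99/100 l <= 101/100 t + 4 e t + 4 e l, and e <=
   1/100 lets the last term be absorbed on the left. *)
have Lt : forall i, `|L 0 i| <= 2 * t.
  move=> i; apply: le_trans (jmax i) _; set l := `|L 0 j0| in jmax *.
  have l0 : 0 <= l by rewrite normr_ge0.
  have h := Lx l j0 l0 jmax.
  have tx : `|dotv (x j0) (T *m x j0)| <= t * (101 / 100).
    have /andP[_ h2] := xx j0.
    apply: le_trans (dotv_le _ _) _.
    apply: le_trans (ler_wpM2l (vnorm_ge0 _) (opnormP _ _)) _.
    rewrite mulrCA -expr2 sqr_vnorm.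
    by apply: ler_pM; rewrite ?opnorm_ge0 ?dotvv_ge0.
  have lx : l * (99 / 100) <= `|L 0 j0 * dotv (x j0) (x j0)|.
    have /andP[h1 _] := xx j0; rewrite normrM; apply: ler_wpM2l => //.
    by apply: le_trans h1 (ler_norm _).
  have := ler_distD 0 (L 0 j0 * dotv (x j0) (x j0)) (dotv (x j0) (T *m x j0)).
  have el : e * l <= 1 / 100 * l by apply: ler_wpM2r.
  have ett : e * t <= 1 / 100 * t by apply: ler_wpM2r.
  have tri : `|L 0 j0 * dotv (x j0) (x j0)| <= `|dotv (x j0) (T *m x j0)| +
    `|dotv (x j0) (T *m x j0) - L 0 j0 * dotv (x j0) (x j0)|.
    by rewrite -[X in `|X| <= _](subKr (dotv (x j0) (T *m x j0))) ler_normB.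
  by move=> _; move: h tx lx el ett tri l0 t0; clear; lra.
have t20 : 0 <= 2 * t by rewrite mulr_ge0.
split=> [w|i].
  apply: le_trans (defect _ w t20 Lt) _; apply: ler_wpM2r; first exact: vnorm_ge0.
  by clear; lra.
have := Lx _ i t20 Lt; have := Tx i; have := xx i.
set X := dotv (x i) (x i); set Y := dotv _ _; rewrite ler_norml.
move=> /andP[X1 X2] /andP[Y1 Y2] /andP[Z1 Z2].
have X0 : 0 < X by move: X1; clear; lra.
have eX : 12 * (e * t) <= 24 * (e * t) * X.
  have : 24 * (e * t) * (99 / 100) <= 24 * (e * t) * X by apply: ler_wpM2l; rewrite ?mulr_ge0.
  by move: et0; clear; lra.
by apply/andP; split; rewrite -(ler_pM2r X0); move: Y1 Y2 Z1 Z2 eX; clear; lra.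
Qed.

End ApproximateEigendecomposition.

(** * Splitting of the total error *)

Section ErrorDecomposition.
Variable R : realType.

Lemma diagonalizes_diag_mx m (L : 'rV[R]_m) : diagonalizes 1%:M L (diag_mx L).
Proof. by split; rewrite ?trmx1 ?mulmx1 ?mul1mx. Qed.

Lemma polymx1E m p (L : 'rV[R]_m) (v : 'cV[R]_m) :
  polymx p 1%:M L *m v = diag_mx (map_mx (horner p) L) *m v.
Proof. by rewrite /polymx trmx1 mulmx1 mul1mx. Qed.

(** Consecutive differences along f(A) x, p(A) x, nx p(A) q_0, nx Q p(T) e_1, nx Q p(T) V V^T e_1,
    nx Q V p(L) V^T e_1, nx Q V f(L) V^T e_1. The detour through p is needed because only
    polynomials are transferred. *)
Lemma lanczos_error_split n (A V : 'M[R]_n) (d : 'rV[R]_n) k m q als bes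
    (W Vt : 'M[R]_m) (dT L : 'rV[R]_m) (tau lo hi M del kap e nx gam : R) (p : {poly R}) (f : R -> R) (x : 'cV[R]_n) :
  lanczos_rel A m q als bes tau -> 0 <= tau ->
  diagonalizes V d A -> diagonalizes W dT (tridiag m als bes) ->
  (0 < m <= k)%N -> ((m < k)%N -> bes`_m = 0) ->
  lo < hi -> (forall i, lo <= d 0 i <= hi) -> (forall i, lo <= dT 0 i <= hi) ->
  (forall i, lo <= L 0 i <= hi) ->
  (size p <= k)%N -> (forall z, lo <= z <= hi -> `|p.[z]| <= M) ->
  (forall z, lo <= z <= hi -> `|p.[z] - f z| <= del) ->
  0 <= del -> 0 <= M -> 0 <= kap -> 0 <= e -> 0 <= nx ->
  (forall w, vnorm (Vt *m w) <= 2 * vnorm w) ->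
  (forall z, vnorm (Vt^T *m z) <= 2 * vnorm z) ->
  (forall z, vnorm (Vt *m (Vt^T *m z) - z) <= 4 * e * vnorm z) ->
  (forall w, vnorm (tridiag m als bes *m (Vt *m w) - Vt *m (diag_mx L *m w)) <= kap * vnorm w) ->
  (forall t, (t < m)%N -> vnorm (q t) <= 101 / 100) ->
  vnorm (nx *: q 0%N - x) <= gam * vnorm x ->
  vnorm (V *m diag_mx (map_mx f d) *m V^T *m x -
    nx *: (col_seq q m *m (Vt *m (diag_mx (map_mx f L) *m (Vt^T *m first_col R m))))) <=
  del * vnorm x + M * (gam * vnorm x)
  + nx * (8 * M * k%:R ^+ 3 * (k%:R * tau) / (hi - lo))
  + nx * (101 / 100 * k%:R * (4 * (e * M) + 8 * M * k%:R ^+ 3 * (2 * kap) / (hi - lo)))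
  + nx * (101 / 100 * k%:R * (4 * del)).
Proof.
move=> rel tau0 VdA WdT mk bm lohi dI dTI LI sp pM pf del0 M0 kap0 e0 nx0 V2 VT2 VVT Vdef qn q1x.
set e1 := first_col R m; have e1n : vnorm e1 <= 1 := vnorm_first_col R m.
set Q := col_seq q m.
pose v := Vt^T *m e1.
have vn : vnorm v <= 2.
  by apply: le_trans (VT2 _) _; rewrite -[leRHS]mulr1 ler_pM2l.
have mkr : m%:R <= k%:R :> R by rewrite ler_nat; case/andP: mk.
have hilo : 0 <= (hi - lo)^-1 by rewrite invr_ge0 subr_ge0 ltW.
have Qn w : vnorm (Q *m w) <= 101 / 100 * k%:R * vnorm w.
  apply: le_trans (vnorm_col_seq_mul w qn) _; rewrite ler_wpM2r ?vnorm_ge0 //.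
  by rewrite mulrC ler_wpM2l.
have VV := VdA.1; have WW := WdT.1.
pose PA := polymx p V d; pose PT := polymx p W dT; pose pL := diag_mx (map_mx (horner p) L).
pose fL := diag_mx (map_mx f L).
have t1 : vnorm (V *m diag_mx (map_mx f d) *m V^T *m x - PA *m x) <= del * vnorm x.
  rewrite -mulmxBl -mulmxBl -mulmxBr -raddfB; apply: vnorm_conj_diag => // i.
  by rewrite !mxE distrC; apply: pf.
have t2 : vnorm (PA *m (x - nx *: q 0%N)) <= M * (gam * vnorm x).
  apply: (@le_trans _ _ (M * vnorm (x - nx *: q 0%N))).
    by apply: vnorm_polymx => // i; apply: pM.
  by apply: ler_wpM2l => //; rewrite vnorm_subC.
have t3 : vnorm (PA *m q 0%N - Q *m (PT *m e1)) <=
    8 * M * k%:R ^+ 3 * (k%:R * tau) / (hi - lo).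
  apply: le_trans (krylov_transfer rel tau0 VdA WdT mk bm lohi dI dTI sp pM) _.
  rewrite ler_wpM2r // ler_wpM2l ?mulr_ge0 ?exprn_ge0 //.
  by rewrite ler_wpM2r.
have t4 : vnorm (PT *m e1 - PT *m (Vt *m v)) <= 4 * (e * M).
  rewrite -mulmxBr; apply: (@le_trans _ _ (M * vnorm (e1 - Vt *m v))).
    by apply: vnorm_polymx => // i; apply: pM.
  apply: (@le_trans _ _ (M * (4 * e))); last by clear; lra.
  apply: ler_wpM2l => //; rewrite vnorm_subC; apply: le_trans (VVT _) _.
  by rewrite -[leRHS]mulr1; apply: ler_wpM2l; rewrite ?mulr_ge0.
have t5 : vnorm (PT *m (Vt *m v) - Vt *m (pL *m v)) <=
    8 * M * k%:R ^+ 3 * (2 * kap) / (hi - lo).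
  rewrite /pL -polymx1E.
  (* Here V intertwines T and the diagonal matrix of L; the defect holds on every vector, and |V^T
     e_1| <= 2 gives 2 kap. *)
  apply: (polymx_transfer WdT (diagonalizes_diag_mx L) lohi dTI _ _ sp pM).
    move=> r sr r1; apply: le_trans (Vdef _) _; rewrite mulrC; apply: ler_wpM2r => //.
    apply: le_trans vn; rewrite -[leRHS]mul1r; apply: vnorm_polymx => // [|i].
      by rewrite trmx1 mulmx1.
    exact: r1.
  by rewrite mulr_ge0.
have t6 : vnorm (Vt *m (pL *m v) - Vt *m (fL *m v)) <= 4 * del.
  rewrite -mulmxBr -mulmxBl -raddfB; apply: le_trans (V2 _) _.
  have := @vnorm_diag _ _ (map_mx (horner p) L - map_mx f L) v del del0.
  move=> h; have {}h : vnorm (diag_mx (map_mx (horner p) L - map_mx f L) *m v) <= del * vnorm v.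
    by apply: h => i; rewrite !mxE; apply: pf.
  by have := ler_wpM2l del0 vn; move: h; clear; lra.
have -> : V *m diag_mx (map_mx f d) *m V^T *m x - nx *: (Q *m (Vt *m (fL *m v))) =
    (V *m diag_mx (map_mx f d) *m V^T *m x - PA *m x) + PA *m (x - nx *: q 0%N)
    + nx *: (PA *m q 0%N - Q *m (PT *m e1))
    + nx *: (Q *m ((PT *m e1 - PT *m (Vt *m v)) + (PT *m (Vt *m v) - Vt *m (pL *m v))))
    + nx *: (Q *m (Vt *m (pL *m v) - Vt *m (fL *m v))).
  rewrite !mulmxDr !mulmxN -!scalemxAr.
  move: (V *m _ *m _ *m x) (PA *m x) (PA *m q 0%N) (Q *m (PT *m e1)) (Q *m (PT *m (Vt *m v)))
    (Q *m (Vt *m (pL *m v))) (Q *m (Vt *m (fL *m v))) => a1 a2 a3 a4 a5 a6 a7.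
  by apply/colP => i; rewrite !mxE; ring.
have step (a b : 'cV[R]_n) (c c' : R) : vnorm a <= c -> vnorm b <= c' -> vnorm (a + b) <= c + c'.
  by move=> ac bc; apply: le_trans (vnormD _ _) _; apply: lerD.
have scal (a : 'cV[R]_n) (c : R) : vnorm a <= c -> vnorm (nx *: a) <= nx * c.
  by move=> ac; rewrite vnormZ ger0_norm // ler_wpM2l.
have kk0 : 0 <= 101 / 100 * k%:R :> R by rewrite mulr_ge0.
have Q4 : vnorm (Q *m ((PT *m e1 - PT *m (Vt *m v)) + (PT *m (Vt *m v) - Vt *m (pL *m v)))) <=
    101 / 100 * k%:R * (4 * (e * M) + 8 * M * k%:R ^+ 3 * (2 * kap) / (hi - lo)).
  apply: le_trans (Qn _) _; apply: ler_wpM2l => //.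
  exact: le_trans (vnormD _ _) (lerD t4 t5).
have Q5 : vnorm (Q *m (Vt *m (pL *m v) - Vt *m (fL *m v))) <= 101 / 100 * k%:R * (4 * del).
  by apply: le_trans (Qn _) _; apply: ler_wpM2l.
exact: (step _ _ _ _ (step _ _ _ _ (step _ _ _ _ (step _ _ _ _ t1 t2) (scal _ _ t3))
  (scal _ _ Q4)) (scal _ _ Q5)).
Qed.

End ErrorDecomposition.

(** * Rounding in the final products *)

Section FinalStage.
Variable R : realType.

Lemma row_trE m n (M : 'M[R]_(m, n)) i : (row i M)^T = M^T *m delta_mx i 0.
Proof. by rewrite rowE trmx_mul trmx_delta. Qed.

Lemma vnorm_delta n (i : 'I_n) : vnorm (delta_mx i 0 : 'cV[R]_n) = 1.
Proof.
rewrite vnormE /dotv (bigD1 i) //= big1 => [|l li].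
  by rewrite !mxE !eqxx mulr1 addr0 sqrtr1.
by rewrite !mxE (negPf li) mul0r.
Qed.

Lemma always_final_stage n m k (Vt : 'M[R]_m) (L : 'rV[R]_m) (Q : 'M[R]_(n, m))
    (nx C gam u : R) kappa (f : R -> R) :
  0 <= u -> u <= gam -> (1 + u) ^+ m.+1 <= 1 + gam ->
  200 * 400 * (gam * (n%:R * k%:R ^+ 2)) <= 1 -> (0 < n)%N -> (0 < k)%N -> (m <= k)%N ->
  (forall i, `|f (L 0 i)| <= C) -> 0 <= C -> 0 <= nx ->
  (forall w, vnorm (Vt *m w) <= 2 * vnorm w) ->
  (forall z, vnorm (Vt^T *m z) <= 2 * vnorm z) ->
  (forall i, vnorm (row i Q)^T <= 2 * k%:R) ->
  (forall w, vnorm (Q *m w) <= 2 * k%:R * vnorm w) ->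
  always
    (g <~ fl_col (fun i => fl u kappa (f (L 0 i))) ;;
     w1 <~ fl_mulmv u kappa Vt^T (first_col R m) ;;
     w2 <~ fl_col (fun i => fl u kappa (g i 0 * w1 i 0)) ;;
     w3 <~ fl_mulmv u kappa Vt w2 ;;
     w4 <~ fl_mulmv u kappa Q w3 ;;
     fl_scale u kappa nx w4)
    (fun y t => vnorm (y - nx *: (Q *m (Vt *m (diag_mx (map_mx f L) *m (Vt^T *m first_col R m)))))
        <= 80 * (gam * (n%:R * k%:R ^+ 2)) * (nx * C)
      /\ (t <= (6 * (k * k) + 3 * (n * k)) * kappa)%N).
Proof.
move=> u0 ug usum small n0 k0 mk fC C0 nx0 V2 VT2 Qrow Qn.
have g0 : 0 <= gam := le_trans u0 ug.
have n1 : 1 <= n%:R :> R by rewrite ler1n.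
have k1 : 1 <= k%:R :> R by rewrite ler1n.
have mkr : m%:R <= k%:R :> R by rewrite ler_nat.
(* G dominates gam n k, from the rounding of the product with Q, and gam k^2, from earlier errors
   multiplied by the norm of Q. *)
set G := gam * (n%:R * k%:R ^+ 2) in small *.
have nk1 : 1 <= n%:R * k%:R :> R by rewrite -natrM ler1n muln_gt0 n0.
have gkG : gam * k%:R <= G.
  apply: ler_wpM2l => //; rewrite -[leLHS]mul1r expr2 mulrA ler_wpM2r //.
have gnkG : gam * (n%:R * k%:R) <= G.
  apply: ler_wpM2l => //; rewrite expr2 mulrA; exact: ler_peMr.
have gG : gam <= G.
  by apply: le_trans gkG; apply: ler_peMr.
have gk0 : 0 <= gam * k%:R by rewrite mulr_ge0.
have gkC0 : 0 <= gam * k%:R * C by rewrite mulr_ge0.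
have G0 : 0 <= G by apply: le_trans gkG.
set e1 := first_col R m; have e1n : vnorm e1 <= 1 := vnorm_first_col R m.
set fL := diag_mx (map_mx f L).
have fLn v : vnorm (fL *m v) <= C * vnorm v by apply: vnorm_diag => // i; rewrite mxE.
have VTe : vnorm (Vt^T *m e1) <= 2.
  by apply: le_trans (VT2 _) _; rewrite -[leRHS]mulr1 ler_pM2l.
have VTrow i : vnorm (row i Vt^T)^T <= 2.
  by rewrite row_trE trmxK; apply: le_trans (V2 _) _; rewrite vnorm_delta mulr1.
have Vrow i : vnorm (row i Vt)^T <= 2.
  by rewrite row_trE; apply: le_trans (VT2 _) _; rewrite vnorm_delta mulr1.
have mg_le a b : 0 <= b -> a <= b -> m%:R * (gam * a) <= gam * k%:R * b.
  move=> b0 ab; apply: (@le_trans _ _ (k%:R * (gam * b))); last by clear; lra.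
  apply: (@le_trans _ _ (m%:R * (gam * b))); last by rewrite ler_wpM2r ?mulr_ge0.
  by rewrite ler_wpM2l // ler_wpM2l.
apply: always_bind (always_fl_col (fun i => always_fl kappa u0 (f (L 0 i)))) _ => g t1 [gE T1].
apply: always_bind (always_fl_mulmv kappa u0 e1 usum g0 VTrow) _ => w1 t2 [w1E T2].
have {}w1E : vnorm (w1 - Vt^T *m e1) <= gam * k%:R * 2.
  apply: le_trans w1E _; apply: mg_le => //.
  by rewrite -[leRHS]mulr1 ler_pM2l.
have w1n : vnorm w1 <= 3.
  apply: le_trans (vnorm_approx VTe w1E) _; move: gkG small; clear; lra.
apply: always_bind (always_fl_col (fun i => always_fl kappa u0 (g i 0 * w1 i 0))) _ => w2 t3 [w2E T3].
have {}w2E : vnorm (w2 - fL *m w1) <= 9 * (gam * k%:R * C).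
  apply: (@le_trans _ _ (3 * gam * C * vnorm w1)); last first.
    apply: (@le_trans _ _ (3 * gam * C * 3)).
      by apply: ler_wpM2l => //; rewrite !mulr_ge0.
    have : gam * C <= gam * k%:R * C by rewrite ler_wpM2r // ler_peMr.
    clear; lra.
  apply: le_vnorm_entries => [|i]; first by rewrite !mulr_ge0.
  have -> : (w2 - fL *m w1) i 0 = (w2 i 0 - g i 0 * w1 i 0) + (g i 0 - f (L 0 i)) * w1 i 0.
    by rewrite mxE [X in _ + X]mxE diag_mx_mulE mxE; ring.
  have h1 := w2E i; have h2 := gE i; have h3 := fC i.
  have W0 : 0 <= `|w1 i 0| by [].
  have {}h2 : `|g i 0 - f (L 0 i)| <= gam * C.
    by apply: le_trans h2 _; apply: ler_pM.
  have gn : `|g i 0| <= C + gam * C.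
    rewrite -(subrKC (f (L 0 i)) (g i 0)); apply: le_trans (ler_normD _ _) _.
    exact: lerD.
  have {}h1 : `|w2 i 0 - g i 0 * w1 i 0| <= gam * ((C + gam * C) * `|w1 i 0|).
    apply: le_trans h1 _; rewrite normrM; apply: ler_pM => //; rewrite ?mulr_ge0 //.
    by apply: ler_wpM2r.
  apply: le_trans (ler_normD _ _) _; rewrite (normrM (g i 0 - _)).
  apply: le_trans (lerD h1 (ler_wpM2r W0 h2)) _.
  have CW : 0 <= gam * C * `|w1 i 0| by rewrite !mulr_ge0.
  have : gam * (gam * C * `|w1 i 0|) <= 1 * (gam * C * `|w1 i 0|).
    by apply: ler_wpM2r => //; move: gG small G0; clear; lra.
  by move: CW; clear; lra.
have w2t : vnorm (w2 - fL *m (Vt^T *m e1)) <= 11 * (gam * k%:R * C).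
  apply: le_trans (vnorm_tri w2E (_ : vnorm _ <= C * (gam * k%:R * 2))) _; last by clear; lra.
  rewrite -mulmxBr; apply: le_trans (fLn _) _; exact: ler_wpM2l.
have fVn : vnorm (fL *m (Vt^T *m e1)) <= C * 2.
  by apply: le_trans (fLn _) _; apply: ler_wpM2l.
have gkC1 : 200 * 400 * (gam * k%:R * C) <= C.
  by have := ler_wpM2r C0 gkG; have := ler_wpM2r C0 small; clear; lra.
have w2n : vnorm w2 <= 3 * C.
  by apply: le_trans (vnorm_approx fVn w2t) _; move: gkC1 gkC0; clear; lra.
apply: always_bind (always_fl_mulmv kappa u0 w2 usum g0 Vrow) _ => w3 t4 [w3E T4].
have {}w3E : vnorm (w3 - Vt *m w2) <= gam * k%:R * (6 * C).
  apply: le_trans w3E _; apply: mg_le; first by rewrite mulr_ge0.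
  by move: w2n; clear; lra.
have w3t : vnorm (w3 - Vt *m (fL *m (Vt^T *m e1))) <= 28 * (gam * k%:R * C).
  apply: le_trans (vnorm_tri w3E (_ : vnorm _ <= 2 * (11 * (gam * k%:R * C)))) _; last by clear; lra.
  rewrite -mulmxBr; apply: le_trans (V2 _) _; exact: ler_wpM2l.
have VfVn : vnorm (Vt *m (fL *m (Vt^T *m e1))) <= 4 * C.
  by apply: le_trans (V2 _) _; move: fVn; clear; lra.
have w3n : vnorm w3 <= 5 * C.
  by apply: le_trans (vnorm_approx VfVn w3t) _; move: gkC1 gkC0; clear; lra.
apply: always_bind (always_fl_mulmv kappa u0 w3 usum g0 Qrow) _ => w4 t5 [w4E T5].
have GC0 : 0 <= G * C by rewrite mulr_ge0.
have {}w4E : vnorm (w4 - Q *m w3) <= 10 * (G * C).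
  apply: le_trans w4E _.
  apply: (@le_trans _ _ (n%:R * (gam * (2 * k%:R * (5 * C))))).
    by do 3 (apply: ler_wpM2l; rewrite ?mulr_ge0 //).
  have := ler_wpM2r C0 gnkG; clear; lra.
have w4t : vnorm (w4 - Q *m (Vt *m (fL *m (Vt^T *m e1)))) <= 66 * (G * C).
  apply: le_trans (vnorm_tri w4E (_ : vnorm _ <= 2 * k%:R * (28 * (gam * k%:R * C)))) _.
    rewrite -mulmxBr; apply: le_trans (Qn _) _; by apply: ler_wpM2l; rewrite ?mulr_ge0.
  have : gam * k%:R ^+ 2 * C <= G * C.
    rewrite ler_wpM2r // ler_wpM2l //; by rewrite ler_peMl ?exprn_ge0.
  by rewrite expr2; clear; lra.
have w4n : vnorm w4 <= 8 * (k%:R * C) + 66 * (G * C).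
  apply: vnorm_approx w4t; apply: le_trans (Qn _) _.
  have k20 : 0 <= 2 * k%:R :> R by rewrite mulr_ge0.
  by have := ler_wpM2l k20 VfVn; clear; lra.
apply: always_impl (always_fl_scale kappa u0 nx w4) _ => y t6 [yE T6]; split; last first.
  move: T1 T2 T3 T4 T5 T6 mk n0 k0; clear.
  move=> T1 T2 T3 T4 T5 T6 mk n0 k0.
  have mkk : (m * kappa <= k * kappa)%N by rewrite leq_mul2r mk orbT.
  have mmk : (m * (2 * (m * kappa)) <= 2 * (k * k) * kappa)%N.
    apply: (@leq_trans (k * (2 * (k * kappa)))); last by lia.
    by apply: leq_mul => //; rewrite leq_mul2l.
  have nmk : (n * (2 * (m * kappa)) <= 2 * (n * k) * kappa)%N.
    apply: (@leq_trans (n * (2 * (k * kappa)))); last by lia.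
    by rewrite leq_mul2l leq_mul2l mkk !orbT.
  have kkk : (k * kappa <= k * k * kappa)%N by rewrite leq_mul2r leq_pmulr ?orbT.
  have nkk : (n * kappa <= n * k * kappa)%N by rewrite leq_mul2r leq_pmulr ?orbT.
  rewrite mulnDl -!mulnA; move: mmk nmk kkk nkk; rewrite -!mulnA => *.
  lia.
have -> : y - nx *: (Q *m (Vt *m (fL *m (Vt^T *m e1)))) =
    (y - nx *: w4) + nx *: (w4 - Q *m (Vt *m (fL *m (Vt^T *m e1)))).
  by rewrite scalerBr addrA subrK.
apply: le_trans (vnormD _ _) _; rewrite (vnormZ nx) ger0_norm //.
apply: (@le_trans _ _ (gam * (nx * (8 * (k%:R * C) + 66 * (G * C))) + nx * (66 * (G * C)))).
  apply: lerD; last exact: ler_wpM2l.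
  apply: le_trans yE _; rewrite ger0_norm //; apply: ler_pM; rewrite ?mulr_ge0 ?vnorm_ge0 //.
  exact: ler_wpM2l.
have h1 : nx * C * (gam * k%:R) <= nx * C * G by rewrite ler_wpM2l // mulr_ge0.
have h2 : nx * (G * C) * gam <= nx * (G * C) * (1 / (200 * 400)).
  by rewrite ler_wpM2l ?mulr_ge0 //; move: gG small; clear; lra.
have h3 : 0 <= nx * (G * C) by rewrite !mulr_ge0.
by move: h1 h2 h3; clear; lra.
Qed.

End FinalStage.

(** * Best uniform approximation and bounds on the spectrum *)

Section BestApproximation.
Variable R : realType.

(** Makes the inner supremum in [best_approx] that of a bounded set. *)
Lemma poly_bounded (p : {poly R}) (lo hi : R) :
  exists b, forall x, lo <= x <= hi -> `|p.[x]| <= b.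
Proof.
pose c := `|lo| + `|hi|.
exists (\sum_(i < size p) `|p`_i| * c ^+ i) => x /andP[lox xhi].
rewrite horner_coef; apply: le_trans (ler_norm_sum _ _ _) _.
apply: ler_sum => i _; rewrite normrM normrX; apply: ler_wpM2l => //.
apply: lerXn2r; rewrite ?nnegrE ?addr_ge0 // ler_norml /c.
have := ler_norm hi; have := ler_norm (- lo); rewrite normrN.
have := normr_ge0 lo; have := normr_ge0 hi.
by move: lox xhi; clear=> *; apply/andP; split; lra.
Qed.

(** The zero polynomial gives the upper bound C. The excess e of a near-minimizer is later charged
    to eps C. *)
Lemma best_approx_spec (f : R -> R) k (lo hi C : R) : lo <= hi ->
  (forall z, lo <= z <= hi -> `|f z| < C) ->
  [/\ 0 <= best_approx f k `[lo, hi], best_approx f k `[lo, hi] <= C &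
    forall e, 0 < e -> exists2 p : {poly R}, (size p <= k)%N &
      forall z, lo <= z <= hi -> `|p.[z] - f z| <= best_approx f k `[lo, hi] + e].
Proof.
move=> lohi fC; set I := `[lo, hi]%classic.
pose err (p : {poly R}) := [set `|p.[x] - f x| | x in I].
have inI z : lo <= z <= hi -> I z by move=> h; rewrite /I /= in_itv.
have Iin z : I z -> lo <= z <= hi by rewrite /I /= in_itv.
have ub p : has_ubound (err p).
  have [b pb] := poly_bounded p lo hi; exists (b + C) => _ [x /Iin xI <-].
  by apply: le_trans (ler_normB _ _) _; apply: lerD; [apply: pb|apply/ltW/fC].
have le_err p z : lo <= z <= hi -> `|p.[z] - f z| <= sup (err p).
  by move=> zI; apply: (ub_le_sup (ub p)); exists z => //; apply: inI.
have lo_in : lo <= lo <= hi by rewrite lexx.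
have err0 p : 0 <= sup (err p) := le_trans (normr_ge0 _) (le_err p lo lo_in).
set S := [set sup (err p) | p in [set p : {poly R} | (size p <= k)%N]].
have S0 : S (sup (err 0)) by exists 0 => //=; rewrite size_poly0.
have lbS : lbound S 0 by move=> _ [p _ <-].
have infS : has_inf S by split; [exists (sup (err 0)) | exists 0].
have bE : best_approx f k I = inf S by [].
rewrite bE; split.
- by apply: lb_le_inf => //; exists (sup (err 0)).
- apply: le_trans (ge_inf infS.2 S0) _; apply: ge_sup.
    by exists `|(0 : {poly R}).[lo] - f lo|, lo => //; apply: inI.
  by move=> _ [x /Iin xI <-]; rewrite horner0 sub0r normrN; apply/ltW/fC.
move=> e e0; have [_ [p sp <-] pe] := inf_adherent e0 infS.
exists p => // z zI; apply: le_trans (le_err p z zI) _; exact: ltW.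
Qed.

End BestApproximation.

Section LambdaBounds.
Variable R : realType.

Lemma lambda_le_opnorm n (A : 'M[R]_n) : (0 < n)%N -> A^T = A ->
  [/\ - opnorm A <= lambda_min A, lambda_max A <= opnorm A & lambda_min A <= lambda_max A].
Proof.
case: n A => // n A _ As; have [V [d VdA]] := symmetric_diagonalizable As.
have ev : [set a | eigenvalue A a] (d 0 ord0).
  by apply/(eigenvalue_diag _ As VdA); exists ord0.
have bnd a : [set a | eigenvalue A a] a -> - opnorm A <= a <= opnorm A.
  move=> /(eigenvalue_diag _ As VdA) [j ->].
  by rewrite -ler_norml (eigenvalue_le_opnorm j VdA).
split.
- by apply: lb_le_inf; [exists (d 0 ord0)|move=> a /bnd /andP[]].
- by apply: ge_sup; [exists (d 0 ord0)|move=> a /bnd /andP[]].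
- by have /andP[] := lambda_bounds ord0 As VdA; apply: le_trans.
Qed.

End LambdaBounds.

(** * Bookkeeping of the error constants *)

Section Arithmetic.
Variable R : realType.

(** Shares of eps C: the excess of [del] costs less than 1/2, each of the two polynomial transfers
    about 6/100, the remaining terms a few thousandths. The factors 101/100 compare nx with |x| and
    bound the computed vectors. *)
Lemma error_budget (k N eta eps C gam e t h delta nx X G del M : R) :
  del = delta + eps * C / (12 * k) -> M = 3 * C -> 1 <= k -> 0 < eta -> eta <= N -> 0 < eps -> 0 < C -> 0 <= gam -> 0 <= e ->
  0 <= t -> t <= 2 * N -> eta <= h -> 0 <= delta -> 0 <= nx -> nx <= 101 / 100 * X ->
  0 <= X -> 200 * 400 * gam <= eps -> 200 * 400 * G <= eps ->
  200 * 400 * (gam * k ^+ 5 * N) <= eps * eta ->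
  110 * 100 * (e * k ^+ 4 * N) <= eps * eta ->
  del * X + M * (gam * X)
  + nx * (8 * M * k ^+ 3 * (k * (200 * (gam * (k * N)))) / h)
  + nx * (101 / 100 * k * (4 * (e * M) + 8 * M * k ^+ 3 * (2 * (6 * (e * t))) / h))
  + nx * (101 / 100 * k * (4 * del)) + 80 * G * (nx * C)
  <= (7 * k * delta + eps * C) * X.
Proof.
move=> delE ME k1 eta0 etaN eps0 C0 gam0 e0 t0 tN etah delta0 nx0 nxX X0 gameps Geps P1 P2.
have k0 : 0 < k by apply: lt_le_trans k1.
have h0 : 0 < h by apply: lt_le_trans etah.
have N0 : 0 < N by apply: lt_le_trans etaN.
have epsC : 0 <= eps * C by rewrite mulr_ge0 // ltW.
have div_h a : 0 <= a -> a <= eps * eta -> a / h <= eps.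
  by move=> a0 ae; rewrite ler_pdivrMr //; apply: le_trans ae _; rewrite ler_pM2l.
have pos (c : R) : 0 <= c -> 0 <= 200 * 400 * c /\ 0 <= 110 * 100 * c.
  by clear => c0; split; lra.
set r1 := gam * k ^+ 5 * N in P1.
have r10 : 0 <= r1 by rewrite !mulr_ge0 ?exprn_ge0 // ltW.
have r1h : 200 * 400 * r1 / h <= eps by exact: div_h (pos _ r10).1 P1.
set r2 := e * k ^+ 4 * N in P2.
have r20 : 0 <= r2 by rewrite !mulr_ge0 ?exprn_ge0 // ltW.
have r2h : 110 * 100 * r2 / h <= eps by exact: div_h (pos _ r20).2 P2.
have ke : 110 * 100 * (e * k) <= eps.
  have : e * k * N <= r2.
    rewrite /r2 ler_wpM2r ?(ltW N0) // ler_wpM2l // -[leLHS]mulr1 exprS.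
    by rewrite ler_wpM2l ?(ltW k0) // exprn_ege1.
  move=> ekN; rewrite -(ler_pM2r N0).
  apply: le_trans (_ : _ <= eps * eta) _; last by rewrite ler_pM2l.
  by move: ekN P2; clear; lra.
have E3 : 8 * M * k ^+ 3 * (k * (200 * (gam * (k * N)))) / h = 60 * 80 * (C * (r1 / h)).
  by rewrite ME /r1; ring.
have E4 : k * (8 * M * k ^+ 3 * (2 * (6 * (e * t))) / h) <= 576 * (C * (r2 / h)).
  have -> : k * (8 * M * k ^+ 3 * (2 * (6 * (e * t))) / h) = 288 * (C * (e * k ^+ 4 * t / h)).
    by rewrite ME; ring.
  have -> : 576 * (C * (r2 / h)) = 288 * (C * (e * k ^+ 4 * (2 * N) / h)).
    by rewrite /r2; ring.
  have key : e * k ^+ 4 * t / h <= e * k ^+ 4 * (2 * N) / h.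
    rewrite ler_pM2r ?invr_gt0 //; apply: ler_wpM2l => //.
    by rewrite mulr_ge0 ?exprn_ge0 // ltW.
  by have := ler_wpM2l (ltW C0) key; clear; lra.
have T3 : 60 * 80 * (C * (r1 / h)) <= 6 / 100 * (eps * C).
  by have := ler_wpM2l (ltW C0) r1h; clear; lra.
have T4 : 576 * (C * (r2 / h)) <= 6 / 110 * (eps * C).
  by have := ler_wpM2l (ltW C0) r2h; move: epsC; clear; lra.
have T4' : k * (4 * (e * M)) <= 1 / 500 * (eps * C).
  by have := ler_wpM2l (ltW C0) ke; move: epsC; rewrite ME; clear; lra.
have T2 : M * gam <= 1 / 1000 * (eps * C).
  by have := ler_wpM2l (ltW C0) gameps; move: epsC; rewrite ME; clear; lra.
have T6 : 80 * G * C <= 1 / 1000 * (eps * C).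
  by have := ler_wpM2l (ltW C0) Geps; move: epsC; clear; lra.
have kdel : k * del = k * delta + eps * C / 12.
  by rewrite delE mulrDr; congr (_ + _); field; rewrite lt0r_neq0.
have delk : del <= k * del.
  by rewrite ler_peMl // delE addr_ge0 // divr_ge0 // mulr_ge0 // ltW.
have kd0 : 0 <= k * delta by rewrite mulr_ge0 // ltW.
pose Z := 8 * M * k ^+ 3 * (k * (200 * (gam * (k * N)))) / h
  + (101 / 100 * k * (4 * (e * M) + 8 * M * k ^+ 3 * (2 * (6 * (e * t))) / h))
  + (101 / 100 * k * (4 * del)) + 80 * G * C.
have -> : del * X + M * (gam * X)
  + nx * (8 * M * k ^+ 3 * (k * (200 * (gam * (k * N)))) / h)
  + nx * (101 / 100 * k * (4 * (e * M) + 8 * M * k ^+ 3 * (2 * (6 * (e * t))) / h))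
  + nx * (101 / 100 * k * (4 * del)) + 80 * G * (nx * C) =
  (del + M * gam) * X + nx * Z by rewrite /Z; ring.
have ZE : Z <= 404 / 100 * (k * delta) + 1 / 2 * (eps * C).
  rewrite /Z E3; move: T3 (le_trans E4 T4) T4' T6 kdel epsC kd0.
  set a1 := 8 * M * _ * _ / h; set a2 := 4 * (e * M); set a3 := C * (r1 / h).
  have -> : 101 / 100 * k * (a2 + a1) = 101 / 100 * (k * a2) + 101 / 100 * (k * a1) by ring.
  have -> : 101 / 100 * k * (4 * del) = 404 / 100 * (k * del) by field.
  by clear; lra.
have ZB : nx * Z <= 101 / 100 * X * (404 / 100 * (k * delta) + 1 / 2 * (eps * C)).
  apply: le_trans (ler_wpM2l nx0 ZE) _; apply: (ler_wpM2r _ nxX).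
  by move: epsC kd0; clear; lra.
apply: le_trans (lerD (lexx _) ZB) _.
rewrite -subr_ge0.
have -> : (7 * k * delta + eps * C) * X - ((del + M * gam) * X +
   101 / 100 * X * (404 / 100 * (k * delta) + 1 / 2 * (eps * C))) =
  (7 * k * delta + eps * C - (del + M * gam) - 101 / 100 * (404 / 100 * (k * delta) + 1 / 2 * (eps * C))) * X.
  by field.
apply: (mulr_ge0 _ X0); move: T2 delk kdel kd0 epsC.
by clear; lra.
Qed.

End Arithmetic.

(** * The whole algorithm under explicit smallness conditions *)

Section LanczosAnalysis.
Variable R : realType.

Lemma tridiag_rcons (als bes : seq R) b : size bes = size als ->
  tridiag (size als) als (rcons bes b) = tridiag (size als) als bes.
Proof.
move=> sb; apply/matrixP => i j; rewrite !mxE !nth_rcons sb.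
by have := ltn_ord i; have := ltn_ord j => -> ->.
Qed.

Lemma col_seq_rcons n (qs : seq 'cV[R]_n) q m : size qs = m ->
  col_seq (nth 0 (rcons qs q)) m = col_seq (nth 0 qs) m.
Proof. by move=> sq; apply/matrixP => i j; rewrite !mxE nth_rcons sq ltn_ord. Qed.

Lemma log2_ge0 (x : R) : 1 <= x -> 0 <= log2 x.
Proof. by move=> x1; rewrite divr_ge0 ?ln_ge0 // ler1n. Qed.

Lemma log2_le (x y : R) : 0 < x -> x <= y -> log2 x <= log2 y.
Proof.
move=> x0 xy; rewrite ler_wpM2r ?invr_ge0 ?ln_ge0 ?ler1n //.
by rewrite ler_ln ?posrE // (lt_le_trans x0).
Qed.

Definition lanczos_raw_time (n k kappa mv : nat) : nat :=
  (2 * (n * kappa) + kappa + n * kappa + k * lanczos_iter_time n kappa mv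
   + (6 * (k * k) + 3 * (n * k)) * kappa)%N.

(** Origin of the exponents: Paige's condition 32 m^3 tau <= Delta needs gam k^5 |A| below a
    fraction of eta, as tau carries one k and 1 / Delta another; the Krylov transfer gives k^3 m
    tau, again k^5. For [e1] the transfer gives k^3 and the norm of Q one more k. The factor n pays
    for the product with Q. *)
Lemma always_lanczos n (A : 'M[R]_n) (x : 'cV[R]_n) k (eta eps C : R) (f : R -> R)
    mv (u : R) kappa (ge : eigensolver R) (c K e1 gam : R) :
  A^T = A -> x != 0 -> (1 <= k)%N -> 0 < eta -> eta <= opnorm A -> 0 < eps -> eps <= 1 ->
  (forall z, spec_interval A eta z -> `|f z| < C) ->
  0 <= u -> u <= gam -> (forall j, (j <= n + k)%N -> (1 + u) ^+ j.+1 <= 1 + gam) ->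
  2 * n%:R `^ (3 / 2) * u <= gam ->
  200 * 400 * (gam * (n%:R * k%:R ^+ 5) * opnorm A) <= eps * eta ->
  110 * 100 * (e1 * k%:R ^+ 4 * opnorm A) <= eps * eta ->
  0 < e1 -> (forall m, (0 < m <= k)%N -> c * m%:R ^+ 3 * log2 m%:R * u <= e1) ->
  0 < K -> gu_eisenstat u c K ge ->
  always (lanczos u kappa A mv ge e1 k x f) (fun y t =>
    vnorm (mxfun f A *m x - y)
      <= (7 * k%:R * best_approx f k (spec_interval A eta) + eps * C) * vnorm x
    /\ t%:R <= (lanczos_raw_time n k kappa mv)%:R
        + K * (k%:R ^+ 2 * log2 (k%:R / e1) + k%:R * log2 (k%:R / e1) ^+ 2)).
Proof.
move=> As x0 k1 eta0 etaN eps0 eps1 fC u0 ug usum umul P1 P2 e10 prec K0 geP.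
have n0 : (0 < n)%N.
  by case: (n) x x0 => // y; rewrite (flatmx0 y) eqxx.
have [V [d [VV AE FE]]] : exists (V : 'M[R]_n) (d : 'rV[R]_n), [/\ V^T *m V = 1%:M,
    A = V *m diag_mx d *m V^T & mxfun f A = V *m diag_mx (map_mx f d) *m V^T].
  (* The analysis runs with whichever diagonalization the choice in [mxfun] provides; the spectral
     theorem excludes the default value. *)
  rewrite /mxfun; case: xgetP => [F _ [V [d [VV AE FE]]]|none]; first by exists V, d.
  have [V [d [VV AE]]] := symmetric_diagonalizable As.
  by case: (none (V *m diag_mx (map_mx f d) *m V^T)); exists V, d.
set N := opnorm A in etaN P1 P2.
have N0 : 0 < N by apply: lt_le_trans etaN.
have g0 : 0 <= gam := le_trans u0 ug.
have n1r : 1 <= n%:R :> R by rewrite ler1n.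
have k1r : 1 <= k%:R :> R by rewrite ler1n.
have k0r : 0 < k%:R :> R by apply: lt_le_trans k1r.
have epsN : eps * eta <= eps * N by rewrite ler_pM2l.
have kpow j : 1 <= k%:R ^+ j :> R by apply: exprn_ege1.
have gnk5 : 200 * 400 * (gam * (n%:R * k%:R ^+ 5)) <= eps.
  rewrite -(ler_pM2r N0); apply: le_trans epsN; apply: le_trans P1.
  by clear; lra.
have le_gnk5 a : a <= n%:R * k%:R ^+ 5 -> 200 * 400 * (gam * a) <= eps.
  move=> ah; apply: le_trans gnk5; have := ler_wpM2l g0 ah; clear; lra.
have gk : 200 * 400 * (gam * k%:R) <= eps.
  apply: le_gnk5; rewrite -[leLHS]mul1r; apply: ler_pM => //.
  by rewrite -[leLHS]expr1; apply: ler_weXn2l.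
have gG : 200 * 400 * (gam * (n%:R * k%:R ^+ 2)) <= eps.
  by apply: le_gnk5; rewrite ler_wpM2l //; apply: ler_weXn2l.
have gg : 200 * 400 * gam <= eps.
  have := @le_gnk5 1; rewrite mulr1; apply.
  by rewrite -[leLHS]mul1r; apply: ler_pM.
have g1 : gam <= 1 / 1000 by move: gg eps1 g0; clear; lra.
have g10 : gam <= 1 / 10 by move: g1; clear; lra.
have gk1 : 1000 * (gam * k%:R) <= 1.
  by move: gk eps1 (mulr_ge0 g0 (ltW k0r)); clear; lra.
have e1k4 : 110 * 100 * (e1 * k%:R ^+ 4) <= eps.
  rewrite -(ler_pM2r N0); apply: le_trans epsN; apply: le_trans P2.
  by clear; lra.
have e1N : 110 * 100 * (e1 * N) <= eta.
  have : eps * eta <= eta by rewrite ler_piMl // ltW.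
  have : e1 * N <= e1 * k%:R ^+ 4 * N.
    by rewrite ler_wpM2r ?(ltW N0) // ler_peMr // ltW.
  by move: P2; clear; lra.
have e11 : 110 * 100 * e1 <= 1.
  have : e1 <= e1 * k%:R ^+ 4 by rewrite ler_peMr // ltW.
  by move: e1k4 eps1; clear; lra.
have e12 : e1 <= 1 / 100 by move: e11 e10; clear; lra.
set lo := lambda_min A - eta; set hi := lambda_max A + eta.
have [lamN lamN' lamlam] := lambda_le_opnorm n0 As.
rewrite -/N in lamN lamN'.
have etah : eta <= hi - lo by rewrite /hi /lo; move: lamlam eta0; clear; lra.
have lohi : lo < hi by rewrite -subr_gt0 (lt_le_trans eta0).
have fC' z : lo <= z <= hi -> `|f z| < C.
  by move=> zI; apply: fC; rewrite /spec_interval /= in_itv.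
have C0 : 0 < C.
  by apply: le_lt_trans (normr_ge0 _) (fC' lo _); rewrite lexx ltW.
have [b0 bC bp] := best_approx_spec k (ltW lohi) fC'.
rewrite /spec_interval -/lo -/hi; set delta := best_approx _ _ _ in b0 bC bp *.
have tol0 := lanczos_tol_ge0 A k g0.
rewrite /lanczos.
have usum_n : (1 + u) ^+ n.+1 <= 1 + gam by apply: usum; apply: leq_addr.
apply: always_bind (always_fl_norm kappa u0 x usum_n g10) _ => nx t1 [nxE T1].
apply: always_bind (always_fl_vdiv kappa u0 x nx) _ => q1 t2 [q1E T2].
have [nx0 nxq q1u] := normalize_error u0 ug g1 x0 nxE q1E.
apply: always_bind (always_lanczos_loop kappa mv g0 gk1 u0 ug usum_n umul
  (inv_start A k q1u) (add0n k) k1) _ => -[[qs als] bes] t3 [post T3].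
case: post => szq szb mk [ql [bl [rel qu q0 stop]]].
set m := size als in szq szb mk rel qu stop T3 *; set T := tridiag m als bes.
have [m0 mk'] := andP mk.
have mkr : m%:R <= k%:R :> R by rewrite ler_nat.
have m1r : 1 <= m%:R :> R by rewrite ler1n.
have m0r : 0 < m%:R :> R by apply: lt_le_trans m1r.
have e1h : e1 <= 1 / 2 by move: e12; clear; lra.
have geA := geP m T e1 m0 (tridiag_sym m als bes)
  (@tridiag_tridiagonal _ m als bes) e10 (prec m mk) e1h.
apply: always_bind geA _ => -[Vt L] t4 [/= VLT VtV T4].
have VdA : diagonalizes V d A by split.
have dI i : lo <= d 0 i <= hi.
  have /andP[h1 h2] := lambda_bounds i As VdA.
  by rewrite /lo /hi; move: h1 h2 eta0; clear=> *; apply/andP; split; lra.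
have [W [dT WdT]] := symmetric_diagonalizable (tridiag_sym m als bes).
have TE : T = tridiag m als (rcons bes bl) by rewrite tridiag_rcons.
have WdT' : diagonalizes W dT (tridiag m als (rcons bes bl)) by rewrite -TE.
pose Delta := eta / (2 * k%:R).
have D0 : 0 < Delta by rewrite divr_gt0 // mulr_gt0.
have mD : m%:R * Delta <= eta / 2.
  have -> : eta / 2 = k%:R * Delta by rewrite /Delta; field; rewrite lt0r_neq0.
  by rewrite ler_wpM2r // ltW.
have smallD : 32 * m%:R ^+ 3 * lanczos_tol A k gam <= Delta.
  rewrite /Delta ler_pdivlMr ?mulr_gt0 //.
  apply: (@le_trans _ _ (32 * k%:R ^+ 3 * lanczos_tol A k gam * (2 * k%:R))).
    do 2 (apply: ler_wpM2r; first by rewrite ?mulr_ge0 // ltW).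
    by rewrite ler_wpM2l // lerXn2r ?nnegrE // ltW.
  have -> : 32 * k%:R ^+ 3 * lanczos_tol A k gam * (2 * k%:R) =
     64 * 200 * (gam * (1 * k%:R ^+ 5) * N) by rewrite /lanczos_tol -/N; ring.
  have h : gam * (1 * k%:R ^+ 5) * N <= gam * (n%:R * k%:R ^+ 5) * N.
    apply: (ler_wpM2r (ltW N0)); apply: (ler_wpM2l g0); exact: ler_wpM2r.
  have h0 : 0 <= gam * (1 * k%:R ^+ 5) * N.
    by rewrite !mulr_ge0 ?(ltW N0) // (le_trans _ (kpow 5)).
  have : eps * eta <= eta by rewrite ler_piMl // ltW.
  by move: P1 h h0; clear; lra.
have dTI i : lambda_min A - eta / 2 <= dT 0 i <= lambda_max A + eta / 2.
  have /andP[h1 h2] := ritz_values_range tol0 D0 smallD i As rel WdT'.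
  by move: h1 h2 mD; clear=> *; apply/andP; split; lra.
have dTI' i : lo <= dT 0 i <= hi.
  have /andP[h1 h2] := dTI i.
  by rewrite /lo /hi; move: h1 h2 eta0; clear=> *; apply/andP; split; lra.
have Tn : opnorm T <= 2 * N.
  apply: opnorm_le => [|v]; first by rewrite mulr_ge0 // ltW.
  rewrite /T WdT.2; apply: vnorm_conj_diag => [||i]; first exact: WdT.1.
    by rewrite mulr_ge0 // ltW.
  have /andP[h1 h2] := dTI i; rewrite ler_norml.
  by move: h1 h2 lamN lamN' etaN eta0; clear=> *; apply/andP; split; lra.
have [Vdef LI0] := eigensolver_error VLT VtV e12 WdT dTI.
have [_ V2 VT2 VVT] := almost_orthogonal VtV e12.
have e1T0 : 0 <= e1 * opnorm T by rewrite mulr_ge0 ?opnorm_ge0 // ltW.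
(* The Ritz values have used eta / 2; 24 e1 |T| <= 48 e1 |A| fits into the other half. *)
have LI i : lo <= L 0 i <= hi.
  have /andP[h1 h2] := LI0 i.
  have : e1 * opnorm T <= e1 * (2 * N) by rewrite ler_pM2l.
  by rewrite /lo /hi; move: h1 h2 e1N eta0; clear=> *; apply/andP; split; lra.
have epsC0 : 0 < eps * C / (12 * k%:R) by rewrite divr_gt0 ?mulr_gt0.
have [p sp pf] := bp _ epsC0.
set del := delta + _ in pf.
have del0 : 0 <= del by rewrite addr_ge0 // ltW.
have delC : del <= 2 * C.
  have : eps * C / (12 * k%:R) <= C.
    rewrite ler_pdivrMr ?mulr_gt0 //.
    have h1 : eps * C <= C by rewrite ler_piMl // ltW.
    have h2 : C <= C * k%:R by rewrite ler_peMr // ltW.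
    by move: h1 h2 C0; clear; lra.
  by rewrite /del; move: bC; clear; lra.
have pM z : lo <= z <= hi -> `|p.[z]| <= 3 * C.
  move=> zI; have h1 := pf z zI; have h2 := fC' z zI.
  rewrite -(subrK (f z) p.[z]); apply: le_trans (ler_normD _ _) _.
  by move: h1 h2 delC; clear; lra.
have qE t : (t < m)%N -> (rcons qs ql)`_t = qs`_t by move=> tm; rewrite nth_rcons szq tm.
have qn t : (t < m)%N -> vnorm (rcons qs ql)`_t <= 101 / 100.
  move=> tm; rewrite qE //; apply: le_trans (vnorm_unit_approx g0 (qu t tm)) _.
  by move: g1; clear; lra.
have q0' : (rcons qs ql)`_0 = q1 by rewrite qE.
have bstop : (m < k)%N -> (rcons bes bl)`_m = 0.
  by move=> /stop ->; rewrite nth_rcons szb ltnn eqxx.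
have QE : col_seq (nth 0 (rcons qs ql)) m = col_seq (nth 0 qs) m by apply: col_seq_rcons.
have split_err := @lanczos_error_split _ n A V d k m _ als (rcons bes bl) W Vt dT L
  (lanczos_tol A k gam) lo hi (3 * C) del (6 * (e1 * opnorm T)) e1 nx gam p f x
  rel tol0 VdA WdT' mk bstop lohi dI dTI' LI sp pM pf del0 _ _ (ltW e10) (ltW nx0)
  V2 VT2 VVT _ qn _.
rewrite QE q0' -TE in split_err.
have C30 : 0 <= 3 * C by rewrite mulr_ge0 // ltW.
have kap0 : 0 <= 6 * (e1 * opnorm T) by rewrite mulr_ge0.
have {}split_err := split_err C30 kap0 Vdef nxq.
have Qn w : vnorm (col_seq (nth 0 qs) m *m w) <= 2 * k%:R * vnorm w.
  rewrite -QE; apply: le_trans (vnorm_col_seq_mul w qn) _.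
  rewrite ler_wpM2r ?vnorm_ge0 //; move: mkr k0r; clear; lra.
have Qrow i : vnorm (row i (col_seq (nth 0 qs) m))^T <= 2 * k%:R.
  rewrite -QE; apply: (@le_trans _ _ (m%:R * (101 / 100))); last by move: mkr k0r; clear; lra.
  apply: vnorm_le_entries => j; rewrite !mxE.
  by apply: le_trans (entry_le_vnorm _ _) (qn _ _).
have fL i : `|f (L 0 i)| <= C by apply/ltW/fC'.
have usum_m : (1 + u) ^+ m.+1 <= 1 + gam.
  by apply: usum; apply: leq_trans mk' _; apply: leq_addl.
have gG1 : 200 * 400 * (gam * (n%:R * k%:R ^+ 2)) <= 1 by apply: le_trans gG eps1.
have FS := @always_final_stage R n m k Vt L (col_seq (nth 0 qs) m) nx C gam u kappa f
  u0 ug usum_m gG1 n0 k1 mk' fL (ltW C0) (ltW nx0) V2 VT2 Qrow Qn.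
apply: always_impl FS _ => y t5 [yE T5]; split; last first.
  have lmk : log2 (m%:R / e1) <= log2 (k%:R / e1).
    by apply: log2_le; rewrite ?divr_gt0 // ler_pM2r // invr_gt0.
  have lm0 : 0 <= log2 (m%:R / e1).
    by apply: log2_ge0; rewrite ler_pdivlMr // mul1r; move: e12 m1r; clear; lra.
  have {}T4 : t4%:R <= K * (k%:R ^+ 2 * log2 (k%:R / e1) + k%:R * log2 (k%:R / e1) ^+ 2).
    have m2 : m%:R ^+ 2 <= k%:R ^+ 2 :> R by rewrite lerXn2r ?nnegrE.
    have l2 : log2 (m%:R / e1) ^+ 2 <= log2 (k%:R / e1) ^+ 2.
      by rewrite lerXn2r ?nnegrE // (le_trans lm0).
    apply: le_trans T4 _; rewrite ler_pM2l //.
    by apply: lerD; apply: ler_pM; rewrite ?exprn_ge0.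
  have -> : (t1 + (t2 + (t3 + (t4 + t5))) = (t1 + t2 + t3 + t5) + t4)%N by clear; lia.
  rewrite natrD; apply: lerD => //; rewrite ler_nat /lanczos_raw_time.
  by apply: leq_add T5; apply: leq_add T3; apply: leq_add T2.
rewrite FE.
set ystar := nx *: _ in yE; set Fx := _ *m x.
have -> : Fx - y = (Fx - ystar) - (y - ystar) by rewrite opprB addrA subrK.
apply: le_trans (vnormB _ _) _.
apply: le_trans (lerD split_err yE) _.
have nxX : nx <= 101 / 100 * vnorm x.
  move: nxE; rewrite ler_norml => /andP[_ h].
  have : gam * vnorm x <= 1 / 1000 * vnorm x by rewrite ler_wpM2r ?vnorm_ge0.
  by move: h (vnorm_ge0 x); clear; lra.
have P1' : 200 * 400 * (gam * k%:R ^+ 5 * N) <= eps * eta.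
  apply: le_trans P1.
  have : gam * k%:R ^+ 5 * N <= gam * (n%:R * k%:R ^+ 5) * N.
    apply: (ler_wpM2r (ltW N0)); apply: (ler_wpM2l g0); apply: ler_peMl => //.
  by clear; lra.
have delE : del = delta + eps * C / (12 * k%:R) by [].
have B := error_budget delE (erefl (3 * C)) k1r eta0 etaN eps0 C0 g0 (ltW e10)
  (opnorm_ge0 T) Tn etah b0 (ltW nx0) nxX (vnorm_ge0 x) gg gG P1' P2.
exact: B.
Qed.

End LanczosAnalysis.

(** * Choice of the constants *)

Section Constants.
Variable R : realType.

(** A converse of Bernoulli's inequality, valid while 2 j u <= 1. *)
Lemma expr1Dx_le (u : R) j : 0 <= u -> 2 * j%:R * u <= 1 -> (1 + u) ^+ j <= 1 + 2 * j%:R * u.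
Proof.
move=> u0; elim: j => [|j IH]; first by rewrite expr0 mulr0 mul0r addr0.
rewrite -[j.+1%:R]natr1 => h.
have ju : 0 <= 2 * j%:R * u by rewrite !mulr_ge0.
have {}IH : (1 + u) ^+ j <= 1 + 2 * j%:R * u by apply: IH; move: h u0; clear; lra.
have ju1 : 2 * j%:R * u <= 1 by move: h u0; clear; lra.
rewrite exprS; have u1 : 0 <= 1 + u by rewrite addr_ge0.
apply: le_trans (ler_wpM2l u1 IH) _.
have := ler_wpM2r u0 ju1; clear; lra.
Qed.

Lemma ln2_gt0 : 0 < ln 2 :> R.
Proof. by rewrite ln_gt0 // ltr1n. Qed.

Lemma log2_powR (a : R) : log2 (2 `^ a) = a.
Proof. by rewrite /log2 ln_powR mulfK // lt0r_neq0 // ln2_gt0. Qed.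

Lemma powR_log2 (x : R) : 0 < x -> 2 `^ log2 x = x.
Proof.
move=> x0; rewrite /powR pnatr_eq0 /= /log2 divfK ?lt0r_neq0 ?ln2_gt0 //.
by rewrite lnK.
Qed.

Lemma log2_nat_le m : (0 < m)%N -> log2 m%:R <= m%:R :> R.
Proof.
move=> m0; rewrite -[leRHS]log2_powR powR_mulrn //.
apply: log2_le; first by rewrite ltr0n.
by rewrite -natrX ler_nat ltnW // ltn_expl.
Qed.

Lemma powRinv (a r : R) : 0 <= a -> (a^-1) `^ r = (a `^ r)^-1.
Proof. by move=> a0; rewrite -powR_inv1 // -powRrM mulN1r powRN. Qed.

End Constants.

Theorem theorem1 (R : realType) (kappa : nat) (c K Kmv : R)
    (hc : 0 < c) (hK : 0 < K) (hKmv : 0 < Kmv) :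
  exists c'0 : R, 0 < c'0 /\
  forall c' : R, c'0 <= c' ->
  exists c0 Ct : R, 0 < c0 /\ 0 < Ct /\
  forall (n : nat) (A : 'M[R]_n) (x : 'cV[R]_n) (k : nat) (eta eps C : R)
    (f : R -> R) (mv : nat) (u : R) (ge : eigensolver R),
  let B := log2 (n%:R * k%:R * opnorm A / (eps * eta)) in
  let B1 := Num.max B 1 in
  let I := spec_interval A eta in
  let e1 := (eps * eta / (3 * n%:R * k%:R * opnorm A)) `^ c' in
  A^T = A -> x != 0 -> (1 <= k)%N ->
  0 < eta -> eta <= opnorm A ->
  0 < eps -> eps <= 1 ->
  (forall z : R, I z -> `|f z| < C) ->
  n%:R <= Kmv * mv%:R ->
  0 <= u -> u <= 2 `^ (- (c0 * B1)) ->
  gu_eisenstat u c K ge ->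
  always (lanczos u kappa A mv ge e1 k x f) (fun y t =>
    vnorm (mxfun f A *m x - y)
      <= (7 * k%:R * best_approx f k I + eps * C) * vnorm x
    /\ t%:R <= Ct * (mv%:R * k%:R + k%:R ^+ 2 * B1 + k%:R * B1 ^+ 2)).
Proof.
(* The condition on [e1] is met through e1 Z^14 <= 1, for which c' >= 14 is enough; 19 leaves
   room. *)
exists 19; split=> // c' c'19.
have [s cs] : exists s : nat, c <= 2 ^+ s.
  exists (Num.truncn c).+1; apply: le_trans (ltW (truncnS_gt c)) _.
  by rewrite -natrX ler_nat ltnW // ltn_expl.
(* Y^28 u <= 1 pays for the rounding conditions: Y^21 >= 2^21 beats the numerical constant and Y^7
   beats X^7. The rest covers the precision demanded by the eigensolver, where Y^s >= c and Y^(3 c')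
   >= 1 / e1. *)
pose c0 := 28 + 3 * c' + s%:R.
(* log2(k / e1) <= D B1, because k <= Y and 1 / e1 <= Y^(3 c'). *)
pose D := 1 + 3 * c'.
pose kp : R := kappa%:R.
pose Ct := 15 * kp * Kmv + 9 * kp + 1 + K * D + K * D ^+ 2.
have kp0 : 0 <= kp by [].
have D1 : 1 <= D by rewrite /D; move: c'19; clear; lra.
have D0 : 0 <= D by apply: le_trans D1.
have c00 : 0 < c0 by rewrite /c0; have : 0 <= s%:R :> R by []; move: c'19; clear; lra.
have kpK0 : 0 <= 15 * kp * Kmv by rewrite mulr_ge0 ?mulr_ge0 // ltW.
have KD0 : 0 <= K * D by rewrite mulr_ge0 // ltW.
have KD20 : 0 <= K * D ^+ 2 by rewrite mulr_ge0 ?exprn_ge0 // ltW.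
have Ct0 : 0 < Ct by rewrite /Ct; move: kpK0 KD0 KD20 kp0; clear; lra.
exists c0, Ct; do 2 split=> //.
move=> n A x k eta eps C f mv u ge B B1 I e1 As x0 k1 eta0 etaN eps0 eps1 fC nmv u0 uB geP.
have n0 : (0 < n)%N by case: (n) x x0 => // y; rewrite (flatmx0 y) eqxx.
pose N := opnorm A; rewrite -/N in etaN.
have N0 : 0 < N by apply: lt_le_trans etaN.
have n1r : 1 <= n%:R :> R by rewrite ler1n.
have k1r : 1 <= k%:R :> R by rewrite ler1n.
have k0r : 0 < k%:R :> R by apply: lt_le_trans k1r.
have n0r : 0 < n%:R :> R by apply: lt_le_trans n1r.
have nk1 : 1 <= n%:R * k%:R :> R by rewrite -natrM ler1n muln_gt0 n0.
have ee0 : 0 < eps * eta by rewrite mulr_gt0.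
(* X = 2 ^ B bounds n, k and N / (eps eta); Y = 2 ^ B1 also absorbs constants. *)
pose X := n%:R * k%:R * N / (eps * eta).
have eeN : eps * eta <= N by apply: le_trans etaN; rewrite ler_piMl // ltW.
have XN : n%:R * k%:R * N = X * (eps * eta) by rewrite /X divfK // lt0r_neq0.
have nkX : n%:R * k%:R <= X.
  rewrite /X ler_pdivlMr // ler_wpM2l // ltW //; exact: lt_le_trans nk1.
have X1 : 1 <= X by apply: le_trans nkX.
have X0 : 0 < X by apply: lt_le_trans X1.
have nX : n%:R <= X by apply: le_trans nkX; rewrite ler_peMr // ltW.
have kX : k%:R <= X by apply: le_trans nkX; rewrite ler_peMl // ltW.
have B1B : B <= B1 by rewrite /B1 le_max lexx.
have B11 : 1 <= B1 by rewrite /B1 le_max lexx orbT.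
clearbody B1.
pose Y : R := 2 `^ B1.
have le12 : 1 <= 2 :> R by rewrite ler1n.
have XY : X <= Y.
  by rewrite -[X]powR_log2 //; apply: ler_powR.
have Y2 : 2 <= Y by rewrite -[leLHS]powRr1 //; apply: ler_powR.
have Y1 : 1 <= Y by apply: le_trans Y2.
have Y0 : 0 < Y by apply: lt_le_trans Y1.
have Yu r : r <= c0 -> Y `^ r * u <= 1.
  move=> rc; have -> : 1 = Y `^ r * Y `^ (- r).
    by rewrite powRN mulfV // lt0r_neq0 // powR_gt0.
  rewrite ler_pM2l ?powR_gt0 //; apply: le_trans uB _.
  rewrite (mulrC c0) -mulrN powRrM -/Y; apply: ler_powR => //.
  by rewrite lerN2.
have s0 : 0 <= s%:R :> R by [].
have Yu28 : Y ^+ 28 * u <= 1.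
  by rewrite -powR_mulrn ?(ltW Y0) //; apply: Yu; rewrite /c0; move: s0 c'19; clear; lra.
have Xj j : X ^+ j <= Y ^+ j by rewrite lerXn2r ?nnegrE // ltW.
have twoj j : 2 ^+ j <= Y ^+ j by rewrite lerXn2r ?nnegrE // ltW.
(* 1 / Z is the base of the power [e1]; Z <= Y^3 since 3 <= Y^2. *)
pose Z := 3 * X.
have Z3 : 3 <= Z by rewrite /Z; move: X1; clear; lra.
have Z1 : 1 <= Z by move: Z3; clear; lra.
have Z0 : 0 < Z by apply: lt_le_trans Z1.
have ZY : Z <= Y ^+ 3.
  apply: (@le_trans _ _ (3 * Y)); first by rewrite /Z ler_pM2l.
  rewrite exprS mulrC ler_wpM2l ?(ltW Y0) //.
  by apply: le_trans (twoj 2%N); rewrite expr2; clear; lra.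
have e1E : e1 = (Z `^ c')^-1.
  rewrite -powRinv ?(ltW Z0) // /e1; congr (_ `^ _); rewrite /Z /X -/N.
  by field; rewrite !lt0r_neq0.
have Zc0 : 0 < Z `^ c' by apply: powR_gt0.
have e10 : 0 < e1 by rewrite e1E invr_gt0.
clearbody e1.
have ZcY : Z `^ c' <= Y `^ (3 * c').
  rewrite powRrM powR_mulrn ?(ltW Y0) //; apply: ge0_ler_powR; rewrite ?nnegrE //.
  - by move: c'19; clear; lra.
  - exact: ltW.
  - by rewrite exprn_ge0 // ltW.
have e1Z j : (j <= 19)%N -> e1 * Z ^+ j <= 1.
  move=> j19; rewrite e1E mulrC ler_pdivrMr // mul1r -powR_mulrn ?(ltW Z0) //.
  by apply: ler_powR => //; apply: le_trans c'19; rewrite ler_nat.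
(* X^2 covers both n + k + 1 roundings, at most 3 X, and the n^(3/2) of the product with A. *)
pose gam := 16 * X ^+ 2 * u.
have XX : X <= X ^+ 2 by rewrite expr2 ler_peMl // ltW.
have ugam : u <= gam.
  have : 1 <= X ^+ 2 by apply: exprn_ege1.
  by move/(ler_wpM2r u0); rewrite /gam; move: u0; clear; lra.
have X2u : 200 * 400 * 16 * (X ^+ 7 * u) <= 1.
  apply: le_trans Yu28; rewrite (_ : 28 = 21 + 7)%N // exprD -[leRHS]mulrA.
  have h21 : 200 * 400 * 16 <= Y ^+ 21.
    by apply: le_trans (twoj 21%N); clear; lra.
  have h0 : 0 <= 200 * 400 * 16 :> R by clear; lra.
  apply: (ler_pM h0 _ h21); first by rewrite mulr_ge0 ?exprn_ge0 // ltW.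
  by rewrite ler_wpM2r.
have X7 j : (j <= 7)%N -> X ^+ j * u <= X ^+ 7 * u.
  by move=> j7; rewrite ler_wpM2r //; apply: ler_weXn2l.
have usum j : (j <= n + k)%N -> (1 + u) ^+ j.+1 <= 1 + gam.
  move=> jnk; have jX : j.+1%:R <= 3 * X.
    have : j.+1%:R <= n%:R + k%:R + 1 :> R by rewrite -natrD natr1 ler_nat ltnS.
    by move: nX kX X1; clear; lra.
  have ju : 2 * j.+1%:R * u <= 6 * (X ^+ 2 * u).
    have := ler_wpM2r u0 jX; have := ler_wpM2r u0 XX; clear; lra.
  have X2u0 : 0 <= X ^+ 2 * u by rewrite mulr_ge0 ?exprn_ge0 // ltW.
  apply: le_trans (expr1Dx_le u0 _) _.
    have := X7 2%N isT; move: X2u ju X2u0; clear; lra.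
  by rewrite /gam; move: ju X2u0; clear; lra.
have umul : 2 * n%:R `^ (3 / 2) * u <= gam.
  rewrite /gam ler_wpM2r //.
  have h1 : n%:R `^ (3 / 2) <= X ^+ 2.
    apply: (@le_trans _ _ (n%:R ^+ 2)); last by rewrite lerXn2r ?nnegrE // ltW.
    by rewrite -[leRHS]powR_mulrn //; apply: ler_powR => //; clear; lra.
  by move: h1 (exprn_ge0 2 (ltW X0)); clear; lra.
(* n k |A| = X eps eta turns the left side into a multiple of X^7 u eps eta. *)
have P1 : 200 * 400 * (gam * (n%:R * k%:R ^+ 5) * N) <= eps * eta.
  have -> : 200 * 400 * (gam * (n%:R * k%:R ^+ 5) * N) =
     200 * 400 * 16 * (X ^+ 2 * k%:R ^+ 4 * u * (n%:R * k%:R * N)).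
    by rewrite /gam; ring.
  rewrite XN; have h1 : X ^+ 2 * k%:R ^+ 4 * u * (X * (eps * eta)) <= X ^+ 7 * u * (eps * eta).
    have -> : X ^+ 7 * u * (eps * eta) = X ^+ 2 * X ^+ 4 * u * (X * (eps * eta)) by ring.
    apply: ler_wpM2r; first by rewrite mulr_ge0 // ltW.
    apply: ler_wpM2r => //; apply: ler_wpM2l; first by rewrite exprn_ge0 // ltW.
    by rewrite lerXn2r ?nnegrE // ltW.
  have := ler_wpM2r (ltW ee0) X2u; move: h1; clear; lra.
have P2 : 110 * 100 * (e1 * k%:R ^+ 4 * N) <= eps * eta.
  have NX : N <= X * (eps * eta) by rewrite -XN ler_peMl // ltW.
  have h1 : e1 * k%:R ^+ 4 * N <= e1 * X ^+ 5 * (eps * eta).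
    have -> : e1 * X ^+ 5 * (eps * eta) = e1 * X ^+ 4 * (X * (eps * eta)) by ring.
    apply: ler_pM => //; rewrite ?mulr_ge0 ?exprn_ge0 ?(ltW e10) ?(ltW N0) //.
    by rewrite ler_pM2l // lerXn2r ?nnegrE // ltW.
  have h2 : 110 * 100 * (e1 * X ^+ 5) <= 1.
    apply: le_trans (e1Z 14%N isT).
    (* The power 3^14 contained in Z^14 exceeds 110 * 100. *)
    have -> : Z ^+ 14 = 3 ^+ 14 * X ^+ 9 * X ^+ 5 by rewrite /Z; ring.
    have X9 : 1 <= X ^+ 9 by apply: exprn_ege1.
    have X5 : 0 <= e1 * X ^+ 5 by rewrite mulr_ge0 ?exprn_ge0 // ltW.
    have := ler_wpM2r X5 X9; move: X5; clear; lra.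
  have := ler_wpM2r (ltW ee0) h2; move: h1; clear; lra.
have prec m : (0 < m <= k)%N -> c * m%:R ^+ 3 * log2 m%:R * u <= e1.
  move=> /andP[m0 mk]; have mY : m%:R <= Y.
    by apply: le_trans XY; apply: le_trans kX; rewrite ler_nat.
  have lmY : log2 m%:R <= Y by apply: le_trans (log2_nat_le R m0) mY.
  have lm0 : 0 <= log2 m%:R :> R by apply: log2_ge0; rewrite ler1n.
  have csY : c <= Y ^+ s by apply: le_trans cs (twoj s).
  rewrite e1E -[leRHS]mul1r ler_pdivlMr //.
  apply: le_trans (Yu (s%:R + 3%:R + 1 + 3 * c') _); last first.
    by rewrite /c0; clear; lra.
  rewrite !powRD ?(lt0r_neq0 Y0) ?implybT // !powR_mulrn ?(ltW Y0) // powRr1 ?(ltW Y0) //.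
  rewrite mulrAC; apply: ler_wpM2r => //.
  have m3 : m%:R ^+ 3 <= Y ^+ 3 by rewrite lerXn2r ?nnegrE // ltW.
  have m30 : 0 <= m%:R ^+ 3 :> R by rewrite exprn_ge0.
  have cm0 := mulr_ge0 (ltW hc) m30.
  have cm := ler_pM (ltW hc) m30 csY m3.
  exact: (ler_pM (mulr_ge0 cm0 lm0) (ltW Zc0) (ler_pM cm0 lm0 cm lmY) ZcY).
have main := always_lanczos mv kappa As x0 k1 eta0 etaN eps0 eps1 fC u0 ugam usum umul P1 P2
  e10 prec hK geP.
apply: always_impl main _ => y t [yE tE]; split=> //.
apply: le_trans tE _.
set l := log2 _.
have l0 : 0 <= l.
  apply: log2_ge0; rewrite ler_pdivlMr // mul1r.
  by apply: le_trans (_ : 1 <= _) => //; have := e1Z 0%N isT; rewrite expr0 mulr1.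
have lB : l <= D * B1.
  rewrite -[leRHS]log2_powR; apply: log2_le; first by rewrite divr_gt0.
  rewrite (mulrC D) powRrM -/Y /D powRD ?(lt0r_neq0 Y0) ?implybT // powRr1 ?(ltW Y0) //.
  rewrite e1E invrK; apply: ler_pM => //; [exact: ltW|exact: le_trans XY].
have l2 : l ^+ 2 <= D ^+ 2 * B1 ^+ 2.
  by rewrite -exprMn lerXn2r ?nnegrE // (le_trans l0).
(* Since n >= 1, the lower bound on [mv] forces it to be positive, so terms free of n are absorbed
   by mv k. *)
have mv1 : 1 <= mv%:R :> R.
  rewrite ler1n lt0n; apply/eqP => mv0; move: nmv; rewrite mv0 mulr0.
  by rewrite leNgt n0r.
pose P := mv%:R * k%:R : R.
have P1' : 1 <= P by rewrite /P -natrM ler1n muln_gt0 -(ltr0n R) (lt_le_trans _ mv1).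
have kP : k%:R <= P by rewrite ler_peMl // ltW.
have nP : n%:R * k%:R <= Kmv * P by rewrite /P mulrA ler_wpM2r.
have nP' : n%:R <= Kmv * P by apply: le_trans nP; rewrite ler_peMr // ltW.
have kk0 : 0 <= k%:R ^+ 2 :> R by rewrite exprn_ge0.
have kkB : k%:R ^+ 2 <= k%:R ^+ 2 * B1 by rewrite ler_peMr.
have kB0 : 0 <= k%:R * B1 ^+ 2 by rewrite mulr_ge0 ?exprn_ge0 // (le_trans _ B11).
have raw : (lanczos_raw_time n k kappa mv)%:R =
  3 * (n%:R * kp) + kp + P + 9 * (n%:R * k%:R * kp) + 2 * (k%:R * kp)
  + 6 * (k%:R ^+ 2 * kp) + 3 * (n%:R * k%:R * kp).
  by rewrite /lanczos_raw_time /lanczos_iter_time /P /kp !(natrD, natrM); ring.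
rewrite raw.
have T1 := ler_wpM2r kp0 nP'; have T2 := ler_wpM2r kp0 nP; have T3 := ler_wpM2r kp0 P1'.
have T4 := ler_wpM2r kp0 kP; have T5 := ler_wpM2r kp0 kkB.
have T6 : K * (k%:R ^+ 2 * l + k%:R * l ^+ 2) <=
  K * (k%:R ^+ 2 * (D * B1) + k%:R * (D ^+ 2 * B1 ^+ 2)).
  by rewrite ler_pM2l //; apply: lerD; apply: ler_wpM2l.
pose Q1 := k%:R ^+ 2 * B1; pose Q2 := k%:R * B1 ^+ 2.
have Q10 : 0 <= Q1 by apply: le_trans kkB.
have P0 : 0 <= P by apply: le_trans P1'.
have -> : Ct * (mv%:R * k%:R + k%:R ^+ 2 * B1 + k%:R * B1 ^+ 2) =
  15 * (Kmv * P * kp) + 3 * (P * kp) + P + 6 * (Q1 * kp)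
  + K * (k%:R ^+ 2 * (D * B1) + k%:R * (D ^+ 2 * B1 ^+ 2))
  + (6 * kp + K * D + K * D ^+ 2) * P
  + (15 * kp * Kmv + 3 * kp + 1 + K * D ^+ 2) * Q1 + (15 * kp * Kmv + 9 * kp + 1 + K * D) * Q2.
  by rewrite /Ct /Q1 /Q2 /P; ring.
have R1 : 0 <= (6 * kp + K * D + K * D ^+ 2) * P by rewrite mulr_ge0 // !addr_ge0 // mulr_ge0.
have R2 : 0 <= (15 * kp * Kmv + 3 * kp + 1 + K * D ^+ 2) * Q1.
  by rewrite mulr_ge0 // !addr_ge0 // mulr_ge0.
have R3 : 0 <= (15 * kp * Kmv + 9 * kp + 1 + K * D) * Q2.
  by rewrite mulr_ge0 // !addr_ge0 // mulr_ge0.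
have Pk : 0 <= P * kp by rewrite mulr_ge0.
rewrite -/Q1 in T5; move: T1 T2 T3 T4 T5 T6 R1 R2 R3 Pk; rewrite mul1r; clear; lra.
Qed.
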